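(* Let $d\geq3$ and $b\geq 3$ be integers, and let $A_{d,b}$ be the $d\times(2d-1)$ integer matrix whose columns are $e_1,\dots,e_{d-1},\ e_1+e_d,\dots,e_{d-1}+e_d,\ b\,e_d$, where $e_1,\dots,e_d$ is the standard basis. Then every point of $\mathbb{Z}^d$ lying in the convex hull of the origin and the columns of $A_{d,b}$ belongs to the exceptional arrangement $\mathcal{E}(A_{d,b})$.
   Context: For a $d\times n$ integer matrix $A=(a_{i,j})$ with columns spanning $\mathbb{Z}^d$ as a lattice, let $D$ be the Weyl algebra over $\mathbb{C}$ generated by $x_1,\dots,x_n,\partial_1,\dots,\partial_n$. The toric ideal is $I_A:=\langle\partial^u-\partial^v\mid u,v\in\mathbb{N}^n, Au=Av\rangle\subseteq\mathbb{C}[\partial_1,\dots,\partial_n]$ ($0\in\mathbb{N}$), and $E_i:=\sum_{j=1}^n a_{i,j}x_j\partial_j$. For $\beta\in\mathbb{C}^d$, $M_A(\beta):=D/D\cdot\langle I_A,E_1-\beta_1,\dots,E_d-\beta_d\rangle$, a holonomic left $D$-module. Its (holonomic) rank, $\operatorname{rank}(M_A(\beta))$, is the dimension of the space of germs of holomorphic solutions at a nonsingular point. $\operatorname{vol}(A)$ is $d!$ times the Euclidean volume of the convex hull in $\mathbb{R}^d$ of the origin and the columns of $A$. The exceptional arrangement is $\mathcal{E}(A):=\{\beta\in\mathbb{C}^d\mid\operatorname{rank}(M_A(\beta))>\operatorname{vol}(A)\}$. *)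

(* Defs.v *)
From HB Require Import structures.
From mathcomp Require Import all_boot all_order all_algebra.
From mathcomp Require mpoly.
From mathcomp Require Import complex.

Set Implicit Arguments.
Unset Strict Implicit.
Unset Printing Implicit Defensive.

Import Order.TTheory GRing.Theory Num.Theory.
Local Open Scope ring_scope.

(* The notations of mpoly.v clash with those of MathComp-Analysis: they are
   imported only inside this module, before the analysis library is loaded. *)
Module Weyl.
Import mpoly.
Local Open Scope multi_scope.
Local Open Scope mpoly_scope.
Local Open Scope ring_scope.

(* An element \sum_a p_a(x) d^a of the n-th Weyl algebra is encoded by its
   normal form: the polynomial \sum_a p_a 'X^a in the d_i with coefficients in
   K[x_1, ..., x_n].  The ring product of {mpoly _} is not the product of the
   Weyl algebra, which is [wmul] below. *)
Definition weyl (K : fieldType) (n : nat) : Type := {mpoly {mpoly K[n]}[n]}.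

Section Algebra.
Context {K : fieldType} {n : nat}.
Implicit Types P Q : {mpoly {mpoly K[n]}[n]}.

Definition xvar (j : 'I_n) : {mpoly {mpoly K[n]}[n]} := ('X_j)%:MP.

Definition dvar (i : 'I_n) : {mpoly {mpoly K[n]}[n]} := 'X_i.

(* d_i p = p d_i + dp/dx_i for p in K[x_1, ..., x_n]. *)
Definition dmul (i : 'I_n) Q : {mpoly {mpoly K[n]}[n]} :=
  'X_i * Q + map_mpoly (mderiv i) Q.

Definition wmul P Q : weyl K n :=
  \sum_(a <- msupp P)
    P@_a *: foldr (fun i S => iter (a i) (dmul i) S) Q (enum 'I_n).

(* Left multiplications by the generators satisfy the Weyl relations. *)
Lemma wmul_xvar (j : 'I_n) Q : wmul (xvar j) Q = 'X_j *: Q.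
Proof.
have X0 : 'X_j != 0 :> {mpoly K[n]}.
  apply/eqP => /(congr1 (mcoeff U_(j)))/eqP.
  by rewrite mcoeffX eqxx mcoeff0 oner_eq0.
rewrite /wmul /xvar msuppC (negPf X0) big_seq1 mcoeffC eqxx mulr1.
by congr (_ *: _); elim: (enum _) => //= i s ->; rewrite mnm0E.
Qed.

Lemma wmul_dvar (i : 'I_n) Q : wmul (dvar i) Q = dmul i Q.
Proof.
rewrite /wmul /dvar msuppX big_seq1 mcoeffX eqxx scale1r.
have := mem_enum 'I_n i; have := enum_uniq 'I_n; rewrite inE.
elim: (enum _) => //= k s IHs /andP[ks us]; rewrite inE mnm1E.
have [eik _|ik /= /(IHs us) -> //] := eqVneq i k; rewrite eik /= in IHs *.
congr dmul; elim: s ks {IHs us} => //= l s IHs.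
by rewrite inE negb_or mnm1E => /andP[/negPf-> /IHs ->].
Qed.

Lemma dmul_xvar (i j : 'I_n) Q :
  dmul i (wmul (xvar j) Q) = wmul (xvar j) (dmul i Q) + Q *+ (i == j).
Proof.
rewrite !wmul_xvar /dmul scalerDr scalerAr -addrA; congr (_ + _).
apply/mpolyP => m; rewrite mcoeffD.
rewrite (mcoeff_map_mpoly (mderiv i)) [in LHS]mcoeffZ.
rewrite /= mderivM.
rewrite [in RHS]mcoeffZ (mcoeff_map_mpoly (mderiv i)) addrC; congr (_ + _).
rewrite mcoeffMn mderivX mnm1E eq_sym.
have [->|_] := eqVneq i j; last by rewrite scale0r mul0r.
suff -> : (U_(j) - U_(j))%MM = 0%MM by rewrite scale1r mpolyX0 mul1r.
by apply/mnmP => k; rewrite mnmBE subnn mnm0E.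
Qed.

Local Lemma mcoeff_mderiv (i : 'I_n) Q (m : 'X_{1..n}) :
  (map_mpoly (mderiv i) Q)@_m = mderiv i Q@_m.
Proof. exact: (mcoeff_map_mpoly (mderiv i)). Qed.

Local Lemma map_mderivZX (i : 'I_n) (c : {mpoly K[n]}) (m : 'X_{1..n}) :
  map_mpoly (mderiv i) (c *: 'X_[m]) = mderiv i c *: 'X_[m].
Proof.
apply/mpolyP => k; rewrite (mcoeff_map_mpoly (mderiv i)) /= !mcoeffZ !mcoeffX.
by case: (m == k); rewrite ?mulr1 ?mulr0 ?mderiv0.
Qed.

Local Lemma map_mderivD (i : 'I_n) P Q :
  map_mpoly (mderiv i) (P + Q) =
  map_mpoly (mderiv i) P + map_mpoly (mderiv i) Q.
Proof. exact: raddfD. Qed.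

Local Lemma map_mderivX (i j : 'I_n) Q :
  map_mpoly (mderiv i) ('X_j * Q) = 'X_j * map_mpoly (mderiv i) Q.
Proof.
elim/mpolyind: Q => [|c m Q _ _ IH].
  by rewrite mulr0 (raddf0 (map_mpoly (mderiv i))) mulr0.
rewrite mulrDr !map_mderivD IH mulrDr; congr (_ + _).
by rewrite -scalerAr -mpolyXD !map_mderivZX -scalerAr -mpolyXD.
Qed.

Lemma dmulC (i j : 'I_n) Q : dmul i (dmul j Q) = dmul j (dmul i Q).
Proof.
have DD : map_mpoly (mderiv i) (map_mpoly (mderiv j) Q) =
          map_mpoly (mderiv j) (map_mpoly (mderiv i) Q).
  apply/mpolyP => m.
  transitivity (mderiv i (mderiv j Q@_m)).
    by rewrite -(mcoeff_mderiv j Q) -mcoeff_mderiv.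
  by rewrite mderiv_comm -(mcoeff_mderiv i Q) -mcoeff_mderiv.
rewrite /dmul !map_mderivD !map_mderivX !mulrDr DD.
have -> : 'X_i * ('X_j * Q) = 'X_j * ('X_i * Q) by exact: mulrCA.
exact: addrACA.
Qed.

Definition left_ideal (G : weyl K n -> Prop) (P : weyl K n) : Prop :=
  exists (k : nat) (Q g : 'I_k -> weyl K n),
    (forall i, G (g i)) /\ P = \sum_(i < k) wmul (Q i) (g i).

(* The principal symbol of P, of order (msize P).-1, evaluated at (x, xi). *)
Definition symbol P (x xi : 'I_n -> K) : K :=
  \sum_(a <- msupp P | mdeg a == (msize P).-1)
    (P@_a).@[x] * \prod_(i < n) xi i ^+ a i.

Definition char_variety (I : weyl K n -> Prop) (x xi : 'I_n -> K) : Prop :=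
  forall P, I P -> symbol P x xi = 0.

(* x lies outside the singular locus of D/I, the projection of the
   characteristic variety minus the zero section. *)
Definition nonsingular (I : weyl K n -> Prop) (x : 'I_n -> K) : Prop :=
  forall xi, char_variety I x xi -> forall i, xi i = 0.

End Algebra.

Section Hypergeometric.
Context {K : fieldType} {d n : nat} (A : 'M[int]_(d, n)).

Definition toric_ideal (f : {mpoly K[n]}) : Prop :=
  exists (k : nat) (q : 'I_k -> {mpoly K[n]}) (u v : 'I_k -> 'X_{1..n}),
    (forall i, A *m (\col_j (u i j)%:Z) = A *m (\col_j (v i j)%:Z)) /\
    f = \sum_(i < k) q i * ('X_[u i] - 'X_[v i]).

(* K[d_1, ..., d_n] as a subring of the Weyl algebra. *)
Definition const_coef (f : {mpoly K[n]}) : weyl K n :=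
  map_mpoly (fun c : K => c%:MP : {mpoly K[n]}) f.

Definition euler (i : 'I_d) : weyl K n :=
  \sum_(j < n) wmul (xvar j) (dvar j) *~ A i j.

Definition hyp_generator (beta : 'cV[K]_d) (P : weyl K n) : Prop :=
  (exists2 f, toric_ideal f & P = const_coef f) \/
  (exists i, P = euler i - (beta i 0)%:MP%:MP).

(* M_A(beta) is the quotient of the Weyl algebra by this left ideal. *)
Definition hyp_ideal (beta : 'cV[K]_d) : weyl K n -> Prop :=
  left_ideal (hyp_generator beta).

End Hypergeometric.

(* The action \sum_a p_a(x) d^a f at x, given the partial derivatives d^a f
   of f at x. *)
Definition eval_op {K : fieldType} {n : nat} (P : weyl K n)
    (x : 'I_n -> K) (df : ('I_n -> nat) -> K) : K :=
  \sum_(a <- msupp P) (P@_a).@[x] * df a.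

End Weyl.

From mathcomp Require Import all_classical all_reals all_analysis.
Import numFieldNormedType.Exports.
Local Open Scope classical_set_scope.

Section Solutions.
(* C is instantiated to R[i]; R only serves for the values in \bar R. *)
Context (R : realType) {C : numFieldType} {n : nat}.
Implicit Types (p : 'rV[C]_n) (f : 'rV[C]_n -> C).

Definition partial (i : 'I_n) f : 'rV[C]_n -> C :=
  fun z => 'D_(delta_mx 0 i) f z.

Definition mpartial (a : 'I_n -> nat) f : 'rV[C]_n -> C :=
  foldr (fun i g => iter (a i) (partial i) g) f (enum 'I_n).

Definition act (P : Weyl.weyl C n) f : 'rV[C]_n -> C :=
  fun z => Weyl.eval_op P (z 0) (fun a => mpartial a f z).

(* Germs at p are represented by total functions, considered near p only. *)
Definition holomorphic_at p f : Prop := \forall z \near p, differentiable f z.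

Definition solution_germ (I : Weyl.weyl C n -> Prop) p f : Prop :=
  holomorphic_at p f /\ forall P, I P -> \forall z \near p, act P f z = 0.

Definition free_germs p (m : nat) (F : 'I_m -> 'rV[C]_n -> C) : Prop :=
  forall c : 'I_m -> C,
    (\forall z \near p, \sum_(k < m) c k * F k z = 0) -> forall k, c k = 0.

Definition sol_dim (I : Weyl.weyl C n -> Prop) p : \bar R :=
  ereal_sup [set m%:R%:E | m in [set m : nat |
    exists F : 'I_m -> 'rV[C]_n -> C,
      (forall k, solution_germ I p (F k)) /\ free_germs p F]].

(* For a holonomic D/I the nonsingular points form a nonempty connected open
   set, on which sol_dim is constant; the supremum is this common value. *)
Definition holonomic_rank (I : Weyl.weyl C n -> Prop) : \bar R :=
  ereal_sup [set sol_dim I p |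
    p in [set p : 'rV[C]_n | Weyl.nonsingular I (p 0)]].

End Solutions.

Section Volume.
Context {R : realType}.

Definition convex_hull (V : lmodType R) (S : set V) : set V :=
  [set x | exists (k : nat) (l : 'I_k -> R) (y : 'I_k -> V),
    [/\ forall i, 0 <= l i, \sum_(i < k) l i = 1, forall i, S (y i) &
        x = \sum_(i < k) l i *: y i]].

(* The Lebesgue measure on R^d, as the d-fold product measure. *)
Fixpoint lebesgue_tuple (d : nat) : set (d.-tuple R) -> \bar R :=
  match d with
  | 0 => \d_[tuple]
  | d'.+1 => fun S =>
      ((@lebesgue_measure R) \x @lebesgue_tuple d')%E
        [set z : R * d'.-tuple R | S (cons_tuple z.1 z.2)]
  end.

Definition euclidean_volume (d : nat) (S : set 'cV[R]_d) : \bar R :=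
  lebesgue_tuple [set t : d.-tuple R | S (\col_i tnth t i)].

Definition newton_polytope (d n : nat) (A : 'M[int]_(d, n)) : set 'cV[R]_d :=
  convex_hull ([set 0] `|` range (fun j => map_mx intr (col j A))).

Definition normalized_volume (d n : nat) (A : 'M[int]_(d, n)) : \bar R :=
  ((d`!)%:R%:E * euclidean_volume (newton_polytope A))%E.

End Volume.

Definition exceptional_arrangement {R : realType} (d n : nat)
    (A : 'M[int]_(d, n)) : set 'cV[R[i]]_d :=
  [set beta |
    (normalized_volume A < holonomic_rank R (Weyl.hyp_ideal A beta))%E].

(* basis_vec d k is e_{k+1}: rows and columns are numbered from 0. *)
Definition basis_vec (d k : nat) : 'cV[int]_d := \col_i (i == k :> nat)%:R.

Definition Adb (d b : nat) : 'M[int]_(d, 2 * d - 1) :=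
  \matrix_(i, j)
    (if (j < d - 1)%N then basis_vec d j
     else if (j < 2 * (d - 1))%N then
       basis_vec d (j - (d - 1)) + basis_vec d (d - 1)
     else basis_vec d (d - 1) *+ b) i 0.

(* Main.v *)
(* Write x_i, y_i, z for the variables of the columns e_i, e_i + e_d, b e_d, and
   put rho_i = - x_i / y_i and tau_i = z rho_i^b.  For beta = k e_d each block
   x_i, y_i, z carries b solutions rho_i^-k G(tau_i), where G is a component of a
   solution of a linear system s Y' = (A + s B) Y, solved by power series around
   the nonzero value of tau_i at a nonsingular point.  For beta = e_o + k e_d the
   block i carries b - 1 solutions x_o g + y_o gt, with g and gt of this shape,
   and x_o z^(k/b), y_o z^((k-1)/b) are two more.  The resulting (d - 1) b, resp.
   (d - 1)(b - 1) + 2, independent germs are at least d + b in number, whereas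
   vol(A) <= d - 1 + b, by integrating over the simplex of the first d - 1
   coordinates the upper bound b - (b - 1) (v_1 + ... + v_(d-1)) of v_d. *)
From HB Require Import structures.
Require Import Defs.
From mathcomp Require Import all_boot all_order all_algebra.
From mathcomp Require mpoly.
From mathcomp Require Import ring lra zify.

Set Implicit Arguments.
Unset Strict Implicit.
Unset Printing Implicit Defensive.

Import Order.TTheory GRing.Theory Num.Theory.
Local Open Scope ring_scope.

(** * Differential algebras and the action of the Weyl algebra *)

(** Inside one block the toric equations only trade b derivatives in y for b in x and one in z. The
    Euler equation of the block reads Dy = rho Dx with rho = - x / y, so the first derivatives of a
    solution are - h / y and - rho h / y. For f a function of rho and z, Dy (f / y) = Dx (rho f /
    y); hence a derivative with M >= 1 factors in x and y, of which c in y, and q factors in z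
    equals - Dx^(M - 1) (rho^c Dz^q h / y). So rho^b h = Dz h may fail: it is enough that the defect
    rho^b h - Dz h be polynomial in x of degree at most b - 2, or b - 3 for beta = e_o + k e_d,
    where one derivative goes into the factors x_o, y_o. The defects rho^l z^((k + l + 1) / b - 1)
    of admissible degree, and the zero defect, give the b, resp. b - 1, solutions of a block. A
    prescribed defect makes the equation of h inhomogeneous; its source term is carried along as one
    more unknown, which keeps the system linear.

    The counts of solutions exceed d + b by (d - 2)(b - 1) - 2, resp. (d - 2)(b - 2) - 1, both zero
    at d = b = 3. *)

Record diff_alg (K : fieldType) (n : nat) := DiffAlg {
  da_ring :> comNzRingType;
  da_cst : {rmorphism K -> da_ring};
  da_var : 'I_n -> da_ring;
  da_D : 'I_n -> da_ring -> da_ring;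
  da_DD : forall i f g, da_D i (f + g) = da_D i f + da_D i g;
  da_DM : forall i f g, da_D i (f * g) = da_D i f * g + f * da_D i g;
  da_DC : forall i j f, da_D i (da_D j f) = da_D j (da_D i f);
  da_Dcst : forall i c, da_D i (da_cst c) = 0;
  da_Dvar : forall i j, da_D i (da_var j) = (i == j)%:R }.

Module WeylAction.
Import mpoly.
Local Open Scope multi_scope.
Local Open Scope mpoly_scope.
Local Open Scope ring_scope.
Import Weyl.

Lemma mnm_ind n (P : 'X_{1..n} -> Prop) : P 0%MM ->
  (forall i a, P a -> P (U_(i) + a)%MM) -> forall a, P a.
Proof.
move=> P0 PS a; have [k] := ubnP (mdeg a); elim: k a => // k IH a ak.
have [/eqP|] := eqVneq (mdeg a) 0%N; first by rewrite mdeg_eq0 => /eqP ->.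
rewrite mdeg_eq0 => /eqP a0; have [i ai] : exists i, (0 < a i)%N.
  apply/existsP; apply: contra_notT a0 => /existsPn H; apply/mnmP => i; rewrite mnm0E.
  by apply/eqP; rewrite -leqn0 leqNgt H.
have E : a = (U_(i) + (a - U_(i)))%MM by rewrite addmC submK // lep1mP -lt0n.
by rewrite E; apply/PS/IH; move: ak; rewrite {1}E mdegD mdeg1.
Qed.

Section Action.
Context {K : fieldType} {n : nat} (W : diff_alg K n).
Local Notation D := (@da_D K n W).
Local Notation X := (@da_var K n W).
Local Notation cst := (@da_cst K n W).
Implicit Types (f g : W) (i j : 'I_n) (a : 'X_{1..n}).

Lemma D0 i : D i 0 = 0.
Proof. by rewrite -[X in D i X](rmorph0 cst) da_Dcst. Qed.

Lemma D1 i : D i 1 = 0.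
Proof. by rewrite -[X in D i X](rmorph1 cst) da_Dcst. Qed.

Lemma Dsum i (I : Type) (r : seq I) (P : pred I) (F : I -> W) :
  D i (\sum_(k <- r | P k) F k) = \sum_(k <- r | P k) D i (F k).
Proof. exact: (big_morph (D i) (da_DD i) (D0 i)). Qed.

Lemma DcstM i c f : D i (cst c * f) = cst c * D i f.
Proof. by rewrite da_DM da_Dcst mul0r add0r. Qed.

Definition mD (a : 'I_n -> nat) f : W :=
  foldr (fun i g => iter (a i) (D i) g) f (enum 'I_n).

Lemma D_iter i j m f : D i (iter m (D j) f) = iter m (D j) (D i f).
Proof. by elim: m => //= m IH; rewrite da_DC IH. Qed.

Lemma mD0 f : mD 0%MM f = f.
Proof. by rewrite /mD; elim: (enum _) => //= i s ->; rewrite mnm0E. Qed.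

Lemma D_mD i (a : 'I_n -> nat) f : D i (mD a f) = mD a (D i f).
Proof. by rewrite /mD; elim: (enum _) => //= j s IH; rewrite D_iter IH. Qed.

(** The derivations commute, so one more [D i] can be moved to its place in the fixed order of
    [enum 'I_n] that [mD] follows. *)
Lemma mD_add1 a i f : mD (a + U_(i))%MM f = D i (mD a f).
Proof.
rewrite /mD; have := mem_enum 'I_n i; have := enum_uniq 'I_n; rewrite inE.
elim: (enum _) => //= k s IHs /andP[ks us]; rewrite inE mnmDE mnm1E.
have [eik _|ik /= /(IHs us) -> //] := eqVneq i k; last first.
  by rewrite addn0 -D_iter.
rewrite eik /= in IHs *; rewrite addn1 iterS.
suff -> : foldr (fun i g => iter ((a + U_(k))%MM i) (D i) g) f s =
  foldr (fun i g => iter (a i) (D i) g) f s by [].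
elim: s ks {IHs us} => //= l s IHs.
by rewrite inE negb_or mnmDE mnm1E => /andP[/negPf-> /IHs ->]; rewrite addn0.
Qed.

Lemma mDz (a : 'I_n -> nat) : mD a 0 = 0.
Proof.
rewrite /mD; elim: (enum _) => //= j s ->.
by elim: (a j) => //= m ->; rewrite D0.
Qed.

Definition pev : {mpoly K[n]} -> W := mmap cst X.

HB.instance Definition _ := GRing.RMorphism.on pev.

Lemma pevX i : pev 'X_i = X i.
Proof. by rewrite /pev mmapX mmap1U. Qed.

Lemma pevC c : pev c%:MP = cst c.
Proof. exact: mmapC. Qed.

Lemma pevM p q : pev (p * q) = pev p * pev q.
Proof. exact: rmorphM. Qed.

Lemma pevD p q : pev (p + q) = pev p + pev q.
Proof. exact: rmorphD. Qed.

Lemma pev0 : pev 0 = 0. Proof. exact: rmorph0. Qed.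

Lemma pev1 : pev 1 = 1. Proof. exact: rmorph1. Qed.

Lemma D_pev i (p : {mpoly K[n]}) : D i (pev p) = pev (mderiv i p).
Proof.
have step j q : D i (pev q) = pev (mderiv i q) ->
    D i (pev ('X_j * q)) = pev (mderiv i ('X_j * q)).
  move=> IH; rewrite pevM da_DM IH mderivM pevD !pevM pevX da_Dvar.
  congr (_ * _ + _); rewrite mderivX mnm1E eq_sym.
  have [->|_] := eqVneq i j; last by rewrite scale0r pev0.
  suff -> : (U_(j) - U_(j))%MM = 0%MM by rewrite mpolyX0 scale1r pev1.
  by apply/mnmP => k; rewrite mnmBE subnn mnm0E.
have X1 a : D i (pev 'X_[a]) = pev (mderiv i 'X_[a]).
  elim/mnm_ind : a => [|j a IH]; first by rewrite mpolyX0 -mpolyC1 mderivC pevC da_Dcst pev0.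
  by rewrite mpolyXD; exact: step.
elim/mpolyind : p => [|c a p _ _ IH]; first by rewrite mderiv0 !pev0 D0.
rewrite mderivD !pevD da_DD IH; congr (_ + _).
by rewrite -mul_mpolyC mderivM mderivC mul0r add0r !pevM pevC DcstM X1.
Qed.

(** The algebraic counterpart of [act]. It makes the differential algebra a left module over the
    Weyl algebra, so that annihilation has to be checked on generators of a left ideal only. *)
Definition dact (P : weyl K n) f : W := \sum_(a <- msupp P) pev P@_a * mD a f.

(** The support of [P] is replaced by an index set that several operators can share, which makes
    additivity in [P] a termwise matter. *)
Lemma dactE (P : weyl K n) f k : (msize P <= k)%N ->
  dact P f = \sum_(a : 'X_{1..n < k}) pev P@_a * mD a f.
Proof.
move=> Pk; set I : subFinType _ := 'X_{1..n < k}.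
rewrite /dact (ssrcomplements.big_mksub I) ?msupp_uniq //=; first last.
  by move=> a /msize_mdeg_lt/leq_trans; apply.
rewrite big_rmcond //= => a /memN_msupp_eq0 ->.
by rewrite pev0 mul0r.
Qed.

Lemma dactD P Q f : dact (P + Q) f = dact P f + dact Q f.
Proof.
pose k := maxn (msize P) (msize Q).
rewrite (@dactE P f k) ?leq_maxl // (@dactE Q f k) ?leq_maxr //.
rewrite (@dactE (P + Q) f k); last exact: msizeD_le.
by rewrite -big_split; apply: eq_bigr => a _; rewrite mcoeffD pevD mulrDl.
Qed.

Lemma dactZX (c : {mpoly K[n]}) a f : dact (c *: 'X_[a]) f = pev c * mD a f.
Proof.
have [->|c0] := eqVneq c 0.
  by rewrite scale0r pev0 mul0r /dact msupp0 big_nil.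
by rewrite /dact msuppMCX // big_seq1 mcoeffZ mcoeffX eqxx mulr1.
Qed.

Lemma dact0 f : dact 0 f = 0.
Proof. by rewrite /dact msupp0 big_nil. Qed.

Lemma dact_sum (I : Type) (r : seq I) (P : pred I) (F : I -> weyl K n) f :
  dact (\sum_(i <- r | P i) F i) f = \sum_(i <- r | P i) dact (F i) f.
Proof. exact: (big_morph (dact^~ f) (fun P Q => dactD P Q f) (dact0 f)). Qed.

Lemma dactZ (c : {mpoly K[n]}) P f : dact (c *: P) f = pev c * dact P f.
Proof.
elim/mpolyind : P => [|e a P _ _ IH]; first by rewrite scaler0 dact0 mulr0.
by rewrite scalerDr !dactD IH scalerA !dactZX pevM mulrDr mulrA.
Qed.

Lemma dactN P f : dact (- P) f = - dact P f.
Proof.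
have -> : - P = (-1)%:MP *: P by rewrite mpolyCN mpolyC1 scaleN1r.
by rewrite dactZ pevC rmorphN rmorph1 mulN1r.
Qed.

(** On a monomial this is the Leibniz rule, matched with the relation d_i p = p d_i + dp/dx_i built
    into [dmul]. *)
Lemma dact_dmul i P f : dact (dmul i P) f = D i (dact P f).
Proof.
elim/mpolyind : P => [|c a P _ _ IH].
  by rewrite /dmul mulr0 add0r (raddf0 (map_mpoly (mderiv i))) dact0 D0.
have -> : dmul i (c *: 'X_[a] + P) = dmul i (c *: 'X_[a]) + dmul i P.
  by rewrite /dmul mulrDr Defs.Weyl.map_mderivD addrACA.
apply: etrans (dactD (dmul i (c *: 'X_[a])) (dmul i P) f) _.
apply: etrans (esym (congr1 (D i) (dactD (c *: 'X_[a]) P f))).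
apply: etrans _ (esym (da_DD i (dact (c *: 'X_[a]) f) (dact P f))).
apply: (congr2 +%R _ IH).
rewrite /dmul Defs.Weyl.map_mderivZX -scalerAr -mpolyXD.
apply: etrans (dactD (c *: 'X_[U_(i) + a]) (mderiv i c *: 'X_[a]) f) _.
by rewrite !dactZX da_DM D_pev [RHS]addrC addmC mD_add1.
Qed.

Lemma dact_wmul P Q f : dact (wmul P Q) f = dact P (dact Q f).
Proof.
rewrite /wmul dact_sum; apply: eq_bigr => a _; rewrite dactZ; congr (_ * _).
rewrite /mD; elim: (enum _) => //= i s <-.
by elim: (a i) => //= m IH; rewrite dact_dmul IH.
Qed.

Lemma dact_z P : dact P 0 = 0.
Proof. by rewrite /dact big1 // => a _; rewrite mDz mulr0. Qed.

Lemma dact_left_ideal (G : weyl K n -> Prop) f :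
  (forall P, G P -> dact P f = 0) -> forall P, left_ideal G P -> dact P f = 0.
Proof.
move=> Gf P [k [Q [g [Gg ->]]]]; rewrite dact_sum big1 // => i _.
by rewrite dact_wmul Gf // dact_z.
Qed.

Section HypergeometricAction.
Context {d : nat} (A : 'M[int]_(d, n)).

Lemma const_coefE (f : {mpoly K[n]}) :
  const_coef f = map_mpoly (mpolyC n (R := K)) f.
Proof. by []. Qed.

Lemma const_coef_sum (I : Type) (r : seq I) (F : I -> {mpoly K[n]}) :
  const_coef (\sum_(i <- r) F i) = \sum_(i <- r) const_coef (F i).
Proof. exact: (raddf_sum (map_mpoly (mpolyC n (R := K)))). Qed.

Lemma const_coefB (p q : {mpoly K[n]}) :
  const_coef (p - q) = const_coef p - const_coef q.
Proof. exact: (raddfB (map_mpoly (mpolyC n (R := K)))). Qed.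

Lemma const_coefZX (c : K) (a : 'X_{1..n}) :
  const_coef (c *: 'X_[a]) = c%:MP *: 'X_[a].
Proof. by rewrite const_coefE map_mpolyZ map_mpolyX. Qed.

Lemma dact_const_coefXM (q : {mpoly K[n]}) (u : 'X_{1..n}) f :
  dact (const_coef (q * 'X_[u])) f =
  \sum_(a <- msupp q) cst q@_a * mD (u + a)%MM f.
Proof.
rewrite {1}(mpolyE q) mulr_suml const_coef_sum dact_sum.
apply: eq_bigr => a _.
by rewrite -scalerAl -mpolyXD addmC const_coefZX dactZX pevC.
Qed.

Definition toric_solution f := forall u v : 'X_{1..n},
  A *m (\col_j (u j)%:Z) = A *m (\col_j (v j)%:Z) -> mD u f = mD v f.

(** A multiplier d^a replaces the exponents u, v by u + a, v + a, which still have the same image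
    under [A]. *)
Lemma dact_toric f p : toric_solution f -> toric_ideal A p ->
  dact (const_coef p) f = 0.
Proof.
move=> tf [k [q [u [v [uv ->]]]]].
rewrite const_coef_sum dact_sum big1 // => i _.
rewrite (congr1 (fun r => dact (const_coef r) f)
  (mulrBr (q i) 'X_[u i] 'X_[v i])).
rewrite (congr1 (dact^~ f) (const_coefB (q i * 'X_[u i]) (q i * 'X_[v i]))).
apply: etrans (dactD (const_coef (q i * 'X_[u i])) (- const_coef (q i * 'X_[v i])) f) _.
apply: etrans (congr2 +%R (dact_const_coefXM (q i) (u i) f)
  (etrans (dactN (const_coef (q i * 'X_[v i])) f)
    (congr1 -%R (dact_const_coefXM (q i) (v i) f)))) _.
apply/eqP; rewrite subr_eq0; apply/eqP; apply: eq_bigr => a _.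
congr (_ * _); apply: tf.
have E (w : 'X_{1..n}) : A *m \col_j ((w + a)%MM j)%:Z =
    A *m (\col_j (w j)%:Z) + A *m (\col_j (a j)%:Z).
  by rewrite -mulmxDr; congr (_ *m _); apply/colP => j; rewrite !mxE mnmDE PoszD.
by rewrite !E uv.
Qed.

Lemma dact_euler (i : 'I_d) (c : K) f :
  dact (euler A i - c%:MP%:MP) f =
  \sum_j (X j * D j f) *~ A i j - cst c * f.
Proof.
apply: etrans (dactD (euler A i) (- c%:MP%:MP) f) _.
apply: etrans (congr1 (+%R _) (dactN c%:MP%:MP f)) _.
have -> : dact c%:MP%:MP f = cst c * f.
  by rewrite -[c%:MP%:MP]mulr1 mul_mpolyC -mpolyX0 dactZX pevC mD0.
congr (_ - _); rewrite /euler dact_sum.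
apply: eq_bigr => j _.
have Mz (x : {mpoly {mpoly K[n]}[n]}) z : dact (x *~ z) f = dact x f *~ z.
  by apply: (raddfMz (HB.pack (dact^~ f)
    (GRing.isZmodMorphism.Build _ _ (dact^~ f)
      (fun x y => etrans (dactD x (-y) f) (congr1 _ (dactN y f)))) :
    {additive {mpoly {mpoly K[n]}[n]} -> W})).
rewrite Mz wmul_xvar dactZ pevX; congr (_ * _ *~ _).
by rewrite /dvar -['X_j]scale1r dactZX pev1 mul1r -[in LHS](add0m U_(j)) mD_add1 mD0.
Qed.

Lemma dact_hyp_ideal (beta : 'cV[K]_d) f : toric_solution f ->
  (forall i : 'I_d, \sum_j (X j * D j f) *~ A i j = cst (beta i 0) * f) ->
  forall P, hyp_ideal A beta P -> dact P f = 0.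
Proof.
move=> tf ef; apply: dact_left_ideal => P [[p tp ->]|[i ->]].
  exact: dact_toric tf tp.
by rewrite dact_euler ef subrr.
Qed.

End HypergeometricAction.

(** The bridge to [act]: evaluation at a point is a ring morphism that fixes the constants, and it
    carries the abstract action to the pointwise one. *)
Lemma eval_op_rmorph (e : {rmorphism W -> K}) (P : weyl K n) f :
  cancel cst e ->
  eval_op P (fun j => e (X j)) (fun a : 'I_n -> nat => e (mD a f)) = e (dact P f).
Proof.
move=> ce; rewrite /dact rmorph_sum; apply: eq_bigr => a _.
rewrite rmorphM; congr (_ * _).
rewrite /pev /mmap /meval /mmap rmorph_sum; apply: eq_bigr => m _ /=.
rewrite rmorphM /= ce /mmap1 rmorph_prod; congr (_ * _).
by apply: eq_bigr => i _; rewrite rmorphXn.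
Qed.

End Action.
End WeylAction.

(** * The three kinds of columns of [Adb] and its entries *)

Section Columns.
Context {d : nat}.

Fact col_x_subproof (j : 'I_(d - 1)) : (j < 2 * d - 1)%N.
Proof. have := ltn_ord j; lia. Qed.

Fact col_y_subproof (j : 'I_(d - 1)) : (d - 1 + j < 2 * d - 1)%N.
Proof. have := ltn_ord j; lia. Qed.

Definition col_x (j : 'I_(d - 1)) : 'I_(2 * d - 1) := Ordinal (col_x_subproof j).
Definition col_y (j : 'I_(d - 1)) : 'I_(2 * d - 1) := Ordinal (col_y_subproof j).

Hypothesis d0 : (0 < d)%N.

Fact col_z_subproof : (2 * (d - 1) < 2 * d - 1)%N.
Proof. lia. Qed.

Definition col_z : 'I_(2 * d - 1) := Ordinal col_z_subproof.

Fact row_last_subproof : (d - 1 < d)%N.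
Proof. lia. Qed.

Definition row_last : 'I_d := Ordinal row_last_subproof.

Definition row_of (j : 'I_(d - 1)) : 'I_d := widen_ord (leq_subr 1 d) j.

Variant col_spec (c : 'I_(2 * d - 1)) : Type :=
| ColX j of c = col_x j
| ColY j of c = col_y j
| ColZ of c = col_z.

Lemma columnP c : col_spec c.
Proof.
have [cx|cx] := ltnP c (d - 1); first by apply: (@ColX _ (Ordinal cx)); exact: val_inj.
have [cy|cy] := ltnP c (2 * (d - 1)).
  have cy' : (c - (d - 1) < d - 1)%N by lia.
  by apply: (@ColY _ (Ordinal cy')); apply: val_inj => /=; lia.
by apply: ColZ; apply: val_inj => /=; have := ltn_ord c; lia.
Qed.

Lemma adb_rowP (i : 'I_d) : (exists j, i = row_of j) \/ i = row_last.
Proof.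
have [ix|ix] := ltnP i (d - 1); last first.
  by right; apply: val_inj => /=; have := ltn_ord i; lia.
by left; exists (Ordinal ix); exact: val_inj.
Qed.

Lemma eq_col_x i j : (col_x i == col_x j) = (i == j).
Proof. by []. Qed.

Lemma eq_col_y i j : (col_y i == col_y j) = (i == j).
Proof. by rewrite -!val_eqE /= eqn_add2l. Qed.

Lemma eq_col_xy i j : (col_x i == col_y j) = false.
Proof. by clear d0; rewrite -val_eqE /=; have := ltn_ord i; lia. Qed.

Lemma eq_col_yx i j : (col_y i == col_x j) = false.
Proof. by rewrite eq_sym eq_col_xy. Qed.

Lemma eq_col_xz i : (col_x i == col_z) = false.
Proof. by rewrite -val_eqE /=; have := ltn_ord i; lia. Qed.

Lemma eq_col_zx i : (col_z == col_x i) = false.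
Proof. by rewrite eq_sym eq_col_xz. Qed.

Lemma eq_col_yz i : (col_y i == col_z) = false.
Proof. by rewrite -val_eqE /=; have := ltn_ord i; lia. Qed.

Lemma eq_col_zy i : (col_z == col_y i) = false.
Proof. by rewrite eq_sym eq_col_yz. Qed.

Lemma sum_col (V : nmodType) (F : 'I_(2 * d - 1) -> V) :
  \sum_c F c = \sum_j F (col_x j) + \sum_j F (col_y j) + F col_z.
Proof.
have E : (d - 1 + (d - 1 + 1) = 2 * d - 1)%N by lia.
rewrite (reindex (cast_ord E)) /=; last first.
  by exists (cast_ord (esym E)) => i _; rewrite ?cast_ordK ?cast_ordKV.
rewrite !big_split_ord /= big_ord1 addrA; congr (_ + _ + _).
- by apply: eq_bigr => j _; congr F; apply: val_inj.
- by apply: eq_bigr => j _; congr F; apply: val_inj.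
- by congr F; apply: val_inj => /=; lia.
Qed.

Variable b : nat.
Local Notation A := (Adb d b).

Lemma Adb_rx i j : A (row_of i) (col_x j) = (i == j)%:R.
Proof. by rewrite !mxE /= ltn_ord mxE. Qed.

Lemma Adb_ry i j : A (row_of i) (col_y j) = (i == j)%:R.
Proof.
clear d0; rewrite !mxE /= ltnNge leq_addr /= ifT; last by have := ltn_ord j; lia.
by rewrite !mxE /= addKn (ltn_eqF (ltn_ord i)) addr0.
Qed.

Lemma Adb_rz i : A (row_of i) col_z = 0.
Proof.
rewrite !mxE /= ifF; last by lia.
by rewrite ltnn mulmxnE mxE /= ltn_eqF ?mul0rn ?ltn_ord.
Qed.

Lemma Adb_lx j : A row_last (col_x j) = 0.
Proof. by rewrite !mxE /= ltn_ord mxE gtn_eqF. Qed.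

Lemma Adb_ly j : A row_last (col_y j) = 1.
Proof.
rewrite !mxE /= ltnNge leq_addr /= ifT; last by have := ltn_ord j; lia.
by rewrite !mxE /= addKn eqxx gtn_eqF ?ltn_ord // add0r.
Qed.

Lemma Adb_lz : A row_last col_z = b%:R.
Proof.
rewrite !mxE /= ifF; last by lia.
by rewrite ltnn mulmxnE mxE eqxx.
Qed.

End Columns.
Arguments col_x {d} j.
Arguments col_y {d} j.
(** * Nonsingular points *)

Module Nonsingular.
Import mpoly.
Local Open Scope multi_scope.
Local Open Scope mpoly_scope.
Local Open Scope ring_scope.
Import Weyl.

Section Symbol.
Context {K : fieldType} {n : nat}.
Implicit Types (P Q : {mpoly {mpoly K[n]}[n]}) (x xi : 'I_n -> K).

(** The order [D] is a parameter here, whereas in [symbol] it is the order of the operator; with [D]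
    fixed the value is additive in [P]. *)
Definition symbol_at D x xi P : K :=
  \sum_(a <- msupp P | mdeg a == D) (P@_a).@[x] * \prod_(i < n) xi i ^+ a i.

Lemma symbol_atE D x xi P k : (msize P <= k)%N -> symbol_at D x xi P =
  \sum_(a : 'X_{1..n < k} | mdeg a == D) (P@_a).@[x] * \prod_(i < n) xi i ^+ a i.
Proof.
move=> Pk; set I : subFinType _ := 'X_{1..n < k}.
rewrite /symbol_at (ssrcomplements.big_mksub_cond I) ?msupp_uniq //=; first last.
  by move=> a /msize_mdeg_lt/leq_trans/(_ Pk) ->.
rewrite -big_filter_cond big_rmcond ?big_filter //=.
by move=> a /memN_msupp_eq0 ->; rewrite meval0 mul0r.
Qed.

Lemma symbol_atD D x xi P Q :
  symbol_at D x xi (P + Q) = symbol_at D x xi P + symbol_at D x xi Q.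
Proof.
pose k := maxn (msize P) (msize Q).
rewrite (@symbol_atE D x xi P k) ?leq_maxl //.
rewrite (@symbol_atE D x xi Q k) ?leq_maxr //.
rewrite (@symbol_atE D x xi (P + Q) k); last exact: msizeD_le.
by rewrite -big_split; apply: eq_bigr => a _; rewrite mcoeffD mevalD mulrDl.
Qed.

Lemma symbol_at0 D x xi : symbol_at D x xi 0 = 0.
Proof. by rewrite /symbol_at msupp0 big_nil. Qed.

Lemma symbol_at_sum D x xi (I : Type) (r : seq I) (F : I -> {mpoly {mpoly K[n]}[n]}) :
  symbol_at D x xi (\sum_(i <- r) F i) = \sum_(i <- r) symbol_at D x xi (F i).
Proof.
exact: (big_morph (symbol_at D x xi) (symbol_atD D x xi) (symbol_at0 D x xi)).
Qed.

Lemma symbol_atZX D x xi (c : {mpoly K[n]}) (a : 'X_{1..n}) :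
  symbol_at D x xi (c *: 'X_[a]) =
  if mdeg a == D then c.@[x] * \prod_(i < n) xi i ^+ a i else 0.
Proof.
have [->|c0] := eqVneq c 0.
  by rewrite scale0r symbol_at0 meval0 mul0r if_same.
rewrite /symbol_at msuppMCX // big_mkcond big_seq1.
by rewrite mcoeffZ mcoeffX eqxx mulr1.
Qed.

(** If the order of [P] is exactly [D] this is the definition of the characteristic variety; if it
    is smaller, no exponent of degree [D] occurs in [P]. *)
Lemma char_variety_symbol D (I : weyl K n -> Prop) x xi P :
  char_variety I x xi -> I P -> (msize P <= D.+1)%N -> symbol_at D x xi P = 0.
Proof.
move=> cv IP; rewrite leq_eqVlt => /predU1P[PD|PD].
  by have := cv P IP; rewrite /symbol PD.
rewrite /symbol_at big_seq_cond big1 // => a /andP[ap /eqP aD].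
by have := leq_trans (msize_mdeg_lt ap) PD; rewrite aD ltnn.
Qed.

Lemma wmul1 P : wmul 1 P = P.
Proof.
rewrite /wmul msupp1 big_seq1 mcoeff1 eqxx scale1r.
by elim: (enum _) => //= i s ->; rewrite mnm0E.
Qed.

Lemma left_ideal_gen (G : weyl K n -> Prop) P : G P -> left_ideal G P.
Proof.
by move=> GP; exists 1%N, (fun=> 1), (fun=> P); rewrite big_ord1 wmul1.
Qed.

End Symbol.

Section Hyp.
Context {K : fieldType} {d n : nat} (A : 'M[int]_(d, n)) (beta : 'cV[K]_d).
Variables (x xi : 'I_n -> K).
Hypothesis cv : char_variety (hyp_ideal A beta) x xi.

(** The principal symbol of d^u - d^v is the whole binomial for equal degrees and the monomial of
    [u] when [u] has the larger degree; the boolean factor covers both cases. *)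
Lemma char_variety_toric (u v : 'X_{1..n}) : (mdeg v < mdeg u)%N \/ mdeg v = mdeg u ->
  A *m (\col_j (u j)%:Z) = A *m (\col_j (v j)%:Z) ->
  \prod_i xi i ^+ u i = (mdeg v == mdeg u)%:R * \prod_i xi i ^+ v i.
Proof.
move=> vu Auv.
have dvu : (mdeg v <= mdeg u)%N by case: vu => [/ltnW|->].
pose P : {mpoly {mpoly K[n]}[n]} := 1 *: 'X_[u] + (- 1) *: 'X_[v].
have IP : hyp_ideal A beta P.
  apply: left_ideal_gen; left; exists ('X_[u] - 'X_[v]).
    by exists 1%N, (fun=> 1), (fun=> u), (fun=> v); rewrite big_ord1 mul1r.
  rewrite WeylAction.const_coefB /P scale1r scaleN1r.
  by rewrite !WeylAction.const_coefE !map_mpolyX.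
have sP : (msize P <= (mdeg u).+1)%N.
  rewrite (leq_trans (msizeD_le _ _)) // /P scale1r scaleN1r msizeN !msizeX.
  by rewrite geq_max leqnn.
have := char_variety_symbol cv IP sP.
rewrite symbol_atD !symbol_atZX eqxx meval1 mul1r mevalN meval1 => /eqP.
case: (mdeg v =P mdeg u) => _; last by rewrite addr0 mul0r => /eqP.
by rewrite mulN1r subr_eq0 mul1r => /eqP.
Qed.

(** The constant [beta i 0] has order 0 and leaves no trace in the symbol of order 1. *)
Lemma char_variety_euler (i : 'I_d) : \sum_j (A i j)%:~R * (x j * xi j) = 0.
Proof.
pose P : {mpoly {mpoly K[n]}[n]} :=
  \sum_j ((A i j)%:~R * 'X_j) *: 'X_j + (- (beta i 0)%:MP) *: 'X_[0].
have PE : euler A i - (beta i 0)%:MP%:MP = P.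
  rewrite /P; congr (_ + _); last by rewrite mpolyX0 scaleNr -mul_mpolyC mulr1.
  apply: eq_bigr => j _; rewrite wmul_xvar /dvar -scalerA.
  by rewrite scaler_int.
have IP : hyp_ideal A beta P.
  by rewrite -PE; apply: left_ideal_gen; right; exists i.
have sP : (msize P <= 2)%N.
  rewrite (leq_trans (msizeD_le _ _)) // geq_max; apply/andP; split.
    apply: (big_ind (fun P : {mpoly {mpoly K[n]}[n]} => (msize P <= 2)%N)).
    - by rewrite msize0.
    - by move=> p q p2 q2; rewrite (leq_trans (msizeD_le _ _)) // geq_max p2.
    - by move=> j _; rewrite (leq_trans (msizeZ_le _ _)) // msizeX mdeg1.
  by rewrite (leq_trans (msizeZ_le _ _)) // msizeX mdeg0.
have := char_variety_symbol cv IP sP.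
rewrite symbol_atD symbol_at_sum symbol_atZX mdeg0 /= addr0 => E; rewrite -[RHS]E.
apply: eq_bigr => j _; rewrite symbol_atZX mdeg1 eqxx mevalM mevalXU mulrA.
congr (_ * _); first by congr (_ * _); rewrite -(rmorph_int (mpolyC n (R := K))) mevalC.
rewrite (bigD1 j) //= mnm1E eqxx expr1 big1 ?mulr1 // => k kj.
by rewrite mnm1E eq_sym (negPf kj) expr0.
Qed.

End Hyp.

Section Weight.
Context {d n : nat} (A : 'M[int]_(d, n)).

Definition mnm_weight (u : 'X_{1..n}) : 'cV[int]_d := A *m (\col_j (u j)%:Z).

Lemma mnm_weightD u v : mnm_weight (u + v)%MM = mnm_weight u + mnm_weight v.
Proof.
rewrite /mnm_weight -mulmxDr; congr (_ *m _); apply/colP => j.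
by rewrite !mxE mnmDE PoszD.
Qed.

Lemma mnm_weightMn u k : mnm_weight (u *+ k)%MM = mnm_weight u *+ k.
Proof.
rewrite /mnm_weight -scaler_nat scalemxAr; congr (_ *m _); apply/colP => j.
by rewrite !mxE mulmnE natz PoszM mulrC.
Qed.

Lemma mnm_weightU j : mnm_weight U_(j)%MM = col j A.
Proof.
rewrite colE; congr (_ *m _); apply/colP => i; rewrite !mxE mnm1E.
by rewrite eq_sym andbT; case: eqP.
Qed.

End Weight.

Section NonsingularAdb.
Context {K : fieldType} {d b : nat} (beta : 'cV[K]_d) (x : 'I_(2 * d - 1) -> K).
Hypotheses (d0 : (0 < d)%N) (bK : b%:R != 0 :> K).
Hypothesis x0 : forall c, x c != 0.
Hypothesis x_gen : forall i j, i != j ->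
  x (col_x i) * x (col_y j) != x (col_x j) * x (col_y i).

(** Three families of symbols are played off: the Euler operators, the binomials of x_i^b z against
    y_i^b, which are not homogeneous, and the quadratic binomials of x_i y_j against x_j y_i. *)
Lemma nonsingular_Adb : nonsingular (hyp_ideal (Adb d b) beta) x.
Proof.
move=> xi cv.
have pX (w : 'X_{1..2 * d - 1}) : \prod_i xi i ^+ w i = ('X_[w] : {mpoly K[_]}).@[xi].
  by rewrite mevalX.
have E_x i : x (col_x i) * xi (col_x i) = - (x (col_y i) * xi (col_y i)).
  have pick (F : 'I_(d - 1) -> K) : \sum_j ((i == j)%:R : int)%:~R * F j = F i.
    rewrite (bigD1 i) //= eqxx mul1r big1 ?addr0 // => j.
    by rewrite eq_sym => /negPf ->; rewrite mul0r.
  have := char_variety_euler cv (row_of i); rewrite (sum_col d0) (Adb_rz d0) mul0r addr0.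
  rewrite (eq_bigr (fun j => ((i == j)%:R : int)%:~R * (x (col_x j) * xi (col_x j)))); last first.
    by move=> j _; rewrite Adb_rx.
  rewrite pick (eq_bigr (fun j => ((i == j)%:R : int)%:~R * (x (col_y j) * xi (col_y j)))); last first.
    by move=> j _; rewrite Adb_ry.
  by rewrite pick => /eqP; rewrite addr_eq0 => /eqP.
have E_z : \sum_j x (col_y j) * xi (col_y j) + b%:R * (x (col_z d0) * xi (col_z d0)) = 0.
  rewrite -[RHS](char_variety_euler cv (row_last d0)) (sum_col d0) Adb_lz.
  rewrite [X in _ = X + _ + _]big1 ?add0r => [|j _]; last by rewrite Adb_lx mul0r.
  congr (_ + _); last by rewrite natz.
  by apply: eq_bigr => j _; rewrite Adb_ly mul1r.
have cE j r : (col j (Adb d b)) r 0 = Adb d b r j by rewrite mxE.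
have aE (M N : 'cV[int]_d) r : (M + N) r 0 = M r 0 + N r 0 by rewrite mxE.
have xy i : xi (col_x i) = 0 -> xi (col_y i) = 0.
  move=> z; have := E_x i; rewrite z mulr0 => /esym/eqP.
  by rewrite oppr_eq0 mulf_eq0 (negPf (x0 _)) => /eqP.
have yx i : xi (col_y i) = 0 -> xi (col_x i) = 0.
  move=> z; have := E_x i; rewrite z mulr0 oppr0 => /eqP.
  by rewrite mulf_eq0 (negPf (x0 _)) => /eqP.
(* The leading term of d_x^b d_z - d_y^b is the first one, of degree b + 1. With a nonzero
   z-component it kills all x-components, hence all y-components by [E_x], and then [E_z] is
   contradicted. *)
have z0 : xi (col_z d0) = 0.
  apply/eqP; apply: contraT => nz.
  have X0 i : xi (col_x i) = 0.
    have W : mnm_weight (Adb d b) (U_(col_x i) *+ b + U_(col_z d0))%MM =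
             mnm_weight (Adb d b) (U_(col_y i) *+ b)%MM.
      rewrite mnm_weightD !mnm_weightMn !mnm_weightU; apply/colP => r.
      rewrite aE !mulmxnE !cE; case: (adb_rowP d0 r) => [[k ->]|->].
        by rewrite (Adb_rz d0) Adb_rx Adb_ry addr0.
      by rewrite Adb_lx Adb_ly Adb_lz mul0rn add0r.
    have dg : mdeg (U_(col_y i) *+ b)%MM = b by rewrite mdegMn mdeg1 mul1n.
    have dg' : mdeg (U_(col_x i) *+ b + U_(col_z d0))%MM = b.+1.
      by rewrite mdegD mdegMn !mdeg1 mul1n addn1.
    have := char_variety_toric cv (or_introl _) W.
    rewrite dg dg' ltn_eqF // mul0r pX mpolyXD -mpolyXn mevalM mevalXU => /(_ (ltnSn b))/eqP.
    by rewrite mulf_eq0 (negPf nz) orbF rmorphXn /= mevalXU expf_eq0 => /andP[_ /eqP].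
  move: E_z; rewrite big1 ?add0r => [/eqP|j _]; last by rewrite xy ?mulr0.
  by rewrite !mulf_eq0 (negPf bK) (negPf (x0 _)) (negPf nz).
have exy i j : xi (col_x i) * xi (col_y j) = xi (col_x j) * xi (col_y i).
  have W : mnm_weight (Adb d b) (U_(col_x i) + U_(col_y j))%MM =
           mnm_weight (Adb d b) (U_(col_x j) + U_(col_y i))%MM.
    rewrite !mnm_weightD !mnm_weightU; apply/colP => r.
    rewrite !aE !cE; case: (adb_rowP d0 r) => [[k ->]|->].
      by rewrite !Adb_rx !Adb_ry addrC.
    by rewrite !Adb_lx !Adb_ly.
  have dg : mdeg (U_(col_x j) + U_(col_y i))%MM = mdeg (U_(col_x i) + U_(col_y j))%MM.
    by rewrite !mdegD !mdeg1.
  have := char_variety_toric cv (or_intror dg) W.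
  by rewrite dg eqxx mul1r !pX !mpolyXD !mevalM !mevalXU.
(* After eliminating the x-components from [exy] by [E_x], two nonzero blocks would force x_i y_j =
   x_j y_i, against [x_gen]. *)
have y0 i j : i != j -> xi (col_y i) != 0 -> xi (col_y j) = 0.
  move=> ij yi; apply/eqP; apply: contraT => yj.
  have := x_gen ij; rewrite -subr_eq0.
  have : xi (col_x i) * xi (col_y j) * (x (col_x i) * x (col_x j)) =
         xi (col_x j) * xi (col_y i) * (x (col_x i) * x (col_x j)) by rewrite exy.
  have -> : xi (col_x i) * xi (col_y j) * (x (col_x i) * x (col_x j)) =
    - (x (col_y i) * x (col_x j)) * (xi (col_y i) * xi (col_y j)).
    have := E_x i; move: (xi (col_x i)) (x (col_x i)) => u v E.
    have -> : u * xi (col_y j) * (v * x (col_x j)) = (v * u) * xi (col_y j) * x (col_x j) by ring.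
    by rewrite E; ring.
  have -> : xi (col_x j) * xi (col_y i) * (x (col_x i) * x (col_x j)) =
    - (x (col_y j) * x (col_x i)) * (xi (col_y i) * xi (col_y j)).
    have := E_x j; move: (xi (col_x j)) (x (col_x j)) => u v E.
    have -> : u * xi (col_y i) * (x (col_x i) * v) = (v * u) * xi (col_y i) * x (col_x i) by ring.
    by rewrite E; ring.
  move=> /(mulIf (mulf_neq0 yi yj))/oppr_inj E.
  by rewrite [x (col_x i) * _]mulrC -E [x (col_y i) * _]mulrC subrr eqxx.
have Y0 i : xi (col_y i) = 0.
  apply/eqP; apply: contraT => yi.
  move: E_z; rewrite z0 !mulr0 addr0 (bigD1 i) //= big1 ?addr0 => [/eqP|j ji].
    by rewrite mulf_eq0 (negPf (x0 _)) (negPf yi).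
  by rewrite (y0 i j) ?mulr0 // eq_sym.
by move=> c; case: (columnP d0 c) => [j ->|j ->|->] //; exact: yx.
Qed.

End NonsingularAdb.
End Nonsingular.
(** * Solutions in a differential algebra *)

Module Solutions.
Import mpoly Weyl WeylAction Nonsingular.
Local Open Scope multi_scope.
Local Open Scope mpoly_scope.
Local Open Scope ring_scope.

Section IteratedDerivation.
Context {K : fieldType} {n : nat} (W : diff_alg K n).
Local Notation D := (@da_D K n W).
Implicit Types (f g w : W) (c : 'I_n).

Lemma DN c f : D c (- f) = - D c f.
Proof.
apply/eqP; rewrite -subr_eq0 opprK -da_DD addNr D0 //.
Qed.

Lemma Dnat c m : D c m%:R = 0.
Proof. by elim: m => [|m IH]; rewrite ?D0 // -natr1 da_DD IH D1 addr0. Qed.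

Lemma DM3 c f g w : D c (f * g * w) =
  (D c f * g + f * D c g) * w + f * g * D c w.
Proof. by rewrite !da_DM. Qed.

Lemma Dexp c f w k : D c f = f * w -> D c (f ^+ k) = k%:R * (f ^+ k * w).
Proof.
move=> E; elim: k => [|k IH]; first by rewrite mul0r D1.
by rewrite exprS da_DM IH E -natr1; ring.
Qed.

Lemma iterD_add c k f g : iter k (D c) (f + g) = iter k (D c) f + iter k (D c) g.
Proof. by elim: k => //= k ->; rewrite da_DD. Qed.

Lemma iterD_N c k f : iter k (D c) (- f) = - iter k (D c) f.
Proof. by elim: k => //= k ->; rewrite DN. Qed.

Lemma iterD_0 c k : iter k (D c) 0 = 0.
Proof. by elim: k => //= k ->; rewrite D0. Qed.

Lemma iterD_const c k w f : D c w = 0 -> iter k (D c) (w * f) = w * iter k (D c) f.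
Proof. by move=> w0; elim: k => //= k ->; rewrite da_DM w0 mul0r add0r. Qed.

Lemma iterD_var c k f : iter k.+1 (D c) (da_var W c * f) =
  da_var W c * iter k.+1 (D c) f + k.+1%:R * iter k (D c) f.
Proof.
elim: k => [|k IH]; first by rewrite /= da_DM da_Dvar eqxx /=; ring.
rewrite iterS IH da_DD !da_DM da_Dvar eqxx Dnat -!iterS mul1r -[in RHS]natr1; ring.
Qed.

Lemma iterD_ge c k m f : (k <= m)%N -> iter k (D c) f = 0 -> iter m (D c) f = 0.
Proof. by move=> /subnK <- E; rewrite iterD E iterD_0. Qed.

(** A closed formula for all derivatives at once is thereby proved by checking a single
    differentiation in each variable. *)
Lemma mD_family (Phi : 'X_{1..n} -> W) :
  (forall (u : 'X_{1..n}) c, D c (Phi u) = Phi (U_(c) + u)%MM) ->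
  forall u : 'X_{1..n}, mD u (Phi 0%MM) = Phi u.
Proof.
move=> PhiD; elim/mnm_ind => [|c u IH]; first exact: mD0.
by rewrite addmC mD_add1 IH PhiD addmC.
Qed.

Lemma mD_const (u : 'X_{1..n}) w f : (forall c, u c != 0%N -> D c w = 0) ->
  mD u (w * f) = w * mD u f.
Proof.
rewrite /mD => w0; elim: (enum _) => //= c s ->.
have [->|/w0 wc] := eqVneq (u c) 0%N; first by [].
exact: iterD_const.
Qed.

Lemma mD_add (u : 'X_{1..n}) f g : mD u (f + g) = mD u f + mD u g.
Proof. by rewrite /mD; elim: (enum _) => //= c s ->; rewrite iterD_add. Qed.

End IteratedDerivation.

(** * Weights of exponents under [Adb] *)

Section Weights.
Context {d b : nat}.
Hypothesis d0 : (0 < d)%N.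
Implicit Types u v : 'X_{1..2 * d - 1}.

Definition mnm_xy u (j : 'I_(d - 1)) : nat := (u (col_x j) + u (col_y j))%N.
Definition mnm_y u : nat := (\sum_j u (col_y j))%N.

Lemma mnm_weight_row u j : mnm_weight (Adb d b) u (row_of j) 0 = (mnm_xy u j)%:Z.
Proof.
have pick (F : 'I_(d - 1) -> nat) :
    \sum_(k < d - 1) ((j == k)%:R : int) * (F k)%:Z = (F j)%:Z.
  rewrite (bigD1 j) //= eqxx mul1r big1 ?addr0 // => k.
  by rewrite eq_sym => /negPf ->; rewrite mul0r.
rewrite /mnm_weight mxE (sum_col d0) (Adb_rz d0) mul0r addr0 PoszD.
congr (_ + _).
  by rewrite -(pick (fun j => u (col_x j))); apply: eq_bigr => k _; rewrite Adb_rx [in LHS]mxE.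
by rewrite -(pick (fun j => u (col_y j))); apply: eq_bigr => k _; rewrite Adb_ry [in LHS]mxE.
Qed.

Lemma mnm_weight_last u : mnm_weight (Adb d b) u (row_last d0) 0 =
  (mnm_y u + b * u (col_z d0))%N%:Z.
Proof.
rewrite /mnm_weight mxE (sum_col d0) Adb_lz [X in X + _ + _]big1 ?add0r; last first.
  by move=> k _; rewrite Adb_lx mul0r.
rewrite PoszD /mnm_y PoszM -natz [in RHS]natz; congr (_ + _); last by rewrite [in LHS]mxE natz.
rewrite (big_morph Posz PoszD (erefl 0)); apply: eq_bigr => k _.
by rewrite Adb_ly mul1r mxE.
Qed.

Lemma mnm_weightP u v : mnm_weight (Adb d b) u = mnm_weight (Adb d b) v ->
  (forall j, mnm_xy u j = mnm_xy v j) /\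
  (mnm_y u + b * u (col_z d0) = mnm_y v + b * v (col_z d0))%N.
Proof.
move=> uv; split => [j|].
  by apply/eqP; rewrite -eqz_nat -!mnm_weight_row uv.
by apply/eqP; rewrite -eqz_nat -!mnm_weight_last uv.
Qed.

End Weights.

(** * All derivatives of a solution supported in one block *)

Section Block.
Context {K : fieldType} {d b : nat} (W : diff_alg K (2 * d - 1)).
Hypothesis d0 : (0 < d)%N.
Variable i : 'I_(d - 1).
Local Notation X := (@da_var _ _ W).
Local Notation D := (@da_D _ _ W).
Local Notation Dx := (D (col_x i)).
Local Notation Dy := (D (col_y i)).
Local Notation Dz := (D (col_z d0)).
Local Notation x := (X (col_x i)).
Local Notation y := (X (col_y i)).
Local Notation z := (X (col_z d0)).

Definition blockwise (f : W) := forall j, j != i ->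
  D (col_x j) f = 0 /\ D (col_y j) f = 0.

Lemma blockwiseM f g : blockwise f -> blockwise g -> blockwise (f * g).
Proof.
move=> bf bg j ji; have [fx fy] := bf j ji; have [gx gy] := bg j ji.
by rewrite !da_DM fx fy gx gy !(mul0r, mulr0, addr0).
Qed.

Lemma blockwiseD f c : blockwise f -> blockwise (D c f).
Proof.
by move=> bf j ji; have [fx fy] := bf j ji; rewrite da_DC fx da_DC fy !D0.
Qed.

Lemma blockwiseN f : blockwise f -> blockwise (- f).
Proof. by move=> bf j ji; have [fx fy] := bf j ji; rewrite !DN fx fy oppr0. Qed.

Lemma blockwise1 : blockwise 1.
Proof. by move=> j ji; rewrite !D1. Qed.

Lemma blockwiseX f k : blockwise f -> blockwise (f ^+ k).
Proof.
move=> bf; elim: k => [|k IH]; first exact: blockwise1.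
by rewrite exprS; exact: blockwiseM.
Qed.

Lemma blockwise_iter f c k : blockwise f -> blockwise (iter k (D c) f).
Proof. by move=> bf; elim: k => //= k; exact: blockwiseD. Qed.

Variable yi : W.
Hypothesis yyi : y * yi = 1.
Let rho := - x * yi.

Lemma D_yi c : D c yi = - yi ^+ 2 * D c y.
Proof.
have : D c (y * yi) = 0 by rewrite yyi D1.
rewrite da_DM => E.
have -> : D c yi = yi * (D c y * yi + y * D c yi) + (1 - y * yi) * D c yi - D c y * yi ^+ 2 by ring.
by rewrite E yyi subrr; ring.
Qed.

Lemma Dx_yi : Dx yi = 0.
Proof. by rewrite D_yi da_Dvar eq_col_xy mulr0. Qed.

Lemma Dy_yi : Dy yi = - yi ^+ 2.
Proof. by rewrite D_yi da_Dvar eqxx mulr1. Qed.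

Lemma Dz_yi : Dz yi = 0.
Proof. by rewrite D_yi da_Dvar eq_col_zy mulr0. Qed.

Lemma blockwise_yi : blockwise yi.
Proof.
by move=> j ji; rewrite !D_yi !da_Dvar eq_col_xy // eq_col_y // (negPf ji) mulr0.
Qed.

Lemma blockwise_x : blockwise x.
Proof.
by move=> j ji; rewrite !da_Dvar eq_col_x eq_col_yx // (negPf ji).
Qed.

Lemma blockwise_y : blockwise y.
Proof.
by move=> j ji; rewrite !da_Dvar eq_col_y // eq_col_xy // (negPf ji).
Qed.

Lemma blockwise_z : blockwise z.
Proof. by move=> j ji; rewrite !da_Dvar eq_col_xz // eq_col_yz. Qed.

Lemma blockwise_rho : blockwise rho.
Proof.
apply: blockwiseM; last exact: blockwise_yi.
by apply: blockwiseN; exact: blockwise_x.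
Qed.

Lemma Dx_rho : Dx rho = - yi.
Proof. by rewrite da_DM DN da_Dvar eqxx Dx_yi mulr0 addr0 mulN1r. Qed.

Lemma Dy_rho : Dy rho = - rho * yi.
Proof. by rewrite da_DM DN da_Dvar eq_col_yx /= Dy_yi /rho; ring. Qed.

Lemma Dz_rho : Dz rho = 0.
Proof. by rewrite da_DM DN da_Dvar eq_col_zx /= Dz_yi; ring. Qed.

Lemma y_rho : y * rho = - x.
Proof.
have -> : y * rho = (y * yi) * - x by rewrite /rho; ring.
by rewrite yyi mul1r.
Qed.

(* Kernel functions: Dy - rho Dx annihilates the functions of rho and z. *)
Definition fibred (f : W) := Dy f = rho * Dx f.

Lemma fibredM f g : fibred f -> fibred g -> fibred (f * g).
Proof. by rewrite /fibred !da_DM => -> ->; ring. Qed.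

Lemma fibred_rho : fibred rho.
Proof. by rewrite /fibred Dx_rho Dy_rho; ring. Qed.

Lemma fibred_rhoX k : fibred (rho ^+ k).
Proof.
elim: k => [|k IH]; first by rewrite /fibred !D1 mulr0.
by rewrite exprS; apply: fibredM => //; exact: fibred_rho.
Qed.

Lemma fibred_Dz f : fibred f -> fibred (Dz f).
Proof.
by rewrite /fibred => E; rewrite da_DC E da_DM Dz_rho mul0r add0r [Dz _]da_DC.
Qed.

Lemma fibred_iter_Dz f k : fibred f -> fibred (iter k Dz f).
Proof. by move=> ff; elim: k => //= k; exact: fibred_Dz. Qed.

(** A conservation law: Dy [yi] = - [yi]^2 = [yi] * Dx [rho]. A derivative in y becomes one in x at
    the price of a factor [rho]. *)
Lemma Dy_fibred f : fibred f -> Dy (f * yi) = Dx (rho * f * yi).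
Proof.
rewrite /fibred => E; rewrite [LHS]da_DM [RHS]da_DM [Dx (rho * f)]da_DM.
by rewrite E Dy_yi Dx_yi Dx_rho; ring.
Qed.

(** [rho] is x times a factor independent of x, so each power raises the degree in x by one. *)
Lemma Dx_rhoX k m f : iter k Dx f = 0 -> iter (k + m) Dx (rho ^+ m * f) = 0.
Proof.
move=> E; elim: m => [|m IH]; first by rewrite addn0 mul1r.
have -> : rho ^+ m.+1 * f = - yi * (x * (rho ^+ m * f)) by rewrite exprS /rho; ring.
rewrite iterD_const; last by rewrite DN Dx_yi oppr0.
by rewrite addnS iterD_var [iter _.+1 _ _]iterS IH D0 !mulr0 addr0 mulr0.
Qed.

(** [s] is 0 for beta = k e_d and 1 for beta = e_o + k e_d; in the latter case [g] and [gt] are the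
    derivatives of the solution in x_o and y_o. [hP] bounds the degree in x of the defect. *)
Variables (s : nat) (h g gt : W).
Hypotheses (s1 : (s <= 1)%N) (b2 : (2 <= b)%N).
Hypotheses (bh : blockwise h) (bg : blockwise g) (bgt : blockwise gt).
Hypothesis fh : fibred h.
Hypotheses (Dxg : Dx g = - (h * yi)) (Dyg : Dy g = - (rho * h * yi)).
Hypothesis Dxgt : s = 1%N -> Dx gt = - (rho * h * yi).
Hypothesis Dygt : s = 1%N -> Dy gt = - (rho ^+ 2 * h * yi).
Hypothesis hP : iter (b - 1 - s) Dx (rho ^+ b * h - Dz h) = 0.

(** The derivative with [M] factors in x and y, [c] of them in y, and [q] in z. Derivatives of [gt]
    count one y more, so [c] may reach M + 1; for M = 0 the value of [c] merely tells [g] from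
    [gt]. *)
Definition contig (M c q : nat) : W :=
  if M is m.+1 then - iter m Dx (rho ^+ c * iter q Dz h * yi)
  else iter q Dz (if c is 0 then g else gt).

Lemma iter_Dz_fibre q c f :
  iter q Dz (rho ^+ c * f * yi) = rho ^+ c * iter q Dz f * yi.
Proof.
have Dzr : Dz (rho ^+ c) = 0.
  by elim: c => [|c IH]; rewrite ?D1 // exprS da_DM IH Dz_rho; ring.
rewrite [_ * yi]mulrC iterD_const ?Dz_yi // iterD_const //.
by rewrite [yi * _]mulrC.
Qed.

Lemma Dx_contig M c q : (c <= M + s)%N -> Dx (contig M c q) = contig M.+1 c q.
Proof.
case: M => [|m] cM; last by rewrite /= DN.
rewrite /= D_iter; case: c cM => [|[|c]] cM; last by lia.
  by rewrite Dxg iterD_N -[h * yi]mul1r mulrA -(expr0 rho) iter_Dz_fibre.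
by rewrite Dxgt; [rewrite iterD_N -{1}(expr1 rho) iter_Dz_fibre | lia].
Qed.

Lemma Dy_contig M c q : (c <= M + s)%N -> Dy (contig M c q) = contig M.+1 c.+1 q.
Proof.
case: M => [|m] cM.
  rewrite /= D_iter; case: c cM => [|[|c]] cM; last by lia.
    by rewrite Dyg iterD_N -{1}(expr1 rho) iter_Dz_fibre.
  by rewrite Dygt; [rewrite iterD_N iter_Dz_fibre | lia].
rewrite /= DN D_iter Dy_fibred; last first.
  by apply: fibredM; [exact: fibred_rhoX|exact: fibred_iter_Dz].
by rewrite -iterSr iterS mulrA -exprS.
Qed.

Lemma Dz_contig M c q : Dz (contig M c q) = contig M c q.+1.
Proof.
case: M => [|m] //=.
rewrite DN D_iter; congr (- iter m Dx _).
by rewrite -[LHS]/(iter 1 Dz _) iter_Dz_fibre.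
Qed.

Lemma blockwise_contig M c q : blockwise (contig M c q).
Proof.
case: M => [|m]; first by case: c => [|c]; exact: blockwise_iter.
apply/blockwiseN/blockwise_iter/blockwiseM; last exact: blockwise_yi.
by apply: blockwiseM; [exact/blockwiseX/blockwise_rho|exact: blockwise_iter].
Qed.

(** The difference of the two sides is, up to sign, Dx^(M - 1) applied to [yi] rho^c times Dz^q of
    the defect. By [hP] and [Dx_rhoX] it dies after b - 1 - s + c derivatives in x, and this is at
    most M - 1 by the assumption. *)
Lemma contig_shift M c q : (c + b <= M + s)%N ->
  contig M (c + b) q = contig M c q.+1.
Proof.
(* For M = 0 the assumption would give b <= s <= 1. *)
case: M => [|m] cM; first by lia.
apply/eqP; rewrite /= -subr_eq0 opprK addrC -iterD_N -iterD_add.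
have -> : Dz (iter q Dz h) = iter q Dz (Dz h) by rewrite -iterS iterSr.
rewrite -!iter_Dz_fibre -iterD_N -iterD_add.
have -> : rho ^+ c * Dz h * yi - rho ^+ (c + b) * h * yi =
    - (yi * (rho ^+ c * (rho ^+ b * h - Dz h))) by rewrite exprD; ring.
rewrite iterD_N; set P := _ - _.
have -> : iter q Dz (yi * (rho ^+ c * P)) = rho ^+ c * iter q Dz P * yi.
  by rewrite -iter_Dz_fibre; congr (iter _ _ _); ring.
rewrite iterD_N oppr_eq0 [_ * yi]mulrC iterD_const ?Dx_yi //.
rewrite (@iterD_ge _ _ _ _ (b - 1 - s + c)) ?mulr0 //; first by lia.
apply: Dx_rhoX.
have : iter q Dz (iter (b - 1 - s) Dx P) = 0 by rewrite hP iterD_0.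
suff -> : iter q Dz (iter (b - 1 - s) Dx P) = iter (b - 1 - s) Dx (iter q Dz P) by [].
by elim: (q) => //= m' ->; rewrite D_iter.
Qed.

Lemma contig_shiftn M c q t : (c + b * t <= M + s)%N ->
  contig M (c + b * t) q = contig M c (q + t).
Proof.
elim: t q => [|t IH] q ct; first by rewrite muln0 !addn0.
rewrite mulnS addnCA addnC contig_shift; last by rewrite -addnA (addnC _ b) -mulnS.
by rewrite IH ?addSnnS //; apply: leq_trans ct; rewrite mulnS; lia.
Qed.

Definition in_block (u : 'X_{1..2 * d - 1}) : bool :=
  [forall j, (j != i) ==> (mnm_xy u j == 0%N)].

(** Derivatives leaving the block vanish. The shift [e] is 0 for derivatives of [g] and 1 for those
    of [gt]. *)
Definition contig_mnm (e : nat) (u : 'X_{1..2 * d - 1}) : W :=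
  if in_block u then contig (mnm_xy u i) (u (col_y i) + e) (u (col_z d0)) else 0.

Lemma D_contig_mnm e u c : (e <= s)%N ->
  D c (contig_mnm e u) = contig_mnm e (U_(c) + u)%MM.
Proof.
move=> es; rewrite /contig_mnm; case: (columnP d0 c) => [j ->|j ->|->].
- have N k : mnm_xy (U_(col_x j) + u)%MM k = ((j == k) + mnm_xy u k)%N.
    by rewrite /mnm_xy !mnmDE !mnm1E eq_col_x eq_col_xy // add0n addnA.
  rewrite !mnmDE !mnm1E N eq_col_xy // eq_col_xz !add0n.
  have [->|ji] := eqVneq j i.
    have -> : in_block (U_(col_x i) + u)%MM = in_block u.
      apply: eq_forallb => k; have [//|ki] := eqVneq k i.
      rewrite /mnm_xy !mnmDE !mnm1E eq_col_x eq_col_xy // add0n.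
      by rewrite [i == k]eq_sym (negPf ki).
    case: ifP => _; last by rewrite D0.
    by rewrite add1n Dx_contig // /mnm_xy; lia.
  have -> : in_block (U_(col_x j) + u)%MM = false.
    by apply/negP => /forallP/(_ j)/implyP/(_ ji); rewrite N eqxx.
  by case: ifP => _; rewrite ?D0 //; exact: (blockwise_contig _ _ _ ji).1.
- have N k : mnm_xy (U_(col_y j) + u)%MM k = ((j == k) + mnm_xy u k)%N.
    by rewrite /mnm_xy !mnmDE !mnm1E eq_col_y // eq_col_yx // add0n addnCA.
  rewrite !mnmDE !mnm1E N eq_col_y // eq_col_yz !add0n.
  have [->|ji] := eqVneq j i.
    have -> : in_block (U_(col_y i) + u)%MM = in_block u.
      apply: eq_forallb => k; have [//|ki] := eqVneq k i.
      rewrite /mnm_xy !mnmDE !mnm1E eq_col_y // eq_col_yx // add0n.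
      by rewrite [i == k]eq_sym (negPf ki).
    case: ifP => _; last by rewrite D0.
    by rewrite !add1n addSn Dy_contig // /mnm_xy; lia.
  have -> : in_block (U_(col_y j) + u)%MM = false.
    by apply/negP => /forallP/(_ j)/implyP/(_ ji); rewrite N eqxx.
  by case: ifP => _; rewrite ?D0 //; exact: (blockwise_contig _ _ _ ji).2.
- have N k : mnm_xy (U_(col_z d0) + u)%MM k = mnm_xy u k.
    by rewrite /mnm_xy !mnmDE !mnm1E eq_col_zx eq_col_zy !add0n.
  have -> : in_block (U_(col_z d0) + u)%MM = in_block u.
    by apply: eq_forallb => k; rewrite N.
  rewrite !mnmDE !mnm1E N eq_col_zy eqxx add0n add1n.
  by case: ifP => _; rewrite ?D0 // Dz_contig.
Qed.

Lemma contig_mnm0 e : contig_mnm e 0%MM = if e is 0 then g else gt.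
Proof.
rewrite /contig_mnm /mnm_xy !mnm0E ifT //.
by apply/forallP => j; rewrite /mnm_xy !mnm0E eqxx implybT.
Qed.

Lemma mD_contig (u : 'X_{1..2 * d - 1}) e : (e <= s)%N ->
  mD u (if e is 0 then g else gt) = contig_mnm e u.
Proof.
move=> es; rewrite -contig_mnm0; apply: mD_family => v c.
exact: D_contig_mnm.
Qed.

Let mD_g (u : 'X_{1..2 * d - 1}) : mD u g = contig_mnm 0 u.
Proof. exact: (mD_contig u (leq0n s)). Qed.

Let mD_gt (u : 'X_{1..2 * d - 1}) : s = 1%N -> mD u gt = contig_mnm 1 u.
Proof. by move=> s_1; apply: (@mD_contig u 1); rewrite s_1. Qed.

Lemma in_block_y u : in_block u -> mnm_y u = u (col_y i).
Proof.
move=> /forallP bu; rewrite /mnm_y (bigD1 i) //= big1 ?addn0 // => j ji.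
by have := bu j; rewrite ji /= addn_eq0 => /andP[_ /eqP].
Qed.

(** Equal weights leave only the exchange of b factors in y against one in z, repeated as often as
    the z-exponents differ. Allowing [e] and [e'] to differ compares derivatives of [g] with
    derivatives of [gt]. *)
Lemma contig_mnm_eq e e' u v : (e <= s)%N -> (e' <= s)%N ->
  (forall j, mnm_xy u j = mnm_xy v j) ->
  (mnm_y u + e + b * u (col_z d0) = mnm_y v + e' + b * v (col_z d0))%N ->
  contig_mnm e u = contig_mnm e' v.
Proof.
move=> es es' uv uvz; rewrite /contig_mnm.
have -> : in_block u = in_block v by apply: eq_forallb => j; rewrite uv.
case: ifP => // bv.
have bu : in_block u by apply/forallP => j; rewrite uv; exact: (forallP bv).
rewrite uv; move: uvz; rewrite (in_block_y bu) (in_block_y bv).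
have : (u (col_y i) <= mnm_xy v i)%N by rewrite -uv /mnm_xy; lia.
have : (v (col_y i) <= mnm_xy v i)%N by rewrite /mnm_xy; lia.
move: (mnm_xy v i) => M; move: (u (col_z d0)) (v (col_z d0)) => q q'.
move: (u (col_y i)) (v (col_y i)) => c c' c'M cM E.
have [qq'|qq'] := leqP q q'.
  have -> : (c + e = c' + e' + b * (q' - q))%N by rewrite mulnBr; have := leq_mul (leqnn b) qq'; lia.
  rewrite [LHS]contig_shiftn; first by rewrite subnKC.
  by rewrite mulnBr; have := leq_mul (leqnn b) qq'; lia.
have -> : (c' + e' = c + e + b * (q - q'))%N.
  by rewrite mulnBr; have := leq_mul (leqnn b) (ltnW qq'); lia.
rewrite [RHS]contig_shiftn; first by rewrite subnKC // ltnW.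
by rewrite mulnBr; have := leq_mul (leqnn b) (ltnW qq'); lia.
Qed.

Lemma toric_block : toric_solution (Adb d b) g.
Proof.
move=> u v /(mnm_weightP d0)[uv uvz].
rewrite !mD_g; apply: contig_mnm_eq => //.
by rewrite !addn0.
Qed.

(* In degree e_o + k e_d the solution f = x_o g + y_o gt satisfies
   d f / d x_o = g and d f / d y_o = gt, also when o = i. *)
Lemma toric_block_shift (o : 'I_(d - 1)) : s = 1%N ->
  let f := X (col_x o) * g + X (col_y o) * gt in
  D (col_x o) f = g -> D (col_y o) f = gt -> toric_solution (Adb d b) f.
Proof.
move=> s_1 f fx fy u v /(mnm_weightP d0)[uv uvz].
(* One derivative in block [o] is spent on turning [f] into [g] or [gt]; [e] records whether it was
   a y. *)
have step (w : 'X_{1..2 * d - 1}) : (0 < mnm_xy w o)%N -> exists e w',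
    [/\ (e <= s)%N, mD w f = contig_mnm e w',
        forall j, mnm_xy w j = ((o == j) + mnm_xy w' j)%N,
        mnm_y w = (mnm_y w' + e)%N & w (col_z d0) = w' (col_z d0)].
  rewrite /mnm_xy addn_gt0 => /orP[wo|wo].
    have E : w = ((w - U_(col_x o)) + U_(col_x o))%MM by rewrite submK // lep1mP -lt0n.
    exists 0%N, (w - U_(col_x o))%MM; split => //.
    - by rewrite {1}E mD_add1 D_mD fx mD_g.
    - by move=> j; rewrite {1 2}E !mnmDE !mnm1E eq_col_x eq_col_xy //; lia.
    - rewrite addn0 /mnm_y; apply: eq_bigr => j _.
      by rewrite {1}E mnmDE mnm1E eq_col_xy // addn0.
    - by rewrite {1}E mnmDE mnm1E eq_col_xz addn0.
  have E : w = ((w - U_(col_y o)) + U_(col_y o))%MM by rewrite submK // lep1mP -lt0n.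
  exists 1%N, (w - U_(col_y o))%MM; split => //.
  - by rewrite s_1.
  - by rewrite {1}E mD_add1 D_mD fy mD_gt.
  - by move=> j; rewrite {1 2}E !mnmDE !mnm1E eq_col_y // eq_col_yx //; lia.
  - rewrite /mnm_y {1}E (eq_bigr (fun j => (w - U_(col_y o))%MM (col_y j) + (o == j))%N).
      rewrite big_split /=; congr (_ + _)%N.
      by rewrite (bigD1 o) //= eqxx big1 ?addn0 // => j; rewrite eq_sym => /negPf ->.
    by move=> j _; rewrite mnmDE mnm1E eq_col_y.
  - by rewrite {1}E mnmDE mnm1E eq_col_yz addn0.
have [u0|uo] := posnP (mnm_xy u o); last first.
  have vo : (0 < mnm_xy v o)%N by rewrite -uv.
  have [e [u' [es -> ux uy uz]]] := step u uo.
  have [e' [v' [es' -> vx vy vz]]] := step v vo.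
  apply: contig_mnm_eq => // [j|]; last by lia.
  by have := uv j; rewrite ux vx => /addnI.
(* With no derivative in block [o], the factors x_o and y_o behave as constants and the two terms
   are compared separately. *)
have zero (w : 'X_{1..2 * d - 1}) : mnm_xy w o = 0%N ->
    mD w f = X (col_x o) * contig_mnm 0 w + X (col_y o) * contig_mnm 1 w.
  move=> /eqP; rewrite addn_eq0 => /andP[/eqP wx /eqP wy].
  rewrite mD_add !mD_const ?mD_g ?mD_gt //.
    move=> c; rewrite da_Dvar; have [->|//] := eqVneq c (col_y o).
    by rewrite wy.
  move=> c; rewrite da_Dvar; have [->|//] := eqVneq c (col_x o).
  by rewrite wx.
rewrite !zero -?uv //; congr (_ * _ + _ * _); apply: contig_mnm_eq => //.
- by rewrite !addn0.
- by rewrite s_1.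
- by rewrite s_1.
- lia.
Qed.

End Block.

(** * Solutions built from functions of tau = z rho^b in one block *)

Section Family.
Context {K : fieldType} {d b : nat} (W : diff_alg K (2 * d - 1)).
Hypothesis d0 : (0 < d)%N.
Local Notation X := (@da_var _ _ W).
Local Notation D := (@da_D _ _ W).
Local Notation z := (X (col_z d0)).
Local Notation Dz := (D (col_z d0)).
Variable inv : 'I_(2 * d - 1) -> W.
Hypothesis X_inv : forall c, X c * inv c = 1.
Local Notation zi := (inv (col_z d0)).

Section OneBlock.
Variable i : 'I_(d - 1).
Local Notation Dx := (D (col_x i)).
Local Notation Dy := (D (col_y i)).
Local Notation x := (X (col_x i)).
Local Notation y := (X (col_y i)).
Local Notation xi := (inv (col_x i)).
Local Notation yi := (inv (col_y i)).
Definition rho : W := - x * yi.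
Definition sigma : W := - y * xi.

(* F' plays the role of tau dF/dtau for a function F of tau = z rho^b. *)
Definition tau_chain (F F' : W) := [/\ blockwise i F,
  Dx F = b%:R * (xi * F'), Dy F = - (b%:R * (yi * F')) & Dz F = zi * F'].

Let yyi : y * yi = 1 := X_inv (col_y i).

Lemma rho_sigma : rho * sigma = 1.
Proof.
have -> : rho * sigma = (x * xi) * (y * yi) by rewrite /rho /sigma; ring.
by rewrite !X_inv mulr1.
Qed.

Lemma sigma_yi : sigma * yi = - xi.
Proof.
have -> : sigma * yi = - xi * (y * yi) by rewrite /sigma; ring.
by rewrite X_inv mulr1.
Qed.

Lemma rho_xi : rho * xi = - yi.
Proof.
have -> : rho * xi = - yi * (x * xi) by rewrite /rho; ring.
by rewrite X_inv mulr1.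
Qed.

Lemma D_xi c : D c xi = - xi ^+ 2 * D c x.
Proof.
have : D c (x * xi) = 0 by rewrite X_inv D1.
rewrite da_DM => E.
have -> : D c xi = xi * (D c x * xi + x * D c xi) + (1 - x * xi) * D c xi - D c x * xi ^+ 2 by ring.
by rewrite E X_inv subrr; ring.
Qed.

Lemma Dx_sigma : Dx sigma = sigma * - xi.
Proof.
rewrite /sigma da_DM DN D_xi !da_Dvar eq_col_xy eqxx /=; ring.
Qed.

Lemma Dy_sigma : Dy sigma = sigma * yi.
Proof.
by rewrite sigma_yi /sigma da_DM DN D_xi !da_Dvar eq_col_yx eqxx /=; ring.
Qed.

Lemma Dz_sigma : Dz sigma = sigma * 0.
Proof.
by rewrite /sigma da_DM DN D_xi !da_Dvar eq_col_zx eq_col_zy /=; ring.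
Qed.

Lemma Dx_rho' : Dx rho = rho * xi.
Proof. by rewrite rho_xi (Dx_rho yyi). Qed.

Lemma Dy_rho' : Dy rho = rho * - yi.
Proof. by rewrite (Dy_rho yyi) /rho; ring. Qed.

Lemma Dz_rho' : Dz rho = rho * 0.
Proof. by rewrite (Dz_rho d0 yyi) mulr0. Qed.

Lemma blockwise_sigma : blockwise i sigma.
Proof.
apply: blockwiseM; first by apply: blockwiseN; exact: blockwise_y.
move=> j ji; rewrite !D_xi !da_Dvar eq_col_x eq_col_yx (negPf ji) /=.
by split; ring.
Qed.

(** [T] behaves like tau^((k + l + 1) / b - 1). With [eps] = 0 the equation of [H] is that of
    exp(tau); with [eps] = 1 it has the source term - tau [T]. *)
Variables (s k l eps : nat) (T T' H H' G G' Gt Gt' : W).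
Hypotheses (s1 : (s <= 1)%N) (b2 : (2 <= b)%N).
Hypotheses (cT : tau_chain T T') (cH : tau_chain H H').
Hypotheses (cG : tau_chain G G') (cGt : tau_chain Gt Gt').
Hypothesis T'E : b%:R * T' + b%:R * T = (k + l).+1%:R * T.
Hypothesis H'E : H' = z * rho ^+ b * (H - eps%:R * T).
Hypothesis G'E : b%:R * G' = k%:R * G + H.
Hypothesis Gt'E : b%:R * Gt' + Gt = k%:R * Gt + H.
Hypothesis epsE : eps = 0%N \/ (l + s + 2 <= b)%N.

Definition hsol : W := sigma ^+ k.+1 * H.
Definition gsol : W := sigma ^+ k * G.
(** The factor is rho^(1 - k), written so that k = 0 is included. *)
Definition gtsol : W := rho * sigma ^+ k * Gt.
(** Since [T] behaves like tau^((k + l + 1) / b - 1), this is rho^l times a power of z: a monomial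
    of degree [l] in x. *)
Definition tsol : W := sigma ^+ k.+1 * rho ^+ b * T.

Lemma hsolE : hsol = sigma ^+ k * H * sigma.
Proof. by rewrite /hsol exprS; ring. Qed.

Lemma Dx_gsol : Dx gsol = - (hsol * yi).
Proof.
have [_ dG _ _] := cG.
have -> : - (hsol * yi) = - (sigma ^+ k * H * (sigma * yi)) by rewrite hsolE; ring.
rewrite sigma_yi /gsol da_DM (Dexp _ Dx_sigma) dG.
have -> : k%:R * (sigma ^+ k * - xi) * G + sigma ^+ k * (b%:R * (xi * G')) =
  sigma ^+ k * xi * (b%:R * G' - k%:R * G) by ring.
by rewrite G'E; ring.
Qed.

Lemma Dy_gsol : Dy gsol = - (rho * hsol * yi).
Proof.
have [_ _ dG _] := cG.
have -> : - (rho * hsol * yi) = - (rho * sigma) * (sigma ^+ k * H * yi).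
  by rewrite hsolE; ring.
rewrite rho_sigma /gsol da_DM (Dexp _ Dy_sigma) dG.
have -> : k%:R * (sigma ^+ k * yi) * G + sigma ^+ k * - (b%:R * (yi * G')) =
  - (sigma ^+ k * yi * (b%:R * G' - k%:R * G)) by ring.
by rewrite G'E; ring.
Qed.

Lemma Dx_gtsol : Dx gtsol = - (rho * hsol * yi).
Proof.
have [_ dG _ _] := cGt.
have -> : - (rho * hsol * yi) = - (rho * sigma ^+ k * H * (sigma * yi)).
  by rewrite hsolE; ring.
rewrite sigma_yi /gtsol DM3 Dx_rho' (Dexp _ Dx_sigma) dG.
have -> : (rho * xi * sigma ^+ k + rho * (k%:R * (sigma ^+ k * - xi))) * Gt +
    rho * sigma ^+ k * (b%:R * (xi * Gt')) =
    rho * sigma ^+ k * xi * ((b%:R * Gt' + Gt) - k%:R * Gt) by ring.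
by rewrite Gt'E; ring.
Qed.

Lemma Dy_gtsol : Dy gtsol = - (rho ^+ 2 * hsol * yi).
Proof.
have [_ _ dG _] := cGt.
have -> : - (rho ^+ 2 * hsol * yi) = - (rho * sigma) * (rho * sigma ^+ k * H * yi).
  by rewrite hsolE; ring.
rewrite rho_sigma /gtsol DM3 Dy_rho' (Dexp _ Dy_sigma) dG.
have -> : (rho * - yi * sigma ^+ k + rho * (k%:R * (sigma ^+ k * yi))) * Gt +
    rho * sigma ^+ k * - (b%:R * (yi * Gt')) =
    - (rho * sigma ^+ k * yi * ((b%:R * Gt' + Gt) - k%:R * Gt)) by ring.
by rewrite Gt'E; ring.
Qed.

Lemma fibred_hsol : fibred i yi hsol.
Proof.
have [_ dxH dyH _] := cH.
rewrite /fibred -/rho /hsol [LHS]da_DM [in RHS]da_DM (Dexp _ Dy_sigma) (Dexp _ Dx_sigma) dxH dyH.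
have -> : rho * (k.+1%:R * (sigma ^+ k.+1 * - xi) * H + sigma ^+ k.+1 * (b%:R * (xi * H')))
  = (rho * xi) * (k.+1%:R * - sigma ^+ k.+1 * H + sigma ^+ k.+1 * (b%:R * H')) by ring.
by rewrite rho_xi; ring.
Qed.

(** Dz acts on [H] alone, through tau, and [H'E] is designed so that the terms in [H] cancel. *)
Lemma hsol_defect : rho ^+ b * hsol - Dz hsol = eps%:R * tsol.
Proof.
have [_ _ _ dH] := cH.
rewrite /hsol da_DM (Dexp _ Dz_sigma) dH H'E /tsol.
have -> : rho ^+ b * (sigma ^+ k.+1 * H) -
   (k.+1%:R * (sigma ^+ k.+1 * 0) * H +
    sigma ^+ k.+1 * (zi * (z * rho ^+ b * (H - eps%:R * T)))) =
   rho ^+ b * (sigma ^+ k.+1 * H) -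
    (z * zi) * (sigma ^+ k.+1 * rho ^+ b * (H - eps%:R * T)) by ring.
by rewrite X_inv; ring.
Qed.

Lemma euler_tsol : x * Dx tsol = l%:R * tsol.
Proof.
have [_ dT _ _] := cT.
rewrite /tsol DM3 (Dexp _ Dx_sigma) (Dexp _ Dx_rho') dT.
have -> : x * ((k.+1%:R * (sigma ^+ k.+1 * - xi) * rho ^+ b +
     sigma ^+ k.+1 * (b%:R * (rho ^+ b * xi))) * T +
     sigma ^+ k.+1 * rho ^+ b * (b%:R * (xi * T'))) =
  (x * xi) * (sigma ^+ k.+1 * rho ^+ b * ((b%:R * T' + b%:R * T) - k.+1%:R * T)) by ring.
by rewrite X_inv T'E -addSn natrD; ring.
Qed.

(** From the eigenvalue [l] of x Dx one gets x Dx^(m + 1) = (l - m) Dx^m on [tsol]; at m = l the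
    right side vanishes, and x is invertible. *)
Lemma iter_Dx_tsol : iter l.+1 Dx tsol = 0.
Proof.
have E m : x * iter m.+1 Dx tsol + m%:R * iter m Dx tsol = l%:R * iter m Dx tsol.
  elim: m => [|m IH]; first by rewrite mul0r addr0 euler_tsol.
  have := congr1 Dx IH.
  rewrite da_DD !da_DM da_Dvar !Dnat eqxx -!iterS => E.
  by rewrite -natr1; move: E; rewrite !mul0r !add0r => <-; rewrite mul1r; ring.
have := E l; move=> /eqP; rewrite -subr_eq0 addrK => /eqP E'.
have -> : iter l.+1 Dx tsol = xi * (x * iter l.+1 Dx tsol).
  by rewrite mulrA [xi * x]mulrC X_inv mul1r.
by rewrite E' mulr0.
Qed.

Lemma blockwise_hsol : blockwise i hsol.
Proof.
by case: cH => bH _ _ _; apply: blockwiseM => //; exact/blockwiseX/blockwise_sigma.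
Qed.

Lemma blockwise_gsol : blockwise i gsol.
Proof.
by case: cG => bG _ _ _; apply: blockwiseM => //; exact/blockwiseX/blockwise_sigma.
Qed.

Lemma blockwise_gtsol : blockwise i gtsol.
Proof.
case: cGt => bG _ _ _; apply: blockwiseM => //.
apply: blockwiseM; last exact/blockwiseX/blockwise_sigma.
exact: blockwise_rho.
Qed.

Lemma iter_defect : iter (b - 1 - s) Dx (rho ^+ b * hsol - Dz hsol) = 0.
Proof.
rewrite hsol_defect; case: epsE => [->|ls]; first by rewrite mul0r iterD_0.
rewrite iterD_const ?Dnat // (@iterD_ge _ _ _ _ l.+1) ?mulr0 ?iter_Dx_tsol //.
lia.
Qed.

Lemma euler_gsol : y * Dy gsol + b%:R * (z * Dz gsol) = k%:R * gsol.
Proof.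
have [_ _ dG dzG] := cG.
rewrite {2}/gsol da_DM (Dexp _ Dz_sigma) dzG.
rewrite /gsol da_DM (Dexp _ Dy_sigma) dG.
have -> : y * (k%:R * (sigma ^+ k * yi) * G + sigma ^+ k * - (b%:R * (yi * G'))) +
   b%:R * (z * (k%:R * (sigma ^+ k * 0) * G + sigma ^+ k * (zi * G'))) =
   (y * yi) * (k%:R * (sigma ^+ k * G) - sigma ^+ k * (b%:R * G')) +
   (z * zi) * (sigma ^+ k * (b%:R * G')) by ring.
by rewrite !X_inv; ring.
Qed.

Lemma euler_gtsol :
  y * Dy gtsol + b%:R * (z * Dz gtsol) + gtsol = k%:R * gtsol.
Proof.
have [_ _ dG dzG] := cGt.
rewrite {2}/gtsol DM3 (Dexp _ Dz_sigma) Dz_rho' dzG.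
rewrite {1}/gtsol DM3 (Dexp _ Dy_sigma) Dy_rho' dG.
have -> : y * ((rho * - yi * sigma ^+ k + rho * (k%:R * (sigma ^+ k * yi))) * Gt
    + rho * sigma ^+ k * - (b%:R * (yi * Gt'))) +
   b%:R * (z * ((rho * 0 * sigma ^+ k + rho * (k%:R * (sigma ^+ k * 0))) * Gt
    + rho * sigma ^+ k * (zi * Gt'))) =
   (y * yi) * (rho * sigma ^+ k * (k%:R * Gt - Gt - b%:R * Gt')) +
   (z * zi) * (rho * sigma ^+ k * (b%:R * Gt')) by ring.
by rewrite !X_inv /gtsol; ring.
Qed.

Lemma toric_gsol : s = 0%N -> toric_solution (Adb d b) gsol.
Proof.
move=> s_0; apply: (@toric_block _ _ _ _ d0 i yi yyi s hsol gsol gtsol) => //.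
- exact: blockwise_hsol.
- exact: blockwise_gsol.
- exact: blockwise_gtsol.
- exact: fibred_hsol.
- exact: Dx_gsol.
- exact: Dy_gsol.
- by rewrite s_0.
- by rewrite s_0.
- exact: iter_defect.
Qed.

Lemma x_y_rho : x + y * rho = 0.
Proof. by rewrite /rho (y_rho yyi) subrr. Qed.

Definition fsol (o : 'I_(d - 1)) := X (col_x o) * gsol + X (col_y o) * gtsol.

(** When o = i the extra terms, coming from the derivatives of [gsol] and [gtsol], cancel by x + y
    rho = 0. *)
Lemma Dxo_fsol o : D (col_x o) (fsol o) = gsol.
Proof.
rewrite /fsol da_DD (da_DM _ _ gsol) (da_DM _ _ gtsol) !da_Dvar eqxx eq_col_xy.
have [->|oi] := eqVneq o i.
  rewrite Dx_gsol Dx_gtsol.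
  have -> : true%:R * gsol + x * - (hsol * yi) +
    (false%:R * gtsol + y * - (rho * hsol * yi)) =
    gsol - (x + y * rho) * hsol * yi by rewrite /=; ring.
  by rewrite x_y_rho !mul0r subr0.
by rewrite (blockwise_gsol oi).1 (blockwise_gtsol oi).1 /=; ring.
Qed.

Lemma Dyo_fsol o : D (col_y o) (fsol o) = gtsol.
Proof.
rewrite /fsol da_DD (da_DM _ _ gsol) (da_DM _ _ gtsol) !da_Dvar eqxx eq_col_yx.
have [->|oi] := eqVneq o i.
  rewrite Dy_gsol Dy_gtsol.
  have -> : false%:R * gsol + x * - (rho * hsol * yi) +
    (true%:R * gtsol + y * - (rho ^+ 2 * hsol * yi)) =
    gtsol - (x + y * rho) * rho * hsol * yi by rewrite /=; ring.
  by rewrite x_y_rho !mul0r subr0.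
by rewrite (blockwise_gsol oi).2 (blockwise_gtsol oi).2 /=; ring.
Qed.

Lemma toric_fsol o : s = 1%N -> toric_solution (Adb d b) (fsol o).
Proof.
move=> s_1.
apply: (@toric_block_shift _ _ _ _ d0 i yi yyi s hsol gsol gtsol) => //.
- exact: blockwise_hsol.
- exact: blockwise_gsol.
- exact: blockwise_gtsol.
- exact: fibred_hsol.
- exact: Dx_gsol.
- exact: Dy_gsol.
- by move=> _; exact: Dx_gtsol.
- by move=> _; exact: Dy_gtsol.
- exact: iter_defect.
- exact: Dxo_fsol.
- exact: Dyo_fsol.
Qed.

End OneBlock.

Lemma euler_row f j : \sum_c (X c * D c f) *~ Adb d b (row_of j) c =
  X (col_x j) * D (col_x j) f + X (col_y j) * D (col_y j) f.
Proof.
have pick (F : 'I_(d - 1) -> W) : \sum_(k < d - 1) F k *~ ((j == k)%:R : int) = F j.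
  rewrite (bigD1 j) //= eqxx mulr1z big1 ?addr0 // => k.
  by rewrite eq_sym => /negPf ->; rewrite mulr0z.
rewrite (sum_col d0) (Adb_rz d0) mulr0z addr0; congr (_ + _).
  by rewrite -[RHS](pick (fun j => X (col_x j) * D (col_x j) f)); apply: eq_bigr => k _; rewrite Adb_rx.
by rewrite -[RHS](pick (fun j => X (col_y j) * D (col_y j) f)); apply: eq_bigr => k _; rewrite Adb_ry.
Qed.

Lemma euler_last f : \sum_c (X c * D c f) *~ Adb d b (row_last d0) c =
  \sum_j X (col_y j) * D (col_y j) f + b%:R * (z * Dz f).
Proof.
rewrite (sum_col d0) Adb_lz [X in X + _ + _]big1 ?add0r => [|j _]; last first.
  by rewrite Adb_lx mulr0z.
congr (_ + _); last by rewrite -mulrzl natz -pmulrn.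
by apply: eq_bigr => j _; rewrite Adb_ly mulr1z.
Qed.

End Family.

(** * Solutions x_o Z(z) and y_o Z(z) *)

Section MonomialSolution.
Context {K : fieldType} {d b : nat} (W : diff_alg K (2 * d - 1)).
Hypotheses (d0 : (0 < d)%N) (b2 : (2 <= b)%N).
Local Notation D := (@da_D _ _ W).
Variables (o : 'I_(d - 1)) (f : W).
Hypothesis f_other : blockwise o f.
Hypotheses (fxx : D (col_x o) (D (col_x o) f) = 0)
  (fxy : D (col_x o) (D (col_y o) f) = 0)
  (fyy : D (col_y o) (D (col_y o) f) = 0).

Let mD_sub (u : 'X_{1..2 * d - 1}) c (g : W) :
  (0 < u c)%N -> mD u g = mD (u - U_(c))%MM (D c g).
Proof.
move=> uc; have {1}-> : u = ((u - U_(c)) + U_(c))%MM by rewrite submK // lep1mP -lt0n.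
by rewrite mD_add1 D_mD.
Qed.

Let mD_other (u : 'X_{1..2 * d - 1}) j : j != o -> (0 < mnm_xy u j)%N -> mD u f = 0.
Proof.
move=> jo; rewrite /mnm_xy addn_gt0 => /orP[uj|uj]; rewrite (mD_sub _ uj).
  by rewrite (f_other jo).1 mDz.
by rewrite (f_other jo).2 mDz.
Qed.

Let mD_twice (u : 'X_{1..2 * d - 1}) : (1 < mnm_xy u o)%N -> mD u f = 0.
Proof.
rewrite /mnm_xy => u2; have [ux|ux] := posnP (u (col_x o)).
  have uy : (0 < u (col_y o))%N by lia.
  rewrite (mD_sub _ uy) (@mD_sub _ (col_y o)) ?fyy ?mDz //.
  by rewrite mnmBE mnm1E eqxx; lia.
rewrite (mD_sub _ ux); have [ux1|ux1] := posnP ((u - U_(col_x o))%MM (col_x o)); last first.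
  by rewrite (mD_sub _ ux1) fxx mDz.
rewrite (@mD_sub _ (col_y o)) ?[D (col_y o) _]da_DC ?fxy ?mDz //.
by move: ux1; rewrite !mnmBE !mnm1E eqxx eq_col_xy /=; lia.
Qed.

(** Only exponents with at most one factor in block [o], and none in other blocks, give nonzero
    derivatives. For these, equal weights leave u_y + b u_z = v_y + b v_z with u_y, v_y <= 1 < b,
    hence u = v. *)
Lemma toric_monomial : toric_solution (Adb d b) f.
Proof.
move=> u v /(mnm_weightP d0)[uv uvz].
have [[j /andP[jo uj]]|/existsPn nj] := altP (@existsP _ (fun j => (j != o) && (0 < mnm_xy u j)%N)).
  by rewrite (mD_other jo uj) (mD_other jo) // -uv.
have [u2|u2] := ltnP 1 (mnm_xy u o); first by rewrite !mD_twice // -uv.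
have uz j : j != o -> mnm_xy u j = 0%N.
  by move=> jo; have := nj j; rewrite jo /= lt0n negbK => /eqP.
have yo w : (forall j, j != o -> mnm_xy w j = 0%N) -> mnm_y w = w (col_y o).
  move=> wz; rewrite /mnm_y (bigD1 o) //= big1 ?addn0 // => j jo.
  by have /eqP := wz j jo; rewrite addn_eq0 => /andP[_ /eqP].
have vz j : j != o -> mnm_xy v j = 0%N by move=> jo; rewrite -uv uz.
move: uvz; rewrite !yo // => uvz.
have uo := uv o; rewrite /mnm_xy in uo u2.
have qq : u (col_z d0) = v (col_z d0).
  have [qq|qq|//] := ltngtP (u (col_z d0)) (v (col_z d0)).
    have := leq_mul (leqnn b) qq; rewrite mulnS; lia.
  have := leq_mul (leqnn b) qq; rewrite mulnS; lia.
suff -> : u = v by [].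
apply/mnmP => c; case: (columnP d0 c) => [j ->|j ->|-> //].
  have [->|jo] := eqVneq j o; first by lia.
  by have := uz j jo; have := vz j jo; rewrite /mnm_xy; lia.
have [->|jo] := eqVneq j o; first by lia.
by have := uz j jo; have := vz j jo; rewrite /mnm_xy; lia.
Qed.

End MonomialSolution.

(** * Annihilation and independence of the constructed solutions *)

Section HypergeometricSolutions.
Context {K : numFieldType} {d b : nat} (W : diff_alg K (2 * d - 1)).
Hypotheses (d0 : (0 < d)%N) (b2 : (2 <= b)%N).
Local Notation X := (@da_var _ _ W).
Local Notation D := (@da_D _ _ W).
Local Notation cst := (@da_cst _ _ W).
Local Notation z := (X (col_z d0)).
Local Notation Dz := (D (col_z d0)).
Variable inv : 'I_(2 * d - 1) -> W.
Hypothesis X_inv : forall c, X c * inv c = 1.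
Variables s k : nat.
Hypothesis s1 : (s <= 1)%N.
Local Notation N := (b - s)%N.

(** The solutions l < N - 1 have a defect of degree [l] in x; the last one, l = N - 1, has zero
    defect. *)
Definition eps (l : nat) : nat := (l < N.-1)%N.

(* The system satisfied by the column (T, H, G, Gt). *)
Definition fuchsA (l : nat) : 'M[K]_4 := \matrix_(i, j)
  nth 0 (nth [::] [:: [:: ((k + l).+1%:R - b%:R) / b%:R; 0; 0; 0];
    [:: 0; 0; 0; 0]; [:: 0; b%:R^-1; k%:R / b%:R; 0];
    [:: 0; b%:R^-1; 0; (k%:R - 1) / b%:R]] i) j.
Definition fuchsB (l : nat) : 'M[K]_4 := \matrix_(i, j)
  nth 0 (nth [::] [:: [:: 0; 0; 0; 0]; [:: - (eps l)%:R; 1; 0; 0];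
    [:: 0; 0; 0; 0]; [:: 0; 0; 0; 0]] i) j.

Local Notation rho := (rho inv).
Local Notation sigma := (sigma inv).
Definition tau i : W := z * rho i ^+ b.
Definition tau_inv i : W := inv (col_z d0) * sigma i ^+ b.

Variable F : 'I_(d - 1) -> nat -> 'I_4 -> W.
Hypothesis F_fuchs : forall i l, (l < N)%N -> forall c a, D c (F i l a) =
  D c (tau i) *
  \sum_a' (cst (fuchsA l a a') * tau_inv i + cst (fuchsB l a a')) * F i l a'.

Lemma tau_invP i : tau i * tau_inv i = 1.
Proof.
have -> : tau i * tau_inv i = (z * inv (col_z d0)) * (rho i * sigma i) ^+ b.
  by rewrite /tau /tau_inv (exprMn _ (rho i)); ring.
by rewrite X_inv (rho_sigma X_inv) expr1n mul1r.
Qed.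

(** The derivative tau dF/dtau, read off from the system, so that [F] may be any element of the
    algebra rather than a composite with [tau]. *)
Definition tau_deriv i l a : W := tau i *
  \sum_a' (cst (fuchsA l a a') * tau_inv i + cst (fuchsB l a a')) * F i l a'.

Lemma D_F i l c a : (l < N)%N ->
  D c (F i l a) = D c (tau i) * tau_inv i * tau_deriv i l a.
Proof.
move=> lN; rewrite F_fuchs // /tau_deriv.
set S := \sum_a' _.
have -> : D c (tau i) * tau_inv i * (tau i * S) = (tau i * tau_inv i) * (D c (tau i) * S) by ring.
by rewrite tau_invP mul1r.
Qed.

Lemma tau_derivE i l a : tau_deriv i l a =
  \sum_a' (cst (fuchsA l a a') + tau i * cst (fuchsB l a a')) * F i l a'.
Proof.
rewrite /tau_deriv mulr_sumr; apply: eq_bigr => a' _.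
have -> : tau i * ((cst (fuchsA l a a') * tau_inv i + cst (fuchsB l a a')) * F i l a')
  = ((tau i * tau_inv i) * cst (fuchsA l a a') + tau i * cst (fuchsB l a a')) * F i l a' by ring.
by rewrite tau_invP mul1r.
Qed.

Lemma Dlog_tau i c : D c (tau i) * tau_inv i =
  D c z * inv (col_z d0) + b%:R * (D c (rho i) * sigma i).
Proof.
have Dpow m : D c (rho i ^+ m) * sigma i ^+ m = m%:R * (D c (rho i) * sigma i).
  elim: m => [|m IH]; first by rewrite D1 !mul0r.
  have -> : D c (rho i ^+ m.+1) * sigma i ^+ m.+1 =
    (rho i * sigma i) ^+ m * (D c (rho i) * sigma i) +
    (rho i * sigma i) * (D c (rho i ^+ m) * sigma i ^+ m).
    by rewrite !exprS (da_DM _ (rho i)) (exprMn _ (rho i)); ring.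
  by rewrite (rho_sigma X_inv) expr1n IH -natr1; ring.
rewrite /tau /tau_inv da_DM.
have -> : (D c z * rho i ^+ b + z * D c (rho i ^+ b)) * (inv (col_z d0) * sigma i ^+ b) =
  (rho i * sigma i) ^+ b * (D c z * inv (col_z d0)) +
  (z * inv (col_z d0)) * (D c (rho i ^+ b) * sigma i ^+ b) by rewrite (exprMn _ (rho i)); ring.
by rewrite Dpow (rho_sigma X_inv) X_inv expr1n !mul1r.
Qed.

(** The logarithmic derivatives of z rho^b in x, y, z are b / x, - b / y and 1 / z. *)
Lemma tau_chain_F i l a : (l < N)%N ->
  @tau_chain _ _ b _ d0 inv i (F i l a) (tau_deriv i l a).
Proof.
move=> lN; split.
- move=> j ji; rewrite !D_F // !Dlog_tau.
  have [-> ->] := @blockwise_rho _ _ W i _ (X_inv (col_y i)) j ji.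
  by have [-> ->] := @blockwise_z _ _ W d0 i j ji; rewrite !(mul0r, mulr0, addr0).
- rewrite D_F // Dlog_tau da_Dvar eq_col_xz (Dx_rho' X_inv) /=.
  have -> : (0%:R * inv (col_z d0) + b%:R * (rho i * inv (col_x i) * sigma i)) * tau_deriv i l a
    = (rho i * sigma i) * (b%:R * (inv (col_x i) * tau_deriv i l a)) by ring.
  by rewrite (rho_sigma X_inv) mul1r.
- rewrite D_F // Dlog_tau da_Dvar eq_col_yz (Dy_rho' X_inv) /=.
  have -> : (0%:R * inv (col_z d0) + b%:R * (rho i * - inv (col_y i) * sigma i)) * tau_deriv i l a
    = - (rho i * sigma i) * (b%:R * (inv (col_y i) * tau_deriv i l a)) by ring.
  by rewrite (rho_sigma X_inv) mulN1r.
- rewrite D_F // Dlog_tau da_Dvar eqxx (Dz_rho' d0 X_inv) /=; ring.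
Qed.

Local Notation T i l := (F i l 0).
Local Notation H i l := (F i l 1).
Local Notation G i l := (F i l (inord 2)).
Local Notation Gt i l := (F i l (inord 3)).

Let b0 : b%:R != 0 :> K. Proof. by rewrite pnatr_eq0; lia. Qed.

Let sum4 (f : 'I_4 -> W) : \sum_a f a = f 0 + f 1 + f (inord 2) + f (inord 3).
Proof.
rewrite !big_ord_recl big_ord0 addr0 !addrA.
by congr (f _ + f _ + f _ + f _); apply: val_inj; rewrite /= ?inordK.
Qed.

Let cst_b (c : K) : b%:R * cst c = cst (b%:R * c).
Proof. by rewrite rmorphM rmorph_nat. Qed.

Lemma T'E i l : b%:R * tau_deriv i l 0 + b%:R * T i l = (k + l).+1%:R * T i l.
Proof.
rewrite tau_derivE sum4 !mxE /= ?inordK // !rmorph0 !(mul0r, mulr0, addr0).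
rewrite mulrA cst_b mulrCA divff // mulr1 rmorphB !rmorph_nat; ring.
Qed.

Lemma H'E i l : tau_deriv i l 1 = z * rho i ^+ b * (H i l - (eps l)%:R * T i l).
Proof.
rewrite tau_derivE sum4 !mxE /= ?inordK // !rmorph0 !(mul0r, mulr0, addr0, add0r).
rewrite rmorphN rmorph1 rmorph_nat /tau; ring.
Qed.

Lemma G'E i l : b%:R * tau_deriv i l (inord 2) = k%:R * G i l + H i l.
Proof.
rewrite tau_derivE sum4 !mxE /= ?inordK //= !rmorph0 !(mul0r, mulr0, addr0, add0r).
rewrite mulrDr !mulrA !cst_b mulrCA divff // mulr1 rmorph1 rmorph_nat; ring.
Qed.

Lemma Gt'E i l : b%:R * tau_deriv i l (inord 3) + Gt i l = k%:R * Gt i l + H i l.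
Proof.
rewrite tau_derivE sum4 !mxE /= ?inordK //= !rmorph0 !(mul0r, mulr0, addr0, add0r).
rewrite mulrDr !mulrA !cst_b mulrCA divff // mulr1 rmorph1 rmorphB rmorph1 rmorph_nat; ring.
Qed.

Lemma epsE l : (l < N)%N -> eps l = 0%N \/ (l + s + 2 <= b)%N.
Proof. by rewrite /eps => lN; case: ltnP => ?; [right; lia|left]. Qed.

Local Notation h i l := (hsol inv i k (H i l)).
Local Notation g i l := (gsol inv i k (G i l)).
Local Notation gt i l := (gtsol inv i k (Gt i l)).
Local Notation f i l o := (fsol inv i k (G i l) (Gt i l) o).
Local Notation t i l := (@tsol _ _ b _ inv i k (T i l)).

Section Annihilation.
Variables (i : 'I_(d - 1)) (l : nat).
Hypothesis lN : (l < N)%N.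

Let cF a := tau_chain_F i a lN.

Lemma gsol_annihilated (beta : 'cV[K]_d) : s = 0%N ->
  (forall j, beta (row_of j) 0 = 0) -> beta (row_last d0) 0 = k%:R ->
  forall P, hyp_ideal (Adb d b) beta P -> dact P (g i l) = 0.
Proof.
move=> s_0 bj bl; apply: dact_hyp_ideal.
  exact: (toric_gsol X_inv s1 b2 (cF 0) (cF 1) (cF (inord 2)) (cF (inord 3)) (T'E i l) (H'E i l)
    (G'E i l) (epsE lN) s_0).
have bg := blockwise_gsol X_inv k (cF (inord 2)).
have Dxg := Dx_gsol X_inv (cF (inord 2)) (G'E i l).
have Dyg := Dy_gsol X_inv (cF (inord 2)) (G'E i l).
move=> r; case: (adb_rowP d0 r) => [[j ->]|->].
  rewrite euler_row // bj rmorph0 mul0r; have [->|ji] := eqVneq j i; last first.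
    by rewrite (bg j ji).1 (bg j ji).2 !mulr0 addr0.
  rewrite Dxg Dyg.
  have -> : X (col_x i) * - (h i l * inv (col_y i)) +
    X (col_y i) * - (rho i * h i l * inv (col_y i)) =
    - (X (col_x i) + X (col_y i) * rho i) * (h i l * inv (col_y i)) by ring.
  by rewrite (x_y_rho X_inv) oppr0 mul0r.
rewrite (euler_last d0) // bl rmorph_nat.
rewrite -(euler_gsol X_inv k (cF (inord 2))); congr (_ + _).
by rewrite (bigD1 i) //= big1 ?addr0 // => j ji; rewrite (bg j ji).2 mulr0.
Qed.

Lemma fsol_annihilated (beta : 'cV[K]_d) o : s = 1%N ->
  (forall j, beta (row_of j) 0 = (j == o)%:R) -> beta (row_last d0) 0 = k%:R ->
  forall P, hyp_ideal (Adb d b) beta P -> dact P (f i l o) = 0.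
Proof.
move=> s_1 bj bl; apply: dact_hyp_ideal.
  exact: (toric_fsol X_inv s1 b2 (cF 0) (cF 1) (cF (inord 2)) (cF (inord 3)) (T'E i l) (H'E i l)
    (G'E i l) (Gt'E i l) (epsE lN) o s_1).
have bg := blockwise_gsol X_inv k (cF (inord 2)).
have bgt := blockwise_gtsol X_inv k (cF (inord 3)).
have Dxg := Dx_gsol X_inv (cF (inord 2)) (G'E i l).
have Dyg := Dy_gsol X_inv (cF (inord 2)) (G'E i l).
have Dxgt := Dx_gtsol X_inv (cF (inord 3)) (Gt'E i l).
have Dygt := Dy_gtsol X_inv (cF (inord 3)) (Gt'E i l).
have fx := Dxo_fsol X_inv (cF (inord 2)) (cF (inord 3)) (G'E i l) (Gt'E i l) o.
have fy := Dyo_fsol X_inv (cF (inord 2)) (cF (inord 3)) (G'E i l) (Gt'E i l) o.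
have Do c : c != col_x o -> c != col_y o ->
    D c (f i l o) = X (col_x o) * D c (g i l) + X (col_y o) * D c (gt i l).
  move=> cx cy; rewrite /fsol da_DD (da_DM _ _ (g i l)) (da_DM _ _ (gt i l)).
  by rewrite !da_Dvar (negPf cx) (negPf cy) !mul0r !add0r.
have xyr : X (col_x i) = - (X (col_y i) * rho i).
  by apply/eqP; rewrite -addr_eq0 (x_y_rho X_inv).
move=> r; case: (adb_rowP d0 r) => [[j ->]|->].
  rewrite euler_row // bj rmorph_nat; have [->|jo] := eqVneq j o.
    by rewrite fx fy mul1r.
  rewrite mul0r !Do ?eq_col_x ?eq_col_y ?eq_col_xy ?eq_col_yx //.
  have [->|ji] := eqVneq j i; last first.
    by rewrite (bg j ji).1 (bg j ji).2 (bgt j ji).1 (bgt j ji).2; ring.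
  rewrite Dxg Dyg Dxgt Dygt xyr; ring.
rewrite (euler_last d0) // bl rmorph_nat.
rewrite Do ?eq_col_zx ?eq_col_zy //.
have E1 := euler_gsol X_inv k (cF (inord 2)).
have E2 := euler_gtsol X_inv k (cF (inord 3)).
(* For o = i the y-derivative of the solution is [gt], and the remaining terms x Dy g + y Dy gt
   cancel, because Dy gt = rho Dy g and x + y rho = 0. *)
have [oi|oi] := eqVneq o i.
  rewrite (bigD1 o) //= big1 ?addr0; last first.
    move=> j jo; rewrite Do ?eq_col_y ?eq_col_yx //.
    by rewrite oi in jo; rewrite (bg j jo).2 (bgt j jo).2; ring.
  rewrite fy oi /fsol.
  have -> : k%:R * (X (col_x i) * g i l + X (col_y i) * gt i l) =
     X (col_x i) * (k%:R * g i l) + X (col_y i) * (k%:R * gt i l) by ring.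
  rewrite -E1 -E2 Dyg Dygt.
  set hh := h i l; set yi := inv _; set a := Dz _; set a' := Dz _; set gg := gt i l.
  rewrite xyr; ring.
rewrite (bigD1 o) //= (bigD1 i) 1?eq_sym //= big1 ?addr0; last first.
  move=> j /andP[jo ji]; rewrite Do ?eq_col_y ?eq_col_yx //.
  by rewrite (bg j ji).2 (bgt j ji).2; ring.
rewrite fy Do ?eq_col_y ?eq_col_yx 1?eq_sym // /fsol.
have -> : k%:R * (X (col_x o) * g i l + X (col_y o) * gt i l) =
   X (col_x o) * (k%:R * g i l) + X (col_y o) * (k%:R * gt i l) by ring.
rewrite -E1 -E2.
by ring.
Qed.

End Annihilation.

Section MonomialAnnihilation.
Variables (Z0 Z1 : W) (o : 'I_(d - 1)).
Hypothesis Z0_xy : forall j, D (col_x j) Z0 = 0 /\ D (col_y j) Z0 = 0.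
Hypothesis Z1_xy : forall j, D (col_x j) Z1 = 0 /\ D (col_y j) Z1 = 0.
Hypothesis Z0_z : b%:R * (z * Dz Z0) = k%:R * Z0.
Hypothesis Z1_z : b%:R * (z * Dz Z1) + Z1 = k%:R * Z1.
Variable beta : 'cV[K]_d.
Hypothesis bj : forall j, beta (row_of j) 0 = (j == o)%:R.
Hypothesis bl : beta (row_last d0) 0 = k%:R.

Lemma xZ0_annihilated P : hyp_ideal (Adb d b) beta P ->
  dact P (X (col_x o) * Z0) = 0.
Proof.
have Dx j : D (col_x j) (X (col_x o) * Z0) = (j == o)%:R * Z0.
  by rewrite da_DM da_Dvar eq_col_x (Z0_xy j).1 mulr0 addr0.
have Dy j : D (col_y j) (X (col_x o) * Z0) = 0.
  by rewrite da_DM da_Dvar eq_col_yx (Z0_xy j).2 mulr0 mul0r addr0.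
move: P; apply: dact_hyp_ideal.
  apply: (toric_monomial d0 b2 (o := o)).
  - by move=> j jo; rewrite Dx Dy (negPf jo) mul0r.
  - by rewrite Dx eqxx mul1r (Z0_xy o).1.
  - by rewrite Dy D0.
  - by rewrite Dy D0.
move=> r; case: (adb_rowP d0 r) => [[j ->]|->].
  rewrite euler_row // bj rmorph_nat Dx Dy mulr0 addr0.
  by have [->|] := eqVneq j o; rewrite ?mul1r // !mul0r mulr0.
rewrite (euler_last d0) // bl rmorph_nat big1 ?add0r => [|j _]; last by rewrite Dy mulr0.
rewrite da_DM da_Dvar eq_col_zx mul0r add0r.
by rewrite [RHS]mulrCA -Z0_z; ring.
Qed.

Lemma yZ1_annihilated P : hyp_ideal (Adb d b) beta P ->
  dact P (X (col_y o) * Z1) = 0.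
Proof.
have Dy j : D (col_y j) (X (col_y o) * Z1) = (j == o)%:R * Z1.
  by rewrite da_DM da_Dvar eq_col_y (Z1_xy j).2 mulr0 addr0.
have Dx j : D (col_x j) (X (col_y o) * Z1) = 0.
  by rewrite da_DM da_Dvar eq_col_xy (Z1_xy j).1 mulr0 mul0r addr0.
move: P; apply: dact_hyp_ideal.
  apply: (toric_monomial d0 b2 (o := o)).
  - by move=> j jo; rewrite Dx Dy (negPf jo) mul0r.
  - by rewrite Dx D0.
  - by rewrite Dy eqxx mul1r (Z1_xy o).1.
  - by rewrite Dy eqxx mul1r (Z1_xy o).2.
move=> r; case: (adb_rowP d0 r) => [[j ->]|->].
  rewrite euler_row // bj rmorph_nat Dx Dy mulr0 add0r.
  by have [->|] := eqVneq j o; rewrite ?mul1r // !mul0r mulr0.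
rewrite (euler_last d0) // bl rmorph_nat.
rewrite (bigD1 o) //= big1 ?addr0 => [|j jo]; last by rewrite Dy (negPf jo) mul0r mulr0.
rewrite Dy eqxx mul1r da_DM da_Dvar eq_col_zy mul0r add0r.
by rewrite [RHS]mulrCA -Z1_z; ring.
Qed.

End MonomialAnnihilation.

(* Z stands for the functions vanishing near the base point, e for the
   evaluation there. *)
Section Independence.
Variables (Z : W -> Prop) (e : {rmorphism W -> K}).
Hypotheses (ZD : forall u v, Z u -> Z v -> Z (u + v))
  (ZM : forall u v, Z v -> Z (u * v)) (ZDer : forall c u, Z u -> Z (D c u))
  (Ze : forall u, Z u -> e u = 0) (ecst : cancel cst e).
Hypothesis e_T : forall i l, (l < N)%N -> e (T i l) = 1.
Hypothesis e_H : forall i l, (l < N)%N -> e (H i l) = 1.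

Let eM u v : e (u * v) = e u * e v.
Proof. exact: rmorphM. Qed.

Let e_sum n (u : 'I_n -> W) : e (\sum_l u l) = \sum_l e (u l).
Proof. exact: rmorph_sum. Qed.

Let e_rho i : e (rho i) != 0.
Proof.
have := congr1 e (rho_sigma X_inv i); rewrite rmorphM rmorph1 => E.
by apply/eqP => z0; move: E; rewrite z0 mul0r => /esym/eqP; rewrite oner_eq0.
Qed.

Let e_sigma i : e (sigma i) != 0.
Proof.
have := congr1 e (rho_sigma X_inv i); rewrite rmorphM rmorph1 => E.
by apply/eqP => z0; move: E; rewrite z0 mulr0 => /esym/eqP; rewrite oner_eq0.
Qed.

Lemma Z_euler_eigen i (a : nat -> K) m :
  Z (\sum_(l < N) cst (a l) * t i l) ->
  Z (\sum_(l < N) cst (a l * (l%:R - m%:R)) * t i l).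
Proof.
move=> Za.
have -> : \sum_(l < N) cst (a l * (l%:R - m%:R)) * t i l =
  X (col_x i) * D (col_x i) (\sum_(l < N) cst (a l) * t i l) +
  (- m%:R) * (\sum_(l < N) cst (a l) * t i l).
  rewrite Dsum !mulr_sumr -big_split /=; apply: eq_bigr => l _.
  rewrite DcstM [X (col_x i) * _]mulrCA.
  rewrite (euler_tsol X_inv (tau_chain_F i 0 (ltn_ord l)) (T'E i l)).
  by rewrite rmorphM rmorphB !rmorph_nat; ring.
by apply: ZD; apply: ZM => //; exact: ZDer.
Qed.

(** The monomials t_l are eigenvectors of x Dx with eigenvalue l; the product of the operators x Dx
    - m filters them. *)
Lemma Z_euler_eigen_prod i (a : nat -> K) (r : seq nat) :
  Z (\sum_(l < N) cst (a l) * t i l) ->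
  Z (\sum_(l < N) cst (a l * \prod_(m <- r) (l%:R - m%:R)) * t i l).
Proof.
elim: r a => [|m r IH] a Za.
  by under eq_bigr do rewrite big_nil mulr1.
under eq_bigr do rewrite big_cons (mulrA (a _)).
by apply: (IH (fun l => a l * (l%:R - m%:R))); exact: Z_euler_eigen.
Qed.

(** The operator rho^b - Dz maps h_l to eps_l t_l, and the t_l have distinct degrees in x. The one
    h_l that it kills is then left alone, and it does not vanish at the base point. *)
Lemma Z_hsol i (c : nat -> K) : Z (\sum_(l < N) cst (c l) * h i l) ->
  forall l, (l < N)%N -> c l = 0.
Proof.
move=> Zc.
have Zt : Z (\sum_(l < N) cst (c l * (eps l)%:R) * t i l).
  have -> : \sum_(l < N) cst (c l * (eps l)%:R) * t i l =
    rho i ^+ b * (\sum_(l < N) cst (c l) * h i l) +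
    (-1) * Dz (\sum_(l < N) cst (c l) * h i l).
    rewrite Dsum !mulr_sumr -big_split /=; apply: eq_bigr => l _.
    have E := hsol_defect X_inv k (tau_chain_F i 1 (ltn_ord l)) (H'E i l).
    rewrite DcstM rmorphM rmorph_nat -mulrA -E; ring.
  by apply: ZD; apply: ZM => //; exact: ZDer.
have e_t l : (l < N)%N -> e (t i l) != 0.
  move=> lN; rewrite /tsol !rmorphM !rmorphXn e_T // mulr1.
  by rewrite mulf_neq0 // expf_neq0.
have c0 l : (l < N.-1)%N -> c l = 0.
  move=> lN.
  (* The product over m < N - 1, m <> l, annihilates every t_m with nonzero [eps] except t_l. *)
  have := Ze (@Z_euler_eigen_prod i (fun l => c l * (eps l)%:R)
    (filter (predC1 l) (iota 0 N.-1)) Zt).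
  have lN' : (l < N)%N by lia.
  rewrite e_sum (bigD1 (Ordinal lN')) //= [X in _ + X]big1 ?addr0; last first.
    move=> m ml; rewrite eM ecst.
    have ml' : (m != l :> nat) by rewrite -val_eqE in ml.
    rewrite /eps; case: (ltnP m N.-1) => mN; last by rewrite mulr0 mul0r mul0r.
    rewrite (big_rem (m : nat)) /= ?subrr ?mul0r ?mulr0 ?mul0r //.
    by rewrite mem_filter /= ml' mem_iota.
  rewrite eM ecst => /eqP; rewrite !mulf_eq0 (negPf (e_t _ lN')) orbF.
  rewrite /eps lN oner_eq0 orbF => /orP[/eqP //|].
  rewrite prodf_seq_eq0 => /hasP[m]; rewrite mem_filter /= => /andP[ml _].
  by rewrite subr_eq0 eqr_nat eq_sym (negPf ml).
move=> l lN; have [/c0 //|lN1] := ltnP l N.-1.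
have := Ze Zc; rewrite e_sum (bigD1 (Ordinal lN)) //= big1 ?addr0; last first.
  move=> m ml; rewrite eM ecst c0 ?mul0r //.
  by have := ltn_ord m; move: ml; rewrite -val_eqE /=; lia.
rewrite eM ecst => /eqP; rewrite mulf_eq0 => /orP[/eqP //|].
by rewrite /hsol rmorphM rmorphXn e_H // mulr1 expf_eq0 (negPf (e_sigma i)) andbF.
Qed.

(** The operator - y_i D_(x_i) kills the other blocks and sends g to h in block i. *)
Lemma Z_gsol (c : 'I_(d - 1) -> nat -> K) :
  Z (\sum_i \sum_(l < N) cst (c i l) * g i l) ->
  forall i l, (l < N)%N -> c i l = 0.
Proof.
move=> Zc i; apply: (@Z_hsol i).
have -> : \sum_(l < N) cst (c i l) * h i l =
  - X (col_y i) * D (col_x i) (\sum_i \sum_(l < N) cst (c i l) * g i l).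
  rewrite Dsum (bigD1 i) //= [X in _ + X]big1 ?addr0 => [|j ji]; last first.
    rewrite Dsum big1 // => l _; rewrite DcstM.
    have bg := blockwise_gsol X_inv k (tau_chain_F j (inord 2) (ltn_ord l)).
    by rewrite (bg i _).1 ?mulr0 // eq_sym.
  rewrite Dsum mulr_sumr; apply: eq_bigr => l _; rewrite DcstM.
  rewrite (Dx_gsol X_inv (tau_chain_F i (inord 2) (ltn_ord l)) (G'E i l)).
  have -> : - X (col_y i) * (cst (c i l) * - (h i l * inv (col_y i))) =
    (X (col_y i) * inv (col_y i)) * (cst (c i l) * h i l) by ring.
  by rewrite X_inv mul1r.
by apply: ZM; exact: ZDer.
Qed.

(** The derivative in x_o turns f into g, x_o Z0 into Z0 and y_o Z1 into 0; a derivative in x_i then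
    removes Z0 and isolates block i. Once the coefficients of the f vanish, Z0 and Z1 are separated
    by the derivatives in x_o and y_o. *)
Lemma Z_fsol (c : 'I_(d - 1) -> nat -> K) (c0 c1 : K) o (Z0 Z1 : W) :
  (forall j, D (col_x j) Z0 = 0 /\ D (col_y j) Z0 = 0) ->
  (forall j, D (col_x j) Z1 = 0 /\ D (col_y j) Z1 = 0) ->
  e Z0 = 1 -> e Z1 = 1 ->
  Z (\sum_i \sum_(l < N) cst (c i l) * f i l o +
     cst c0 * (X (col_x o) * Z0) + cst c1 * (X (col_y o) * Z1)) ->
  [/\ forall i l, (l < N)%N -> c i l = 0, c0 = 0 & c1 = 0].
Proof.
move=> Z0_xy Z1_xy e0 e1; set S := \sum_i _ => Zc.
have DoS : D (col_x o) S = \sum_i \sum_(l < N) cst (c i l) * g i l.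
  rewrite Dsum; apply: eq_bigr => i _; rewrite Dsum; apply: eq_bigr => l _.
  rewrite DcstM; congr (_ * _).
  have cF a := tau_chain_F i a (ltn_ord l).
  exact: (Dxo_fsol X_inv (cF (inord 2)) (cF (inord 3)) (G'E i l) (Gt'E i l) o).
have DoyS : D (col_y o) S = \sum_i \sum_(l < N) cst (c i l) * gt i l.
  rewrite Dsum; apply: eq_bigr => i _; rewrite Dsum; apply: eq_bigr => l _.
  rewrite DcstM; congr (_ * _).
  have cF a := tau_chain_F i a (ltn_ord l).
  exact: (Dyo_fsol X_inv (cF (inord 2)) (cF (inord 3)) (G'E i l) (Gt'E i l) o).
have Zx : Z (\sum_i \sum_(l < N) cst (c i l) * g i l + cst c0 * Z0).
  have := ZDer (col_x o) Zc; rewrite !da_DD !DcstM DoS (da_DM _ _ Z0) (da_DM _ _ Z1).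
  rewrite !da_Dvar eqxx eq_col_xy (Z0_xy o).1 (Z1_xy o).1.
  by rewrite !(mul0r, mulr0, addr0) mul1r.
have Zy : Z (\sum_i \sum_(l < N) cst (c i l) * gt i l + cst c1 * Z1).
  have := ZDer (col_y o) Zc; rewrite !da_DD !DcstM DoyS (da_DM _ _ Z0) (da_DM _ _ Z1).
  rewrite !da_Dvar eqxx eq_col_yx (Z0_xy o).2 (Z1_xy o).2.
  by rewrite !(mul0r, mulr0, addr0) mul1r.
have cz i l : (l < N)%N -> c i l = 0.
  apply: (@Z_hsol i (c i)).
  have -> : \sum_(l < N) cst (c i l) * h i l =
    - X (col_y i) * D (col_x i) (\sum_i \sum_(l < N) cst (c i l) * g i l + cst c0 * Z0).
    rewrite da_DD DcstM (Z0_xy i).1 mulr0 addr0.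
    rewrite Dsum (bigD1 i) //= [X in _ + X]big1 ?addr0 => [|j ji]; last first.
      rewrite Dsum big1 // => m _; rewrite DcstM.
      have bg := blockwise_gsol X_inv k (tau_chain_F j (inord 2) (ltn_ord m)).
      by rewrite (bg i _).1 ?mulr0 // eq_sym.
    rewrite Dsum mulr_sumr; apply: eq_bigr => m _; rewrite DcstM.
    rewrite (Dx_gsol X_inv (tau_chain_F i (inord 2) (ltn_ord m)) (G'E i m)).
    have -> : - X (col_y i) * (cst (c i m) * - (h i m * inv (col_y i))) =
      (X (col_y i) * inv (col_y i)) * (cst (c i m) * h i m) by ring.
    by rewrite X_inv mul1r.
  by apply: ZM; exact: ZDer.
have S0 (u : 'I_(d - 1) -> nat -> W) : \sum_i \sum_(l < N) cst (c i l) * u i l = 0.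
  by rewrite big1 // => i _; rewrite big1 // => l _; rewrite cz // rmorph0 mul0r.
split=> //.
  by have := Ze Zx; rewrite (S0 (fun i l => g i l)) add0r eM ecst e0 mulr1.
by have := Ze Zy; rewrite (S0 (fun i l => gt i l)) add0r eM ecst e1 mulr1.
Qed.

End Independence.

End HypergeometricSolutions.
End Solutions.

From mathcomp Require Import complex.
From mathcomp Require Import all_classical all_reals all_analysis.
Import numFieldNormedType.Exports.
Local Open Scope classical_set_scope.

(** * Power series and linear systems *)

Definition complex_numField (R : realType) : numFieldType := R[i].

Section ComplexSeries.
Context {R : realType}.
Local Notation C := (complex_numField R).
Local Notation cRe := (@complex.Re R).
Local Notation cIm := (@complex.Im R).
Local Open Scope complex_scope.

Lemma normc_le_ReIm (x : C) : `|x| <= `|cRe x|%:C + `|cIm x|%:C.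
Proof.
rewrite {1}[x]complexE (le_trans (ler_normD _ _)) // normrM.
have n1 : `|'i%C| = 1 :> C.
  by rewrite normc_def /= expr0n expr1n add0r sqrtr1.
by rewrite n1 mul1r !normc_def /= !expr0n /= !addr0 !sqrtr_sqr.
Qed.

Lemma cvg_complex (u : nat -> C) (a b : R) :
  (fun n => cRe (u n)) @ \oo --> a -> (fun n => cIm (u n)) @ \oo --> b ->
  u @ \oo --> (a +i* b : C).
Proof.
move=> ua ub; apply/cvgrPdist_lt => e e0.
have eE : e = (cRe e)%:C by rewrite RRe_real // gtr0_real.
have e20 : 0 < cRe e / 2 by rewrite divr_gt0 // -ltcR -eE.
move/cvgrPdist_lt : ua => /(_ _ e20); move/cvgrPdist_lt : ub => /(_ _ e20).
apply: filterS2 => n nb na.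
rewrite (le_lt_trans (normc_le_ReIm _)) // eE [cRe e]splitr rmorphD/= ltrD //.
  by rewrite ltcR; move: na; case: (u n).
by rewrite ltcR; move: nb; case: (u n).
Qed.

(** Real and imaginary parts are dominated by the same geometric series. This instance of
    completeness is what the hypotheses [C_complete] and [K_complete] demand of a general field. *)
Lemma series_dominated (a : nat -> C) (M : C) :
  (forall n, `|a n| <= M / 2 ^+ n) -> exists l : C, series a @ \oo --> l.
Proof.
move=> aM.
have M0 : 0 <= M.
  by have := aM 0%N; rewrite expr0 divr1; apply: le_trans.
have ME : M = (cRe M)%:C by rewrite RRe_real // ger0_real.
have aM' n : `|a n| <= (cRe M / 2 ^+ n)%:C.
  by rewrite rmorphM /= -ME fmorphV rmorphXn /= rmorph_nat.
have cv (u : nat -> R) : (forall n, `|u n| <= cRe M / 2 ^+ n) -> cvgn (series u).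
  move=> uM; apply: normed_cvg.
  apply: (@series_le_cvg _ _ (geometric (cRe M) (2^-1 : R))) => [n|n|n|].
  - exact: normr_ge0.
  - by rewrite /geometric /= mulr_ge0 ?exprn_ge0 // -lecR -ME.
  - by rewrite /geometric /= exprVn; exact: uM.
  - by apply: is_cvg_geometric_series; rewrite ger0_norm ?invf_lt1 ?ltr1n.
have seriesE (p : {additive C -> R}) (n : nat) :
    p (series a n) = series (fun n => p (a n)) n.
  by rewrite /series /= raddf_sum.
have Ncs (x : C) : `|cRe x|%:C <= `|x| /\ `|cIm x|%:C <= `|x|.
  split; first exact: normc_ge_Re.
  have := normc_ge_Re (- (x * 'i%C)).
  rewrite normrN normrM raddfN /= normrN ReiNIm normrN.
  have -> : `|'i%C| = 1 :> C.
    by rewrite normc_def /= expr0n expr1n add0r sqrtr1.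
  by rewrite mulr1.
exists (lim (series (fun n => cRe (a n)) @ \oo) +i*
        lim (series (fun n => cIm (a n)) @ \oo)).
apply: cvg_complex.
  rewrite (_ : (fun n => cRe _) = series (fun n => cRe (a n))).
    by apply: cv => n; rewrite -lecR (le_trans (Ncs _).1).
  by apply/funext => n; rewrite (seriesE (cRe : {additive Rcomplex R -> R})).
rewrite (_ : (fun n => cIm _) = series (fun n => cIm (a n))).
  by apply: cv => n; rewrite -lecR (le_trans (Ncs _).2).
by apply/funext => n; rewrite (seriesE (cIm : {additive Rcomplex R -> R})).
Qed.

End ComplexSeries.

(** * Power series and their derivatives over a field where geometrically dominated series
    converge *)

Section PowerSeries.
Context {C : numFieldType}.

Lemma normc_lim_le (u : nat -> C) (l K : C) :
  u @ \oo --> l -> (forall n, `|u n| <= K) -> `|l| <= K.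
Proof.
move=> /cvgrPdist_lt ul uK; apply/ler_addgt0Pr => e e0.
have [n _ /(_ n (leqnn n)) ln] := ul e e0.
rewrite -[l](subrK (u n)) (le_trans (ler_normD _ _)) // addrC lerD //.
exact: ltW.
Qed.

Lemma series_dominated_le (a : nat -> C) (l M : C) :
  (forall n, `|a n| <= M / 2 ^+ n) -> series a @ \oo --> l -> `|l| <= M * 2.
Proof.
move=> aM al; apply: (normc_lim_le al) => n.
have M0 : 0 <= M.
  by have := aM 0%N; rewrite expr0 divr1; apply: le_trans.
rewrite (@le_trans _ _ (M * (2 - 2 / 2 ^+ n))) //; last first.
  by rewrite ler_wpM2l // gerBl divr_ge0 ?exprn_ge0.
rewrite /series /= (le_trans (ler_norm_sum _ _ _)) //.
elim: n => [|n IH]; first by rewrite big_geq // expr0 divr1 subrr mulr0.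
rewrite big_nat_recr //= (le_trans (lerD IH (aM n))) // -mulrDr.
rewrite ler_wpM2l // le_eqVlt; apply/orP; left; apply/eqP.
have n0 : (2 ^+ n : C) != 0 by rewrite expf_neq0 // pnatr_eq0.
by rewrite exprS; field.
Qed.

Definition psum (a : nat -> C) (t : C) : C :=
  lim (series (fun n => a n * t ^+ n) @ \oo).

Lemma psumP (a : nat -> C) (t l : C) :
  series (fun n => a n * t ^+ n) @ \oo --> l -> psum a t = l.
Proof. exact/cvg_lim/norm_hausdorff. Qed.

(* The constants are wasteful so that all series met below are dominated by
   a geometric series of ratio 1/2. *)
Definition geombound (M r : C) (a : nat -> C) :=
  [/\ 0 <= M, 0 < r & forall n, `|a n| <= M * r ^+ n].

Definition small (r t : C) := `|t| <= (4 * r)^-1.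

Lemma small_term (M r t : C) (a : nat -> C) : geombound M r a -> small r t ->
  forall n, `|a n * t ^+ n| <= M / 2 ^+ n.
Proof.
move=> [M0 r0 aM] st n; rewrite normrM normrX.
rewrite (@le_trans _ _ (M * r ^+ n * (4 * r)^-1 ^+ n)) //.
  by rewrite ler_pM ?exprn_ge0 // lerXn2r // nnegrE // ltW // invr_gt0 mulr_gt0.
rewrite -mulrA ler_wpM2l // -exprMn invfM [r * _]mulrC -mulrA mulVf ?gt_eqF //.
rewrite mulr1 exprVn lef_pV2 ?posrE ?exprn_gt0 //.
by rewrite lerXn2r ?nnegrE // ler_nat.
Qed.

Hypothesis C_complete : forall (a : nat -> C) (M : C),
  (forall n, `|a n| <= M / 2 ^+ n) -> exists l : C, series a @ \oo --> l.

Lemma psum_cvg (M r t : C) (a : nat -> C) : geombound M r a -> small r t ->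
  series (fun n => a n * t ^+ n) @ \oo --> psum a t.
Proof.
move=> aM st; have [l al] := C_complete (small_term aM st).
by rewrite (psumP al).
Qed.

(** The remainders satisfy R_(n+1) = x R_n + n (x - t)^2 t^(n-1). Each term takes half of the new
    factor 2 rho, the second one thanks to n <= 2^n. *)
Lemma exprB_taylor (rho x t : C) (n : nat) : 0 < rho -> `|x| <= rho ->
  `|t| <= rho ->
  `|x ^+ n - t ^+ n - n%:R * (x - t) * t ^+ n.-1|
    <= `|x - t| ^+ 2 / rho ^+ 2 * (2 * rho) ^+ n.
Proof.
move=> r0 xr tr; elim: n => [|n IH].
  rewrite !expr0 subrr !mul0r subr0 normr0 mulr1.
  by rewrite divr_ge0 // exprn_ge0 // ltW.
have -> : x ^+ n.+1 - t ^+ n.+1 - n.+1%:R * (x - t) * t ^+ n.+1.-1 =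
   x * (x ^+ n - t ^+ n - n%:R * (x - t) * t ^+ n.-1)
   + n%:R * (x - t) ^+ 2 * t ^+ n.-1.
  by case: n {IH} => [|n] /=; rewrite ?exprS -?natr1; ring.
rewrite (le_trans (ler_normD _ _)) // normrM (exprS (2 * rho)).
set B := _ / _ in IH *.
have -> : B * (2 * rho * (2 * rho) ^+ n) =
  rho * (B * (2 * rho) ^+ n) + rho * (B * (2 * rho) ^+ n) by ring.
rewrite lerD // ?ler_pM //.
rewrite 2!normrM normr_nat !normrX /B exprMn.
rewrite (_ : rho * _ = 2 ^+ n * `|x - t| ^+ 2 * (rho * rho ^+ n / rho ^+ 2)); last by ring.
have r0' := ltW r0.
case: n {IH} => [|n].
  by rewrite !mul0r !(mulr_ge0, exprn_ge0, invr_ge0).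
rewrite (_ : rho * _ / _ = rho ^+ n); last by rewrite !exprS; field; exact: lt0r_neq0.
rewrite ler_pM ?mulr_ge0 ?exprn_ge0 //.
  by rewrite ler_wpM2r ?exprn_ge0 // -natrX ler_nat ltnW // ltn_expl.
by rewrite lerXn2r // nnegrE ltW.
Qed.

Definition pderiv (a : nat -> C) (n : nat) : C := n.+1%:R * a n.+1.

Lemma geombound_pderiv (M r : C) (a : nat -> C) :
  geombound M r a -> geombound (M * r * 2) (r * 2) (pderiv a).
Proof.
move=> [M0 r0 aM]; have r0' := ltW r0.
split; rewrite ?(mulr_ge0, mulr_gt0) // => n.
rewrite normrM normr_nat exprMn (@le_trans _ _ (2 ^+ n.+1 * (M * r ^+ n.+1))) //.
  by rewrite ler_pM // -natrX ler_nat ltnW // ltn_expl.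
by rewrite le_eqVlt !exprS; apply/orP; left; apply/eqP; ring.
Qed.

Lemma psum_taylor (M r x t : C) (a : nat -> C) : geombound M r a ->
  small (r * 2) x -> small (r * 2) t ->
  `|psum a x - psum a t - (x - t) * psum (pderiv a) t|
    <= (M * (8 * r) ^+ 2 * 2) * `|x - t| ^+ 2.
Proof.
move=> aM sx st; have [M0 r0 aMn] := aM.
have ss y : small (r * 2) y -> small r y.
  move/le_trans; apply; rewrite lef_pV2 ?posrE ?mulr_gt0 //.
  by rewrite ler_wpM2l // ler_peMr ?ltW ?ltr1n.
pose e n := a n * x ^+ n - a n * t ^+ n - (x - t) * (n%:R * a n * t ^+ n.-1).
have cv : series e @ \oo --> psum a x - psum a t - (x - t) * psum (pderiv a) t.
  have -> : series e = (fun n => series (fun n => a n * x ^+ n) n -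
     series (fun n => a n * t ^+ n) n -
     (x - t) * series (fun n => n%:R * a n * t ^+ n.-1) n).
    apply/funext => n; rewrite /series /= mulr_sumr -!sumrB.
    exact: eq_bigr.
  apply: cvgB.
    by apply: cvgB; apply: (psum_cvg aM); exact: ss.
  apply: cvgMr.
  rewrite -(cvg_shiftn 1).
  rewrite (_ : (fun n => _) = series (fun n => pderiv a n * t ^+ n)).
    by apply: (psum_cvg (geombound_pderiv aM)).
  apply/funext => n; rewrite /series /= addn1 big_nat_recl //= !mul0r add0r.
  exact: eq_bigr.
(* With this radius r * (2 * rho) = 1/4, so the remainders are dominated by a geometric series of
   ratio 1/2, and rho^-2 = (8 r)^2 yields the stated constant. *)
pose rho := (4 * (r * 2))^-1.
have rho0 : 0 < rho by rewrite invr_gt0 !mulr_gt0.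
have eb n : `|e n| <= (M * (8 * r) ^+ 2 * `|x - t| ^+ 2) / 2 ^+ n.
  rewrite /e (_ : _ - _ = a n * (x ^+ n - t ^+ n - n%:R * (x - t) * t ^+ n.-1)); last by ring.
  rewrite normrM.
  rewrite (@le_trans _ _ (M * r ^+ n * (`|x - t| ^+ 2 / rho ^+ 2 * (2 * rho) ^+ n))) //.
    by rewrite ler_pM // exprB_taylor.
  have -> : M * r ^+ n * (`|x - t| ^+ 2 / rho ^+ 2 * (2 * rho) ^+ n) =
     M * rho ^- 2 * `|x - t| ^+ 2 * (r * (2 * rho)) ^+ n.
    by rewrite [(r * _) ^+ _]exprMn; ring.
  have -> : rho^-2 = (8 * r) ^+ 2.
    by rewrite /rho -exprVn invrK; ring.
  have r0' := ltW r0.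
  rewrite ler_wpM2l ?(mulr_ge0, exprn_ge0) //.
  have -> : r * (2 * rho) = 4^-1 by rewrite /rho; field; rewrite gt_eqF.
  by rewrite exprVn lef_pV2 ?posrE ?exprn_gt0 // lerXn2r ?nnegrE // ler_nat.
by rewrite (le_trans (series_dominated_le eb cv)) // le_eqVlt; apply/orP; left; apply/eqP; ring.
Qed.

Lemma is_derive_psum (M r t : C) (a : nat -> C) : geombound M r a ->
  `|t| < (4 * (r * 2))^-1 -> is_derive t 1 (psum a) (psum (pderiv a) t).
Proof.
move=> aM st; have [M0 r0 aMn] := aM.
set rho := _^-1 in st.
have st' : small (r * 2) t by rewrite /small ltW.
set K := M * (8 * r) ^+ 2 * 2.
have r0' := ltW r0.
have K0 : 0 <= K by rewrite !(mulr_ge0, exprn_ge0).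
suff H : (fun h => h^-1 *: (psum a (h *: 1 + t) - psum a t)) @ 0^' -->
   psum (pderiv a) t.
  split; first by apply/cvg_ex; exists (psum (pderiv a) t).
  exact: (cvg_lim (@norm_hausdorff _ _) H).
apply/cvgrPdist_lt => e e0.
have K1 : 0 < K + 1 by rewrite ltr_wpDl.
near=> h.
have h0 : h != 0 by near: h; exact: nbhs_dnbhs_neq.
have hs : `|h| < rho - `|t|.
  by near: h; apply: dnbhs0_lt; rewrite subr_gt0.
have he : `|h| < e / (K + 1).
  by near: h; apply: dnbhs0_lt; rewrite divr_gt0.
have sh : small (r * 2) (h + t).
  by rewrite /small (le_trans (ler_normD _ _)) // ltW // -ltrBrDr.
have := psum_taylor aM sh st'.
rewrite addrK => ht.
rewrite [h *: 1]mulr1 distrC.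
have -> : h^-1 *: (psum a (h + t) - psum a t) - psum (pderiv a) t =
  h^-1 * (psum a (h + t) - psum a t - h * psum (pderiv a) t).
  rewrite /GRing.scale /=; field; exact: h0.
rewrite normrM normfV ltr_pdivrMl ?normr_gt0 // (le_lt_trans ht) //.
rewrite -/K expr2 mulrA mulrC ltr_pM2l ?normr_gt0 //.
rewrite (@le_lt_trans _ _ ((K + 1) * `|h|)) ?ler_wpM2r ?lerDl //.
by rewrite mulrC -ltr_pdivlMr.
Unshelve. all: by end_near.
Qed.

Lemma psum_shift (M r t : C) (a : nat -> C) : geombound M r a -> small r t ->
  series (fun n => (if n is n'.+1 then a n' else 0) * t ^+ n) @ \oo
    --> t * psum a t.
Proof.
move=> aM st; rewrite -(cvg_shiftn 1).
rewrite (_ : (fun n => _) = (fun n => t * series (fun n => a n * t ^+ n) n)).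
  by apply: cvgMr; exact: psum_cvg aM st.
apply/funext => n; rewrite /series /= addn1 big_nat_recl //= mul0r add0r.
by rewrite mulr_sumr; apply: eq_bigr => i _; rewrite exprS; ring.
Qed.

(** * Local solutions of s Y' = (A + s B) Y at a nonzero point *)

Section FuchsianSystem.
Context {m : nat} (A B : 'M[C]_m) (c : C) (y0 : 'I_m -> C).
Hypothesis c0 : c != 0.

Let A' := A + c *: B.

(* Coefficients of orders n and n - 1 of the power series solution at c of
   s Y' = (A + s B) Y. *)
Fixpoint fuchs_coef (n : nat) : ('I_m -> C) * ('I_m -> C) :=
  if n is n'.+1 then
    let p := fuchs_coef n' in
    (fun i => (\sum_j (A' i j * p.1 j + B i j * p.2 j) - n'%:R * p.1 i) /
              (c * n'.+1%:R), p.1)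
  else (y0, fun=> 0).

Let S := \sum_i \sum_j (`|A' i j| + `|B i j|).
(** The summand 1 gives r >= 1, needed for the delayed coefficients. The other one absorbs the
    recurrence, as S + n <= (S + 1)(n + 1), and gives r |c| >= 1, which keeps 0 out of the disc of
    convergence used below. *)
Let r := 1 + (S + 1) / `|c|.
Let M := \sum_i `|y0 i|.

Lemma fuchs_coef_bound n i :
  `|(fuchs_coef n).1 i| <= M * r ^+ n /\ `|(fuchs_coef n).2 i| <= M * r ^+ n.
Proof.
have S0 : 0 <= S by apply: sumr_ge0 => k _; apply: sumr_ge0 => j _; rewrite addr_ge0.
have M0 : 0 <= M by apply: sumr_ge0.
have nc : 0 < `|c| by rewrite normr_gt0.
have S1 : 0 <= (S + 1) / `|c| by rewrite divr_ge0 // addr_ge0.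
have r1 : 1 <= r by rewrite lerDl.
elim: n i => [|n IH] i /=.
  rewrite expr0 mulr1 normr0; split=> //.
  by rewrite /M (bigD1 i) //= lerDl sumr_ge0.
have Mr0 : 0 <= M * r ^+ n by rewrite mulr_ge0 // exprn_ge0 // (le_trans ler01).
split; last first.
  by rewrite (le_trans (IH i).1) // exprS mulrCA ler_peMl.
rewrite normrM normfV normrM normr_nat ler_pdivrMr ?mulr_gt0 // ?ltr0n //.
rewrite (le_trans (ler_normB _ _)) //.
rewrite (@le_trans _ _ (S * (M * r ^+ n) + n%:R * (M * r ^+ n))) //.
  rewrite lerD //; last by rewrite normrM normr_nat ler_wpM2l // (IH i).1.
  rewrite (le_trans (ler_norm_sum _ _ _)) //.
  rewrite (@le_trans _ _ ((\sum_j (`|A' i j| + `|B i j|)) * (M * r ^+ n))) //; last first.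
    rewrite ler_wpM2r // /S [leRHS](bigD1 i) //= lerDl.
    by apply: sumr_ge0 => k _; apply: sumr_ge0 => j _; rewrite addr_ge0.
  rewrite mulr_suml ler_sum // => j _; rewrite mulrDl (le_trans (ler_normD _ _)) //.
  by rewrite !normrM lerD // ler_wpM2l // ?(IH j).1 ?(IH j).2.
rewrite -mulrDl exprS.
have -> : M * (r * r ^+ n) * (`|c| * n.+1%:R) = (r * `|c| * n.+1%:R) * (M * r ^+ n) by ring.
rewrite ler_wpM2r //.
have -> : r * `|c| = `|c| + (S + 1) by rewrite /r mulrDl mul1r divfK // gt_eqF.
rewrite (@le_trans _ _ ((S + 1) * n.+1%:R)) // ?ler_wpM2r ?lerDr ?normr_ge0 //.
have -> : (S + 1) * n.+1%:R = (S + n%:R) + (S * n%:R + 1) by rewrite -natr1; ring.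
by rewrite lerDl addr_ge0 ?mulr_ge0.
Qed.

Let a i n := (fuchs_coef n).1 i.

Let geombound_a i : geombound M r (a i).
Proof.
have S0 : 0 <= S by apply: sumr_ge0 => k _; apply: sumr_ge0 => j _; rewrite addr_ge0.
split; first exact: sumr_ge0.
  by rewrite ltr_pwDl // divr_ge0 // addr_ge0.
by move=> n; exact: (fuchs_coef_bound n i).1.
Qed.

(** With s = c + t, comparing coefficients of t^n gives c (n + 1) a_(n+1) + n a_n = (A + c B) a_n +
    B a_(n-1), which is the recurrence of [fuchs_coef]. *)
Lemma psum_fuchs i (t : C) : small (r * 2) t ->
  (c + t) * psum (pderiv (a i)) t = \sum_j (A i j + (c + t) * B i j) * psum (a j) t.
Proof.
move=> st.
have [_ r0 _] := geombound_a i.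
have st' : small r t.
  move: st => /le_trans; apply; rewrite lef_pV2 ?posrE ?mulr_gt0 //.
  by rewrite ler_wpM2l // ler_peMr ?ltW ?ltr1n.
pose sh (u : nat -> C) n := if n is n'.+1 then u n' else 0.
have ga := geombound_pderiv (geombound_a i).
have cv : series (fun n => (c * pderiv (a i) n + sh (pderiv (a i)) n -
    \sum_j (A' i j * a j n + B i j * sh (a j) n)) * t ^+ n) @ \oo -->
   c * psum (pderiv (a i)) t + t * psum (pderiv (a i)) t
    - \sum_j (A' i j * psum (a j) t + B i j * (t * psum (a j) t)).
  have -> : series (fun n => (c * pderiv (a i) n + sh (pderiv (a i)) n -
    \sum_j (A' i j * a j n + B i j * sh (a j) n)) * t ^+ n) =
    (fun N => c * series (fun n => pderiv (a i) n * t ^+ n) N +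
        series (fun n => sh (pderiv (a i)) n * t ^+ n) N -
        \sum_j (A' i j * series (fun n => a j n * t ^+ n) N +
                B i j * series (fun n => sh (a j) n * t ^+ n) N)).
    apply/funext => N; rewrite /series /= mulr_sumr -big_split /=.
    under [X in _ = _ - X]eq_bigr do rewrite !mulr_sumr -big_split /=.
    rewrite exchange_big -sumrB; apply: eq_bigr => n _ /=.
    rewrite mulrBl mulrDl mulrA mulr_suml; congr (_ - _).
    by apply: eq_bigr => j _; ring.
  apply: cvgB.
    by apply: cvgD; [apply: cvgMr; exact: psum_cvg ga _|exact: psum_shift ga _].
  apply: cvg_big => [|j _]; first exact: add_continuous.
  apply: cvgD; apply: cvgMr.
    exact: psum_cvg (geombound_a j) _.
  exact: psum_shift (geombound_a j) _.
have z : series (fun n => (c * pderiv (a i) n + sh (pderiv (a i)) n -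
    \sum_j (A' i j * a j n + B i j * sh (a j) n)) * t ^+ n) = fun=> 0.
  apply/funext => N; rewrite /series /= big1 // => n _.
  rewrite (_ : _ - _ = 0) ?mul0r // /pderiv {1}/a /=.
  have -> : sh (fun n0 => n0.+1%:R * a i n0.+1) n = n%:R * a i n.
    by case: n => //=; rewrite mul0r.
  have -> : \sum_j (A' i j * a j n + B i j * sh (a j) n) =
     \sum_j (A' i j * (fuchs_coef n).1 j + B i j * (fuchs_coef n).2 j).
    by apply: eq_bigr => j _; congr (_ + _ * _); case: n.
  rewrite -/(a i n); set X := \sum_j _.
  have n0 : n.+1%:R != 0 :> C by rewrite pnatr_eq0.
  by rewrite invfM mulrCA [_ / n.+1%:R]mulrC; field; rewrite c0 addrC natr1.
move: cv; rewrite z => /cvg_lim; move/(_ (@norm_hausdorff _ _)).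
rewrite lim_cst; last exact: norm_hausdorff.
move/esym/eqP; rewrite subr_eq0 -mulrDl => /eqP ->.
apply: eq_bigr => j _; rewrite !mxE; ring.
Qed.

Lemma fuchs_solution : exists (delta : C) (Y : 'I_m -> C -> C),
  [/\ 0 < delta, forall i, Y i c = y0 i & forall s, `|s - c| < delta ->
    s != 0 /\ forall i,
      is_derive s 1 (Y i) (\sum_j (A i j / s + B i j) * Y j s)].
Proof.
pose delta := (4 * (r * 2))^-1.
have S0 : 0 <= S by apply: sumr_ge0 => k _; apply: sumr_ge0 => j _; rewrite addr_ge0.
have nc : 0 < `|c| by rewrite normr_gt0.
have r0 : 0 < r by rewrite ltr_pwDl // divr_ge0 // addr_ge0.
have d0 : 0 < delta by rewrite invr_gt0 !mulr_gt0.
have dc : delta < `|c|.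
  have : 1 <= r * `|c|.
    rewrite mulrDl mul1r divfK ?gt_eqF // addrA.
    by rewrite lerDr addr_ge0.
  move=> rc.
  rewrite /delta -div1r ltr_pdivrMr ?mulr_gt0 //.
  rewrite (le_lt_trans rc) // (_ : _ * (4 * _) = 8 * (r * `|c|)); last by ring.
  by rewrite ltr_pMl ?mulr_gt0 // ltr1n.
exists delta, (fun i s => psum (a i) (s - c)); split => // [i|s sd].
  rewrite subrr; apply: psumP.
  rewrite -(cvg_shiftn 1) (_ : (fun n => _) = fun=> y0 i); first exact: cvg_cst.
  apply/funext => n; rewrite /series /= addn1 big_nat_recl //= expr0 mulr1.
  by rewrite big1 ?addr0 // => k _; rewrite exprS mul0r mulr0.
have s0 : s != 0.
  apply: contraTneq (lt_trans sd dc) => ->.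
  by rewrite sub0r normrN ltxx.
split=> // i.
have [dv vl] := is_derive_psum (geombound_a i) sd.
have E : (fun h : C => h^-1 *: (psum (a i) (h *: 1 + s - c) - psum (a i) (s - c))) =
   (fun h : C => h^-1 *: (psum (a i) (h *: 1 + (s - c)) - psum (a i) (s - c))).
  by apply/funext => h; rewrite addrA.
split; first by rewrite /derivable E.
rewrite /derive E; have := vl; rewrite /derive => ->.
apply: (mulfI s0); have := @psum_fuchs i (s - c); rewrite subrKC => ->; last exact: ltW.
rewrite mulr_sumr; apply: eq_bigr => j _.
by rewrite mulrA mulrDr mulrCA divff // mulr1.
Qed.

End FuchsianSystem.
End PowerSeries.
(** * Germs of smooth functions *)

Lemma near_eq_differentiable (K : numFieldType) (V W : normedModType K)
    (f g : V -> W) (x : V) :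
  (\forall z \near x, f z = g z) -> differentiable f x -> differentiable g x.
Proof.
move=> fg /diff_locallyP[cf Ef].
have gE : g \o shift x = cst (g x) + 'd f x +o_ 0 id.
  apply/eqaddoP => _/posnumP[e].
  have /eqaddoP/(_ e%:num (gt0 e)) := Ef.
  have fg0 : \forall h \near (0 : V), f (h + x) = g (h + x).
    by move: fg; rewrite (near_shift 0 x) subr0.
  apply: filterS2 fg0 => h fgh.
  by rewrite /= !fctE /= -(nbhs_singleton fg) fgh.
apply/diff_locallyP; split; rewrite (diff_unique cf gE) //.
Qed.

(* Smooth functions on U, in a class generated by explicit constructors so
   that the symmetry of second derivatives holds by induction.  The clause
   [smooth_fuchs] adds the solutions of s Y' = (A + s B) Y composed with a
   function of the class. *)
Section Smooth.
Context {K : numFieldType} {n : nat} (U : set 'rV[K]_n).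
Hypothesis Uo : open U.

Inductive smooth : ('rV[K]_n -> K) -> Prop :=
| smooth_cst c : smooth (fun=> c)
| smooth_coord j : smooth (fun z => z 0 j)
| smooth_add f g : smooth f -> smooth g -> smooth (fun z => f z + g z)
| smooth_mul f g : smooth f -> smooth g -> smooth (fun z => f z * g z)
| smooth_inv f : smooth f -> (forall z, U z -> f z != 0) ->
    smooth (fun z => (f z)^-1)
| smooth_fuchs m (A B : 'M[K]_m) (Y : 'I_m -> K -> K) f i : smooth f ->
    (forall z, U z -> f z != 0 /\ forall i,
       is_derive (f z) 1 (Y i) (\sum_j (A i j / f z + B i j) * Y j (f z))) ->
    smooth (fun z => Y i (f z))
| smooth_eq f g : smooth f -> (forall z, U z -> f z = g z) -> smooth g.

Lemma near_in z : U z -> \forall x \near z, U x.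
Proof. by move=> Uz; exact: open_nbhs_nbhs. Qed.

Lemma near_eqU (f g : 'rV[K]_n -> K) z : U z -> (forall z, U z -> f z = g z) ->
  \forall x \near z, f x = g x.
Proof. by move=> Uz fg; apply: filterS (near_in Uz) => x; exact: fg. Qed.

Lemma smooth_diff f z : smooth f -> U z -> differentiable f z.
Proof.
move=> sf Uz; elim: sf => {f} [c|j|f g _ df _ dg|f g _ df _ dg|f _ df f0|
  m A B Y f i _ df Yd|f g _ df fg].
- exact: differentiable_cst.
- exact: differentiable_coord.
- exact: differentiableD.
- exact: differentiableM.
- by apply: differentiableV => //; exact: f0.
- apply: (@differentiable_comp _ _ _ _ f (Y i)) => //.
  by apply/derivable1_diffP; have [_ /(_ i)[]] := Yd z Uz.
- exact: near_eq_differentiable (near_eqU Uz fg) df.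
Qed.

Lemma smooth_sum (I : Type) (r : seq I) (P : pred I) (F : I -> 'rV[K]_n -> K) :
  (forall i, smooth (F i)) -> smooth (fun z => \sum_(i <- r | P i) F i z).
Proof.
move=> sF; elim: r => [|i r IH].
  by apply: smooth_eq (smooth_cst 0) _ => z _; rewrite big_nil.
case Pi: (P i).
  by apply: smooth_eq (smooth_add (sF i) IH) _ => z _; rewrite big_cons Pi.
by apply: smooth_eq IH _ => z _; rewrite big_cons Pi.
Qed.

Lemma partial_cst (i : 'I_n) (c : K) (z : 'rV[K]_n) : partial i (fun=> c : K) z = 0.
Proof. exact: derive_cst. Qed.

Lemma partial_coord (i j : 'I_n) (z : 'rV[K]_n) : partial i (fun z : 'rV[K]_n => z 0 j) z = (i == j)%:R.
Proof.
rewrite /partial deriveE; last exact: differentiable_coord.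
pose c := (fun z : 'rV[K]_n => z 0 j).
have lc : linear c by move=> a u v; rewrite /c !mxE.
pose l := GRing.isLinear.Build _ _ _ _ c lc.
pose L : {linear 'rV[K]_n -> K} := HB.pack c l.
have -> : 'd (fun z : 'rV[K]_n => z 0 j) z = L :> ('rV[K]_n -> K).
  by apply: (@diff_lin _ _ _ L); exact: coord_continuous.
by rewrite /= /c mxE eqxx /= eq_sym.
Qed.

Lemma partial_eq i f g z : (forall z, U z -> f z = g z) -> U z ->
  partial i f z = partial i g z.
Proof. by move=> fg Uz; apply: near_eq_derive; exact: near_eqU. Qed.

Section Rules.
Variables (f g : 'rV[K]_n -> K) (i : 'I_n) (z : 'rV[K]_n).
Hypotheses (sf : smooth f) (sg : smooth g) (Uz : U z).

Let df : derivable f z (delta_mx 0 i).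
Proof. exact/diff_derivable/smooth_diff. Qed.

Let dg : derivable g z (delta_mx 0 i).
Proof. exact/diff_derivable/smooth_diff. Qed.

Lemma partialD : partial i (fun z => f z + g z) z = partial i f z + partial i g z.
Proof. exact: deriveD. Qed.

Lemma partialM : partial i (fun z => f z * g z) z =
  partial i f z * g z + f z * partial i g z.
Proof. by rewrite /partial deriveM // addrC mulrC. Qed.

Lemma partialV : f z != 0 -> partial i (fun z => (f z)^-1) z =
  - (f z)^-1 ^+ 2 * partial i f z.
Proof. by move=> fz; rewrite /partial deriveV // exprVn. Qed.

Lemma partial_comp (Y : K -> K) dY : is_derive (f z) 1 Y dY ->
  partial i (fun z => Y (f z)) z = partial i f z * dY.
Proof.
move=> [Yd YE]; have Yf : differentiable Y (f z) by exact/derivable1_diffP.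
have fd := smooth_diff sf Uz.
rewrite /partial deriveE; last exact: (@differentiable_comp _ _ _ _ f Y).
rewrite (_ : (fun z => Y (f z)) = Y \o f) // diff_comp //=.
by rewrite (diff1E Yf) derive1E YE [in RHS]deriveE.
Qed.

End Rules.

Lemma partial_sum m (G : 'I_m -> 'rV[K]_n -> K) i z :
  (forall l, smooth (G l)) -> U z ->
  partial i (fun z => \sum_l G l z) z = \sum_l partial i (G l) z.
Proof.
move=> sG Uz; have dG l : derivable (G l) z (delta_mx 0 i).
  exact/diff_derivable/smooth_diff.
rewrite /partial -derive_sum //; congr ('D_ _ _ _).
by apply/funext => x; rewrite fct_sumE.
Qed.

(** The clause [smooth_fuchs] is stable because the system expresses each Y_k' through the
    components Y_j and the inverse of the inner function. *)
Lemma smooth_partial f i : smooth f -> smooth (partial i f).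
Proof.
elim=> {f} [c|j|f g sf df sg dg|f g sf df sg dg|f sf df f0|
  m A B Y f k sf df Yd|f g sf df fg].
- by apply: smooth_eq (smooth_cst 0) _ => z _; rewrite partial_cst.
- by apply: smooth_eq (smooth_cst _) _ => z _; rewrite partial_coord.
- by apply: smooth_eq (smooth_add df dg) _ => z Uz; rewrite partialD.
- apply: smooth_eq (smooth_add (smooth_mul df sg) (smooth_mul sf dg)) _.
  by move=> z Uz; rewrite partialM.
- apply: (smooth_eq (f := fun z => -1 * ((f z)^-1 * (f z)^-1) * partial i f z)).
    apply: smooth_mul => //; apply: smooth_mul; first exact: smooth_cst.
    by apply: smooth_mul; apply: smooth_inv.
  by move=> z Uz; rewrite partialV ?f0 // mulN1r expr2.
- apply: (smooth_eq (f := fun z => partial i f z *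
     \sum_j (A k j * (f z)^-1 + B k j) * Y j (f z))).
    apply: smooth_mul => //; apply: smooth_sum => j.
    apply: smooth_mul; last exact: (smooth_fuchs (A := A) (B := B)).
    apply: smooth_add; last exact: smooth_cst.
    apply: smooth_mul; first exact: smooth_cst.
    by apply: smooth_inv => // z /Yd[].
  by move=> z Uz; rewrite (partial_comp _ sf Uz ((Yd z Uz).2 k)).
- by apply: smooth_eq df _ => z Uz; exact: partial_eq.
Qed.

(** For each constructor the second derivative is written out; it is symmetric once the induction
    hypotheses exchange the second derivatives of the constituents. *)
Lemma partialC f i j z : smooth f -> U z ->
  partial i (partial j f) z = partial j (partial i f) z.
Proof.
move=> sf; elim: sf z => {f} [c|k|f g sf df sg dg|f g sf df sg dg|f sf df f0|
  m A B Y f k sf df Yd|f g sf df fg] z Uz.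
- have E a : partial a (fun=> c) = fun=> 0 :> K.
    by apply/funext => x; exact: partial_cst.
  by rewrite !E !partial_cst.
- have E a : partial a (fun z : 'rV[K]_n => z 0 k) = fun=> (a == k)%:R.
    by apply/funext => x; exact: partial_coord.
  by rewrite !E !partial_cst.
- have E a b : partial b (partial a (fun z => f z + g z)) z =
      partial b (partial a f) z + partial b (partial a g) z.
    rewrite (partial_eq b (fun z Uz => partialD a sf sg Uz) Uz).
    by rewrite (partialD b (smooth_partial a sf) (smooth_partial a sg) Uz).
  apply: etrans (E j i) _; apply: etrans _ (esym (E i j)).
  apply: f_equal2; [exact: df|exact: dg].
- have E a b : partial b (partial a (fun z => f z * g z)) z =
      (partial b (partial a f) z * g z + partial a f z * partial b g z) +
      (partial b f z * partial a g z + f z * partial b (partial a g) z).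
    have sfp := smooth_partial a sf; have sgp := smooth_partial a sg.
    rewrite (partial_eq b (fun z Uz => partialM a sf sg Uz) Uz).
    rewrite (partialD b (smooth_mul sfp sg) (smooth_mul sf sgp) Uz).
    by rewrite (partialM b sfp sg Uz) (partialM b sf sgp Uz).
  apply: etrans (E j i) _; apply: etrans _ (esym (E i j)).
  apply: etrans (congr2 +%R (congr2 +%R (congr1 ( *%R^~ (g z)) (df z Uz)) erefl)
    (congr2 +%R erefl (congr1 ( *%R (f z)) (dg z Uz)))) _.
  exact: addrACA.
- have sV := smooth_inv sf f0; have sW := smooth_mul sV sV.
  have sN := smooth_mul (smooth_cst (-1)) sW.
  have EV a x : U x -> partial a (fun z => (f z)^-1) x =
      (-1 * ((f x)^-1 * (f x)^-1)) * partial a f x.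
    by move=> Ux; rewrite (partialV a sf Ux) ?f0 // mulN1r expr2.
  have E a b : partial b (partial a (fun z => (f z)^-1)) z =
      (2 * (f z)^-1 ^+ 3 * partial a f z * partial b f z -
      (f z)^-1 ^+ 2 * partial b (partial a f) z).
    have sfp := smooth_partial a sf.
    rewrite (partial_eq b (EV a) Uz) (partialM b sN sfp Uz).
    rewrite (partialM b (smooth_cst (-1)) sW Uz) (partialM b sV sV Uz).
    by rewrite (EV b z Uz) partial_cst; ring.
  apply: etrans (E j i) _; apply: etrans _ (esym (E i j)).
  apply: etrans (congr2 +%R erefl (congr1 (fun t => - (_ * t)) (df z Uz))) _.
  ring.
- pose W z := (f z)^-1.
  have f0 z' : U z' -> f z' != 0 by move=> /Yd[].
  have sV : smooth W by exact: smooth_inv.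
  have sY l : smooth (fun z => Y l (f z)) by apply: (smooth_fuchs (A := A) (B := B)).
  have sA c : smooth (fun z => c * (f z)^-1) by exact: smooth_mul (smooth_cst c) sV.
  have sA' c e : smooth (fun z => c * (f z)^-1 + e).
    exact: smooth_add (sA c) (smooth_cst e).
  pose G l := fun z => (A k l * (f z)^-1 + B k l) * Y l (f z).
  have sG l : smooth (G l) by exact: smooth_mul (sA' _ _) (sY l).
  have sS : smooth (fun z => \sum_l G l z) by exact: smooth_sum.
  pose dY l := \sum_j (A l j / f z + B l j) * Y j (f z).
  pose dG l := - A k l * (f z)^-1 ^+ 2 * Y l (f z) +
    (A k l * (f z)^-1 + B k l) * dY l.
  have EG a l : partial a (G l) z = partial a f z * dG l.
    rewrite (partialM a (sA' _ _) (sY l) Uz).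
    rewrite (partialD a (sA _) (smooth_cst (B k l)) Uz).
    rewrite (partialM a (smooth_cst (A k l)) sV Uz) (partialV a sf Uz) ?f0 //.
    rewrite (partial_comp a sf Uz ((Yd z Uz).2 l)) !partial_cst -/(dY l) /dG.
    ring.
  have ES a : partial a (fun z => \sum_l G l z) z = partial a f z * \sum_l dG l.
    rewrite mulr_sumr -(eq_bigr _ (fun l _ => EG a l)).
    exact: partial_sum.
  have E a b : partial b (partial a (fun z => Y k (f z))) z =
      partial b (partial a f) z * (\sum_l G l z) +
      partial a f z * (partial b f z * \sum_l dG l).
    rewrite (partial_eq b (fun x Ux => partial_comp a sf Ux ((Yd x Ux).2 k)) Uz).
    by rewrite (partialM b (smooth_partial a sf) sS Uz) ES.
  apply: etrans (E j i) _; apply: etrans _ (esym (E i j)).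
  apply: etrans (congr2 +%R (congr1 ( *%R^~ _) (df z Uz)) erefl) _.
  ring.
- have E a b : partial b (partial a g) z = partial b (partial a f) z.
    apply: partial_eq => // x Ux; apply: partial_eq => // y Uy.
    by rewrite fg.
  by apply: etrans (E j i) _; apply: etrans _ (esym (E i j)); exact: df.
Qed.

End Smooth.

(** * Smooth functions on an open set as a differential algebra *)

Section Germs.
Context {K : numFieldType} {n : nat}.
Local Notation V := 'rV[K]_n.

(** The base point makes the ring of functions on the domain nonzero and is where germs are
    taken. *)
Record domain := Domain {
  dom_set :> V -> Prop;
  dom_open : open (dom_set : set V);
  dom_pt : V;
  dom_ptP : dom_set dom_pt }.
Arguments dom_open : clear implicits.
Arguments dom_ptP : clear implicits.

Section GermRing.
Variable U : domain.

(* Functions vanish outside U, so that equality on U is Leibniz equality. *)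
Record germ := Germ {
  germ_fun :> V -> K;
  germ_smooth : smooth (dom_set U) germ_fun;
  germ_out : forall z, ~ U z -> germ_fun z = 0 }.

Lemma germP (f g : germ) : (forall z, U z -> f z = g z) -> f = g.
Proof.
move=> fg; have E : germ_fun f = germ_fun g.
  apply/funext => z; have [Uz|Uz] := pselect (U z); first exact: fg.
  by rewrite !germ_out.
case: f g E {fg} => f sf f0 [g sg g0] /= E; rewrite {}E in sf f0 *.
by congr Germ; exact: Prop_irrelevance.
Qed.

Definition on_dom (f : V -> K) z : K := if pselect (U z) then f z else 0.

Lemma on_domE f z : U z -> on_dom f z = f z.
Proof. by rewrite /on_dom; case: pselect. Qed.

Lemma on_dom_out f z : ~ U z -> on_dom f z = 0.
Proof. by rewrite /on_dom; case: pselect. Qed.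

Lemma smooth_on_dom f : smooth (dom_set U) f -> smooth (dom_set U) (on_dom f).
Proof. by move=> sf; apply: smooth_eq sf _ => z Uz; rewrite on_domE. Qed.

Definition mk_germ f (sf : smooth (dom_set U) f) : germ :=
  Germ (smooth_on_dom sf) (@on_dom_out f).

Lemma mk_germE f (sf : smooth (dom_set U) f) z : U z -> mk_germ sf z = f z.
Proof. exact: on_domE. Qed.

HB.instance Definition _ := gen_eqMixin germ.
HB.instance Definition _ := gen_choiceMixin germ.

Definition germ_cst c := mk_germ (smooth_cst (dom_set U) c).
Definition germ_var j := mk_germ (smooth_coord (dom_set U) j).
Definition germ_add (f g : germ) :=
  mk_germ (smooth_add (germ_smooth f) (germ_smooth g)).
Definition germ_mul (f g : germ) :=
  mk_germ (smooth_mul (germ_smooth f) (germ_smooth g)).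
Definition germ_opp (f : germ) := germ_mul (germ_cst (-1)) f.

Lemma germ_addA : associative germ_add.
Proof. by move=> f g h; apply: germP => z Uz; rewrite !mk_germE // addrA. Qed.

Lemma germ_addC : commutative germ_add.
Proof. by move=> f g; apply: germP => z Uz; rewrite !mk_germE // addrC. Qed.

Lemma germ_add0 : left_id (germ_cst 0) germ_add.
Proof. by move=> f; apply: germP => z Uz; rewrite !mk_germE // add0r. Qed.

Lemma germ_addN : left_inverse (germ_cst 0) germ_opp germ_add.
Proof.
by move=> f; apply: germP => z Uz; rewrite !mk_germE // mulN1r addNr.
Qed.

HB.instance Definition _ := GRing.isZmodule.Build germ
  germ_addA germ_addC germ_add0 germ_addN.

Lemma germ_mulA : associative germ_mul.
Proof. by move=> f g h; apply: germP => z Uz; rewrite !mk_germE // mulrA. Qed.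

Lemma germ_mulC : commutative germ_mul.
Proof. by move=> f g; apply: germP => z Uz; rewrite !mk_germE // mulrC. Qed.

Lemma germ_mul1 : left_id (germ_cst 1) germ_mul.
Proof. by move=> f; apply: germP => z Uz; rewrite !mk_germE // mul1r. Qed.

Lemma germ_mulD : left_distributive germ_mul germ_add.
Proof. by move=> f g h; apply: germP => z Uz; rewrite !mk_germE // mulrDl. Qed.

Lemma germ_1neq0 : germ_cst 1 != germ_cst 0.
Proof.
apply/eqP => /(congr1 (fun f : germ => f (dom_pt U)))/eqP.
by rewrite !mk_germE ?oner_eq0 //; exact: dom_ptP.
Qed.

HB.instance Definition _ := GRing.Zmodule_isComNzRing.Build germ
  germ_mulA germ_mulC germ_mul1 germ_mulD germ_1neq0.

Lemma germD (f g : germ) z : U z -> (f + g) z = f z + g z.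
Proof. exact: mk_germE. Qed.

Lemma germM (f g : germ) z : U z -> (f * g) z = f z * g z.
Proof. exact: mk_germE. Qed.

Lemma germN (f : germ) z : U z -> (- f) z = - f z.
Proof. by move=> Uz; rewrite [LHS]mk_germE // mk_germE // mulN1r. Qed.

Lemma germ1 z : U z -> (1 : germ) z = 1.
Proof. exact: mk_germE. Qed.

Lemma germ0 z : U z -> (0 : germ) z = 0.
Proof. exact: mk_germE. Qed.

Lemma germB (f g : germ) z : U z -> (f - g) z = f z - g z.
Proof. by move=> Uz; rewrite germD // germN. Qed.

Lemma germX (f : germ) k z : U z -> (f ^+ k) z = f z ^+ k.
Proof.
by move=> Uz; elim: k => [|k IH]; rewrite ?germ1 // !exprS germM // IH.
Qed.

Lemma germ_sum (I : Type) (r : seq I) (P : pred I) (F : I -> germ) z : U z ->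
  (\sum_(i <- r | P i) F i) z = \sum_(i <- r | P i) F i z.
Proof.
move=> Uz; apply: (big_morph (fun f : germ => f z)) => [f g|].
  exact: germD.
exact: germ0.
Qed.

Lemma germ_cstE c z : U z -> germ_cst c z = c.
Proof. exact: mk_germE. Qed.

Lemma germ_cst_is_zmod_morphism : zmod_morphism germ_cst.
Proof. by move=> c e; apply: germP => z Uz; rewrite germB // !mk_germE. Qed.

Lemma germ_cst_is_monoid_morphism : monoid_morphism germ_cst.
Proof. by split=> // c e; apply: germP => z Uz; rewrite germM // !mk_germE. Qed.

HB.instance Definition _ :=
  GRing.isZmodMorphism.Build K germ germ_cst germ_cst_is_zmod_morphism.
HB.instance Definition _ :=
  GRing.isMonoidMorphism.Build K germ germ_cst germ_cst_is_monoid_morphism.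

Definition germ_D i (f : germ) : germ :=
  mk_germ (smooth_partial (dom_open U) i (germ_smooth f)).

Lemma germ_DE i (f : germ) z : U z -> germ_D i f z = partial i f z.
Proof. exact: mk_germE. Qed.

Lemma germ_partial_eq i (f : germ) (g : V -> K) z : U z ->
  (forall z, U z -> f z = g z) -> partial i f z = partial i g z.
Proof. by move=> Uz fg; apply: (partial_eq (dom_open U)). Qed.

Lemma germ_DD i (f g : germ) : germ_D i (f + g) = germ_D i f + germ_D i g.
Proof.
apply: germP => z Uz; rewrite germD // !germ_DE //.
rewrite (germ_partial_eq i Uz (fun z => germD f g (z := z))).
by rewrite (partialD (dom_open U)) //; exact: germ_smooth.
Qed.

Lemma germ_DM i (f g : germ) : germ_D i (f * g) = germ_D i f * g + f * germ_D i g.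
Proof.
apply: germP => z Uz; rewrite germD // !germM // !germ_DE //.
rewrite (germ_partial_eq i Uz (fun z => germM f g (z := z))).
by rewrite (partialM (dom_open U)) //; exact: germ_smooth.
Qed.

Lemma germ_DC i j (f : germ) : germ_D i (germ_D j f) = germ_D j (germ_D i f).
Proof.
apply: germP => z Uz.
apply: etrans (germ_DE i (germ_D j f) Uz) _.
apply: etrans _ (esym (germ_DE j (germ_D i f) Uz)).
apply: etrans (germ_partial_eq i Uz (fun z => germ_DE j f (z := z))) _.
apply: etrans _ (esym (germ_partial_eq j Uz (fun z => germ_DE i f (z := z)))).
exact: (partialC (dom_open U) i j (germ_smooth f) Uz).
Qed.

Lemma germ_Dcst i c : germ_D i (germ_cst c) = 0.
Proof.
apply: germP => z Uz; rewrite germ0 // germ_DE //.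
rewrite (germ_partial_eq i Uz (fun z => germ_cstE c (z := z))).
exact: partial_cst.
Qed.

Lemma germ_varE j z : U z -> germ_var j z = z 0 j.
Proof. exact: mk_germE. Qed.

Lemma germ_Dvar i j : germ_D i (germ_var j) = (i == j)%:R.
Proof.
apply: germP => z Uz; rewrite germ_DE //.
rewrite (germ_partial_eq i Uz (fun z => germ_varE j (z := z))) partial_coord.
by case: (i == j); rewrite ?germ1 ?germ0.
Qed.

Definition germ_alg : diff_alg K n :=
  @DiffAlg K n germ germ_cst germ_var germ_D germ_DD germ_DM germ_DC
    germ_Dcst germ_Dvar.

Section Evaluation.
Variables (z : V) (Uz : U z).
Definition germ_eval (f : germ_alg) : K := (f : germ) z.
Hypothesis Uz' : U z.

Lemma germ_eval_is_zmod_morphism : zmod_morphism germ_eval.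
Proof. by move=> f g; exact: germB. Qed.

Lemma germ_eval_is_monoid_morphism : monoid_morphism germ_eval.
Proof. by split; [exact: germ1|move=> f g; exact: germM]. Qed.

Definition germ_eval_rmorphism : {rmorphism germ_alg -> K} :=
  HB.pack germ_eval
    (GRing.isZmodMorphism.Build germ_alg K germ_eval germ_eval_is_zmod_morphism)
    (GRing.isMonoidMorphism.Build germ_alg K germ_eval germ_eval_is_monoid_morphism).

End Evaluation.

(** At a point of the open set a partial derivative depends only on values inside it, so cutting off
    to 0 outside at every step changes nothing there. *)
Lemma mpartial_germ (a : 'I_n -> nat) (f : germ) z : U z ->
  mpartial a f z = (WeylAction.mD (W := germ_alg) a f : germ) z.
Proof.
rewrite /mpartial /WeylAction.mD => Uz.
elim: (enum 'I_n) z Uz => //= i s IH z Uz.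
elim: (a i) z Uz => //= m IHm z Uz.
apply: etrans _ (esym (germ_DE i _ Uz)); apply: esym.
by apply: (germ_partial_eq i Uz) => w Uw; rewrite IHm.
Qed.

Lemma act_germ (P : Weyl.weyl K n) (f : germ) z : U z ->
  act P f z = (WeylAction.dact (W := germ_alg) P f : germ) z.
Proof.
move=> Uz.
have := @WeylAction.eval_op_rmorph K n germ_alg (germ_eval_rmorphism Uz) P f
  (fun c => germ_cstE c Uz).
rewrite /= /germ_eval => <-; rewrite /act /Weyl.eval_op; apply: eq_bigr => m _.
congr (_ * _); last exact: mpartial_germ.
congr (mpoly.mmap _ _ _); apply/funext => j.
exact: (esym (germ_varE j Uz)).
Qed.

Lemma germ_solution (I : Weyl.weyl K n -> Prop) (f : germ) :
  (forall P, I P -> WeylAction.dact (W := germ_alg) P f = 0) ->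
  solution_germ I (dom_pt U) f.
Proof.
move=> If; split.
  apply: filterS (near_in (dom_open U) (dom_ptP U)) => z Uz.
  exact: (smooth_diff (dom_open U) (germ_smooth f) Uz).
move=> P IP; apply: filterS (near_in (dom_open U) (dom_ptP U)) => z Uz.
by rewrite act_germ // If // [LHS]germ0.
Qed.

Definition near_zero (f : germ_alg) : Prop :=
  \forall z \near dom_pt U, (f : germ) z = 0.

Lemma near_dom : \forall z \near dom_pt U, U z.
Proof. exact: (near_in (dom_open U) (dom_ptP U)). Qed.

Lemma near_zeroD f g : near_zero f -> near_zero g -> near_zero (f + g).
Proof.
move=> f0 g0; near=> z.
have Uz : U z by near: z; exact: near_dom.
rewrite [LHS](germD f g Uz) (near f0) // (near g0) // addr0 //.
Unshelve. all: by end_near. Qed.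

Lemma near_zeroM f g : near_zero g -> near_zero (f * g).
Proof.
move=> g0; near=> z.
have Uz : U z by near: z; exact: near_dom.
rewrite [LHS](germM f g Uz) (near g0) // mulr0 //.
Unshelve. all: by end_near. Qed.

Lemma near_zeroDer c f : near_zero f -> near_zero (da_D c f).
Proof.
(* The derivative at [z] needs [f] to vanish on a whole neighbourhood of [z], not just at [z]. *)
move=> /near_join f0; near=> z.
have Uz : U z by near: z; exact: near_dom.
rewrite [LHS](germ_DE c f Uz) -(partial_cst c 0 z).
apply: near_eq_derive; exact: (near f0).
Unshelve. all: by end_near. Qed.

Lemma near_zero_eval f : near_zero f -> germ_eval (dom_pt U) f = 0.
Proof. exact: nbhs_singleton. Qed.

Lemma germ_free m (F : 'I_m -> germ) :
  (forall c : 'I_m -> K, near_zero (\sum_k germ_cst (c k) * F k) ->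
     forall k, c k = 0) ->
  free_germs (dom_pt U) F.
Proof.
move=> Ff c c0; apply: Ff; near=> z.
have Uz : U z by near: z; exact: near_dom.
rewrite [LHS]germ_sum // -[RHS](near c0 z _) //; apply: eq_bigr => k _.
by rewrite [LHS]germM // germ_cstE.
Unshelve. all: by end_near. Qed.

End GermRing.

Section FuchsGerms.
Variable U : domain.
Local Notation D := (@da_D _ _ (germ_alg U)).

(** The system pulled back along [phi] by the chain rule, with [phii] in place of 1 / [phi]: the
    form in which the algebraic part consumes it. *)
Lemma fuchs_germs m (A B : 'M[K]_m) (Y : 'I_m -> K -> K) (phi phii : germ U) :
  phi * phii = 1 ->
  (forall z, U z -> phi z != 0 /\ forall i,
     is_derive (phi z) 1 (Y i) (\sum_j (A i j / phi z + B i j) * Y j (phi z))) ->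
  exists F : 'I_m -> germ_alg U,
    (forall a z, U z -> (F a : germ U) z = Y a (phi z)) /\
    forall c a, D c (F a) = D c phi *
      \sum_a' (germ_cst U (A a a') * phii + germ_cst U (B a a')) * F a'.
Proof.
move=> phiV Yd.
pose F a : germ U := mk_germ (smooth_fuchs a (germ_smooth phi) Yd).
have FE a z : U z -> F a z = Y a (phi z) by exact: mk_germE.
exists F; split => // c a; apply: germP => z Uz.
rewrite [LHS]germ_DE // [RHS]germM // germ_DE //.
rewrite (germ_partial_eq c Uz (FE a)).
rewrite (partial_comp (dom_open U) c (germ_smooth phi) Uz ((Yd z Uz).2 a)).
congr (_ * _); rewrite germ_sum //; apply: eq_bigr => j _.
rewrite germM // germD // germM // !germ_cstE // FE //.
have E : phi z * phii z = 1 by rewrite -germM // phiV germ1.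
by rewrite -[phii z](mulKf (Yd z Uz).1) E mulr1.
Qed.

End FuchsGerms.

End Germs.
(** * The rank *)

Section SolutionFamilies.
Context {K : numFieldType}.
Hypothesis K_complete : forall (a : nat -> K) (M : K),
  (forall n, `|a n| <= M / 2 ^+ n) -> exists l : K, series a @ \oo --> l.

Lemma smooth_exp n (U : set 'rV[K]_n) f k : smooth U f -> smooth U (fun z => f z ^+ k).
Proof.
move=> sf; elim: k => [|k IH].
  by apply: smooth_eq (smooth_cst U 1) _ => z _; rewrite expr0.
by apply: smooth_eq (smooth_mul sf IH) _ => z _; rewrite exprS.
Qed.

Definition torus n : set 'rV[K]_n := [set z | forall c, z 0 c != 0].

Lemma nbhs_torus n (z : 'rV[K]_n) : torus z -> nbhs z (@torus n).
Proof.
move=> z0; suff : \forall w \near z, forall c, (w : 'rV[K]_n) 0 c != 0 by [].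

apply: (@filter_forall _ _ (fun c (w : 'rV[K]_n) => is_true (w 0 c != 0)) (nbhs z)) => c.
apply: cvgr_neq0 (z0 c).
exact: coord_continuous.
Qed.

Lemma open_torus n : open (@torus n).
Proof. by rewrite openE => z; exact: nbhs_torus. Qed.

(** As [J] is finite, the discs of convergence around the values [phi j p] pull back to one common
    neighbourhood of [p]. *)
Lemma fuchs_domain n m (J : finType) (phi : J -> 'rV[K]_n -> K)
    (A B : J -> 'M[K]_m) (p : 'rV[K]_n) : torus p ->
  (forall j, smooth (@torus n) (phi j)) -> (forall j, phi j p != 0) ->
  exists (U : @domain K n) (Y : J -> 'I_m -> K -> K),
  [/\ dom_pt U = p, forall z, U z -> torus z, forall j a, Y j a (phi j p) = 1 &
    forall j z, U z -> phi j z != 0 /\ forall a, is_derive (phi j z) 1 (Y j a)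
       (\sum_a' (A j a a' / phi j z + B j a a') * Y j a' (phi j z))].
Proof.
move=> p0 sphi phi0.
have /choice[dY dYP] : forall j, exists dY : K * ('I_m -> K -> K),
  [/\ 0 < dY.1, forall a, dY.2 a (phi j p) = 1 &
    forall s, `|s - phi j p| < dY.1 -> s != 0 /\ forall a,
      is_derive s 1 (dY.2 a) (\sum_a' (A j a a' / s + B j a a') * dY.2 a' s)].
  (* The initial value 1 in every component makes T, H and Z nonzero at [p], as the independence
     proof requires. *)
  move=> j; have [delta [Y H]] := fuchs_solution K_complete (A j) (B j) (fun=> 1) (phi0 j).
  by exists (delta, Y).
have near_phi : nbhs p [set z | torus z /\ forall j, `|phi j z - phi j p| < (dY j).1].
  apply: filterS2 (nbhs_torus p0) _ => [z tz H|]; first by split=> //; exact: H.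
  apply: (@filter_forall _ _ (fun j z => is_true (`|phi j z - phi j p| < (dY j).1)) (nbhs p)) => j.
  have [d0 _ _] := dYP j.
  have /differentiable_continuous/cvgrPdist_lt/(_ _ d0) :=
    smooth_diff (@open_torus n) (sphi j) p0.
  by apply: filterS => z; rewrite distrC.
move: near_phi; rewrite nbhsE => -[B' [oB' pB'] B'sub].
exists (Domain oB' pB'), (fun j => (dY j).2); split => //.
- by move=> z /B'sub[].
- by move=> j a; have [_ ->] := dYP j.
- by move=> j z /B'sub[_ /(_ j)]; have [_ _ H] := dYP j; exact: H.
Qed.

Lemma germ_free_fin n (U : @domain K n) (J : finType) (F : J -> germ U) :
  (forall c : J -> K, near_zero (U := U) (\sum_j germ_cst U (c j) * F j) ->
     forall j, c j = 0) ->
  free_germs (dom_pt U) (fun k : 'I_#|J| => F (enum_val k)).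
Proof.
move=> Ff; apply: germ_free => c Zc k.
rewrite -(enum_valK k); apply: (Ff (fun j => c (enum_rank j))).
rewrite (reindex (@enum_val _ J)) /=; last exact: onW_bij (enum_val_bij J).
by under eq_bigr do rewrite enum_valK.
Qed.

Section Adb.
Variables (d b k s : nat) (p : 'rV[K]_(2 * d - 1)).
Hypotheses (d0 : (0 < d)%N) (b2 : (2 <= b)%N) (s1 : (s <= 1)%N) (p0 : torus p).
Local Notation n := (2 * d - 1)%N.
Local Notation N := (b - s)%N.

Definition tau_fun (i : 'I_(d - 1)) (z : 'rV[K]_n) : K :=
  z 0 (col_z d0) * (- z 0 (col_x i) * (z 0 (col_y i))^-1) ^+ b.

Lemma smooth_tau i : smooth (@torus n) (tau_fun i).
Proof.
apply: smooth_mul; first exact: smooth_coord.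
apply: smooth_exp; apply: smooth_mul.
  apply: (smooth_eq (f := fun z => -1 * z 0 (col_x i))).
    by apply: smooth_mul; [exact: smooth_cst|exact: smooth_coord].
  by move=> z _; rewrite mulN1r.
by apply: smooth_inv; [exact: smooth_coord|move=> z; apply].
Qed.

Lemma tau_fun_neq0 i z : torus z -> tau_fun i z != 0.
Proof.
by move=> tz; rewrite mulf_neq0 // expf_neq0 // mulf_neq0 ?oppr_eq0 ?invr_eq0.
Qed.

(* Index inl (i, l) is the system of the solutions of the block i; index inr c
   is the scalar equation b z Z' = (k - c) Z. *)
Local Notation J := ('I_(d - 1) * 'I_N + bool)%type.

Definition sys_fun (j : J) : 'rV[K]_n -> K :=
  if j is inl q then tau_fun q.1 else fun z => z 0 (col_z d0).

Definition sysA (j : J) : 'M[K]_4 := match j with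
  | inl q => @Solutions.fuchsA K b k q.2
  | inr c => ((k%:R - c%:R) / b%:R)%:M
  end.

Definition sysB (j : J) : 'M[K]_4 :=
  if j is inl q then @Solutions.fuchsB K b s q.2 else 0.

Lemma solution_data : exists (U : @domain K n)
  (inv : 'I_n -> germ_alg U) (F : 'I_(d - 1) -> nat -> 'I_4 -> germ_alg U)
  (Z : bool -> germ_alg U),
  [/\ dom_pt U = p,
    forall c, da_var (germ_alg U) c * inv c = 1,
    forall i l, (l < N)%N -> forall c a, da_D c (F i l a) =
      da_D c (@Solutions.tau _ d b (germ_alg U) d0 inv i) *
      \sum_a' (da_cst (germ_alg U) (@Solutions.fuchsA K b k l a a') *
         @Solutions.tau_inv _ d b (germ_alg U) d0 inv i +
         da_cst (germ_alg U) (@Solutions.fuchsB K b s l a a')) * F i l a',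
    forall i l, (l < N)%N -> forall a, germ_eval p (F i l a) = 1 &
    [/\ forall e j, da_D (col_x j) (Z e) = 0 /\ da_D (col_y j) (Z e) = 0,
        forall e : bool, b%:R * (da_var (germ_alg U) (col_z d0) * da_D (col_z d0) (Z e)) + e%:R * Z e = k%:R * Z e &
        forall e, germ_eval p (Z e) = 1]].
Proof.
have [|j|U [Y [Up Ut Y1 Yd]]] :=
    @fuchs_domain n 4 J sys_fun sysA sysB p p0 _ _.
- by case=> [q|e] /=; [exact: smooth_tau|exact: smooth_coord].
- by case: j => [q|e] /=; [exact: tau_fun_neq0|exact: p0].
have inv_nz c z : U z -> z 0 c != 0 by move=> /Ut.
pose inv c : germ U := mk_germ (smooth_inv (smooth_coord (dom_set U) c) (inv_nz c)).
have invP c : germ_var U c * inv c = 1.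
  apply: germP => z Uz; rewrite germM // germ1 // germ_varE // mk_germE //.
  by rewrite divff // inv_nz.
pose rh i : germ U := Solutions.rho (W := germ_alg U) inv i.
have rhE i z : U z -> rh i z = - z 0 (col_x i) * (z 0 (col_y i))^-1.
  move=> Uz; rewrite /rh /Solutions.rho [LHS]germM // germN // germ_varE //.
  by rewrite mk_germE.
pose ta i : germ U := @Solutions.tau _ d b (germ_alg U) d0 inv i.
have taE i z : U z -> ta i z = tau_fun i z.
  move=> Uz; rewrite /ta /Solutions.tau [LHS]germM // germ_varE //.
  by rewrite [X in _ * X]germX // -/(rh i) rhE.
have taV i : ta i * (@Solutions.tau_inv _ d b (germ_alg U) d0 inv i : germ U) = 1.
  exact: (Solutions.tau_invP (W := germ_alg U) d0 invP).
have blocks (i : 'I_(d - 1)) (l : nat) : exists Fil : 'I_4 -> germ_alg U, (l < N)%N ->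
    (forall c a, da_D c (Fil a) = da_D c (ta i : germ_alg U) *
      \sum_a' (da_cst (germ_alg U) (@Solutions.fuchsA K b k l a a') *
         @Solutions.tau_inv _ d b (germ_alg U) d0 inv i +
         da_cst (germ_alg U) (@Solutions.fuchsB K b s l a a')) * Fil a') /\
    forall a, germ_eval p (Fil a) = 1.
  (* A dummy value for l >= N, where no equation is asked. *)
  have [lN|lN] := ltnP l N; last by exists (fun=> 0).
  pose j : J := inl (i, Ordinal lN).
  have Yd' z : U z -> ta i z != 0 /\ forall a, is_derive (ta i z) 1 (Y j a)
      (\sum_a' (sysA j a a' / ta i z + sysB j a a') * Y j a' (ta i z)).
    by move=> Uz; rewrite taE //; exact: (Yd j).
  have [Fil [FE FD]] := fuchs_germs (taV i) Yd'.
  exists Fil => _; split => // a.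
  rewrite /germ_eval FE; last by rewrite -Up; exact: dom_ptP.
  by rewrite taE ?(Y1 j) //; rewrite -Up; exact: dom_ptP.
have /choice[F FP] : forall i, exists Fi : nat -> 'I_4 -> germ_alg U, forall l, (l < N)%N ->
    (forall c a, da_D c (Fi l a) = da_D c (ta i : germ_alg U) *
      \sum_a' (da_cst (germ_alg U) (@Solutions.fuchsA K b k l a a') *
         @Solutions.tau_inv _ d b (germ_alg U) d0 inv i +
         da_cst (germ_alg U) (@Solutions.fuchsB K b s l a a')) * Fi l a') /\
    forall a, germ_eval p (Fi l a) = 1.
  by move=> i; have /choice[Fi FiP] := blocks i; exists Fi.
pose zv : germ U := germ_var U (col_z d0).
have mono (e : bool) : exists Z : germ_alg U,
    [/\ forall j, da_D (col_x j) Z = 0 /\ da_D (col_y j) Z = 0,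
        b%:R * (da_var (germ_alg U) (col_z d0) * da_D (col_z d0) Z) + e%:R * Z = k%:R * Z &
        germ_eval p Z = 1].
  pose j : J := inr e.
  have Yd' z : U z -> zv z != 0 /\ forall a, is_derive (zv z) 1 (Y j a)
      (\sum_a' (sysA j a a' / zv z + sysB j a a') * Y j a' (zv z)).
    by move=> Uz; rewrite germ_varE //; exact: (Yd j).
  have [Fe [FE FD]] := fuchs_germs (invP (col_z d0)) Yd'.
  (* The matrix of this system is scalar, so its four components are decoupled; component 0 plays
     the role of z^((k - e) / b). *)
  exists (Fe 0); split.
  - by move=> i; rewrite !FD !da_Dvar eq_col_xz eq_col_yz !mul0r.
  - rewrite FD da_Dvar eqxx mul1r.
    have -> : \sum_a' (germ_cst U (sysA j 0 a') * inv (col_z d0) +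
       germ_cst U (sysB j 0 a')) * (Fe a' : germ U) =
      germ_cst U ((k%:R - e%:R) / b%:R) * inv (col_z d0) * (Fe 0 : germ U).
      rewrite (bigD1 0) //= big1 ?addr0 => [|a a0].
        by rewrite !mxE eqxx mulr1n rmorph0 addr0.
      by rewrite !mxE eq_sym (negPf a0) mulr0n !rmorph0 mul0r addr0 mul0r.
    have bK : b%:R != 0 :> K by rewrite pnatr_eq0; lia.
    set cc := germ_cst U _.
    have ccE : (b%:R : germ U) * cc = k%:R - e%:R.
      rewrite /cc -(rmorph_nat (germ_cst U)) -rmorphM mulrCA divff // mulr1.
      by rewrite rmorphB !rmorph_nat.
    have -> : (b%:R : germ U) * (da_var (germ_alg U) (col_z d0) *
        (cc * inv (col_z d0) * (Fe 0 : germ U))) =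
      ((b%:R : germ U) * cc) * ((germ_var U (col_z d0) * inv (col_z d0)) * (Fe 0 : germ U)).
      by rewrite /=; ring.
    by rewrite ccE invP; ring.
  - rewrite /germ_eval FE; last by rewrite -Up; exact: dom_ptP.
    by rewrite germ_varE ?(Y1 j) //; rewrite -Up; exact: dom_ptP.
have /choice[Z ZP] := mono.
exists U, inv, F, Z; split => //.
- by move=> i l lN; have [] := FP i l lN.
- by move=> i l lN; have [] := FP i l lN.
- split=> [e j|e|e]; have [] := ZP e => //.
Qed.

End Adb.
End SolutionFamilies.

(** * Lower bounds for the dimension of the solution space *)

Section RankLowerBound.
Context (R : realType) {K : numFieldType}.
Hypothesis K_complete : forall (a : nat -> K) (M : K),
  (forall n, `|a n| <= M / 2 ^+ n) -> exists l : K, series a @ \oo --> l.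

Lemma sol_dim_ge n (I : Weyl.weyl K n -> Prop) p m (F : 'I_m -> 'rV[K]_n -> K) :
  (forall k, solution_germ I p (F k)) -> free_germs p F ->
  (m%:R%:E <= sol_dim R I p)%E.
Proof.
move=> sF fF; apply: ereal_sup_ubound; exists m => //.
by exists F.
Qed.

Section Bounds.
Variables (d b k : nat) (p : 'rV[K]_(2 * d - 1)) (beta : 'cV[K]_d).
Hypotheses (d0 : (0 < d)%N) (b2 : (2 <= b)%N) (p0 : torus p).
Hypothesis beta_last : beta (row_last d0) 0 = k%:R.
Local Notation I := (Weyl.hyp_ideal (Adb d b) beta).

Lemma sol_dim_ge_last : (forall j, beta (row_of j) 0 = 0) ->
  (((d - 1) * b)%:R%:E <= sol_dim R I p)%E.
Proof.
move=> bj.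
have [U [inv [F [Z [Up X_inv FD F1 [Zxy Zz Z1]]]]]] :=
  solution_data K_complete k d0 b2 (leq0n 1) p0.
pose J : finType := ('I_(d - 1) * 'I_(b - 0))%type.
pose G (j : J) : germ U := @Solutions.gsol _ _ (germ_alg U) inv j.1 k (F j.1 j.2 (inord 2)).
have cJ : #|J| = ((d - 1) * b)%N by rewrite card_prod !card_ord subn0.
rewrite -cJ -Up; apply: (@sol_dim_ge _ _ _ _ (fun q => G (enum_val q))).
  move=> q; apply: germ_solution => P IP.
  exact: (Solutions.gsol_annihilated b2 X_inv (leq0n 1) FD _ (ltn_ord _) erefl bj beta_last).
apply: (@germ_free_fin _ _ U J G) => c Zc [i l].
(* The coefficients are extended by 0 to all natural numbers, the form that [Z_gsol] takes. *)
pose c' i m := if insub m is Some l then c (i, l) else 0.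
have cE i' l' : c' i' (l' : 'I__) = c (i', l') by rewrite /c' valK.
rewrite -cE; apply: (Solutions.Z_gsol b2 X_inv (leq0n 1) FD
  (Z := @near_zero _ _ U) (e := germ_eval_rmorphism (dom_ptP U))) => //.
- exact: near_zeroD.
- exact: near_zeroM.
- exact: near_zeroDer.
- exact: near_zero_eval.
- by move=> a; apply: germ_cstE; exact: dom_ptP.
- by move=> i' l' l'b; rewrite -(F1 i' l' l'b 0) -Up.
- by move=> i' l' l'b; rewrite -(F1 i' l' l'b 1) -Up.
apply: (eq_ind _ (@near_zero _ _ U) Zc); apply: esym.
rewrite pair_big /=; apply: eq_bigr => -[i' l'] _.
by rewrite cE.
Qed.

Lemma sol_dim_ge_shift (o : 'I_(d - 1)) : (forall j, beta (row_of j) 0 = (j == o)%:R) ->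
  (((d - 1) * (b - 1) + 2)%:R%:E <= sol_dim R I p)%E.
Proof.
move=> bj.
have [U [inv [F [Z [Up X_inv FD F1 [Zxy Zz Z1]]]]]] :=
  solution_data K_complete k d0 b2 (leqnn 1) p0.
pose J : finType := ('I_(d - 1) * 'I_(b - 1) + bool)%type.
pose G (j : J) : germ U := match j with
  | inl q => @Solutions.fsol _ _ (germ_alg U) inv q.1 k (F q.1 q.2 (inord 2))
      (F q.1 q.2 (inord 3)) o
  | inr false => da_var (germ_alg U) (col_x o) * Z false
  | inr true => da_var (germ_alg U) (col_y o) * Z true
  end.
have Z0z : b%:R * (da_var (germ_alg U) (col_z d0) * da_D (col_z d0) (Z false)) = k%:R * Z false.
  by have := Zz false; rewrite mul0r addr0.
have Z1z : b%:R * (da_var (germ_alg U) (col_z d0) * da_D (col_z d0) (Z true)) + Z true = k%:R * Z true.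
  by have := Zz true; rewrite mul1r.
have cJ : #|J| = ((d - 1) * (b - 1) + 2)%N by rewrite card_sum card_prod !card_ord card_bool.
rewrite -cJ -Up; apply: (@sol_dim_ge _ _ _ _ (fun q => G (enum_val q))).
  move=> q; apply: germ_solution => P IP; case: (enum_val q) => [j|[]] /=.
  - exact: (Solutions.fsol_annihilated b2 X_inv (leqnn 1) FD _ (ltn_ord _) erefl bj beta_last).
  - exact: (Solutions.yZ1_annihilated b2 (Zxy true) Z1z bj beta_last).
  - exact: (Solutions.xZ0_annihilated b2 (Zxy false) Z0z bj beta_last).
apply: (@germ_free_fin _ _ U J G) => c Zc.
pose c' i m := if insub m is Some l then c (inl (i, l)) else 0.
have cE i' l' : c' i' (l' : 'I__) = c (inl (i', l')) by rewrite /c' valK.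
have [||||||||||c0 cf ct] := Solutions.Z_fsol b2 X_inv (leqnn 1) FD
  (Z := @near_zero _ _ U) (e := germ_eval_rmorphism (dom_ptP U)) _ _ _ _ _ _ _
  (c := c') (c0 := c (inr false)) (c1 := c (inr true)) (o := o) (Zxy false) (Zxy true) _ _ _.
- exact: near_zeroD.
- exact: near_zeroM.
- exact: near_zeroDer.
- exact: near_zero_eval.
- by move=> a; apply: germ_cstE; exact: dom_ptP.
- by move=> i' l' l'b; rewrite -(F1 i' l' l'b 0) -Up.
- by move=> i' l' l'b; rewrite -(F1 i' l' l'b 1) -Up.
- by rewrite -(Z1 false) -Up.
- by rewrite -(Z1 true) -Up.
- apply: (eq_ind _ (@near_zero _ _ U) Zc); apply: esym.
  rewrite big_sumType big_bool /= [X in _ = _ + X]addrC addrA; congr (_ + _ + _).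
  rewrite pair_big /=; apply: eq_bigr => -[i' l'] _.
  by rewrite cE.
by case=> [[i l]|[]] //; rewrite -cE c0.
Qed.

End Bounds.
End RankLowerBound.
(** * The volume *)

Section NonnegativeIntegral.
Context d (T : measurableType d) (R : realType) (mu : {measure set T -> \bar R}).
Local Open Scope ereal_scope.

(** The integral of a nonnegative function is a supremum over the simple functions below it, hence
    monotone for arbitrary functions. The polytope can thus be compared with [region] as a bare
    set. *)
Lemma le_integral_nonmeasurable (f g : T -> \bar R) :
  (forall x, 0 <= f x) -> (forall x, f x <= g x) ->
  \int[mu]_x f x <= \int[mu]_x g x.
Proof.
move=> f0 fg; rewrite !ge0_integralTE // => [|x]; last exact: le_trans (f0 x) (fg x).
apply: le_ereal_sup => _ [h hf <-]; exists h => // x.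
exact: le_trans (hf x) (fg x).
Qed.

End NonnegativeIntegral.

Section Volume.
Context {R : realType}.
Local Notation mu := (@lebesgue_measure R).

Lemma lebesgue_tuple_ge0 m (S : set (m.-tuple R)) : (0 <= lebesgue_tuple S)%E.
Proof.
elim: m S => [|m IH] S /=; first by rewrite lee_fin.
by apply: integral_ge0 => x _; exact: IH.
Qed.

Lemma lebesgue_tupleS m (S : set (m.+1.-tuple R)) : lebesgue_tuple S =
  (\int[mu]_x lebesgue_tuple [set t : m.-tuple R | S (cons_tuple x t)])%E.
Proof.
apply: eq_integral => x _ /=; congr lebesgue_tuple.
by apply/seteqP; split => t /=; rewrite xsectionE.
Qed.

Lemma lebesgue_tuple0 m : lebesgue_tuple (set0 : set (m.-tuple R)) = 0%E.
Proof.
elim: m => [|m IH] /=; first by rewrite dirac0.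
apply: integral0_eq => x _ /=.
rewrite (_ : xsection _ _ = set0) //.
by apply/seteqP; split => t //=; rewrite xsectionE.
Qed.

Lemma le_lebesgue_tuple m (S S' : set (m.-tuple R)) : S `<=` S' ->
  (lebesgue_tuple S <= lebesgue_tuple S')%E.
Proof.
elim: m S S' => [|m IH] S S' SS' /=.
  rewrite !diracE lee_fin ler_nat; case: (boolP (_ \in S)) => // /set_mem/SS'/mem_set.
  by move=> ->.
apply: le_integral_nonmeasurable => x; first exact: lebesgue_tuple_ge0.
apply: IH => t; rewrite /= !xsectionE /=; exact: SS'.
Qed.

Variable b : nat.

(* Vertical fibres over the simplex: with a the remaining mass and c the mass
   already used, the height is at most (used mass) + b (unused mass). *)
Fixpoint region (m : nat) (a c : R) (s : seq R) : Prop :=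
  match m, s with
  | 0, h :: _ => 0 <= h <= b%:R * a + c
  | m'.+1, y :: s' => 0 <= y <= a /\ region m' (a - y) (c + y) s'
  | _, _ => False
  end.

(** Over the simplex where the m coordinates have sum at most a, the functions 1, sum and a - sum
    integrate to a^m / m!, m a^(m+1) / (m+1)! and a^(m+1) / (m+1)!. *)
Definition region_volume (m : nat) (a c : R) : R :=
  a ^+ m / m`!%:R * c + a ^+ m.+1 * (m + b)%:R / m.+1`!%:R.

Definition region_poly (m : nat) (a c : R) : {poly R} :=
  let q := a%:P - 'X in
  (m`!%:R^-1)%:P * (q ^+ m * (c%:P + 'X)) + ((m + b)%:R / m.+1`!%:R)%:P * q ^+ m.+1.

Lemma region_polyE m a c y :
  (region_poly m a c).[y] = region_volume m (a - y) (c + y).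
Proof.
by rewrite /region_poly /region_volume !hornerE /=; ring.
Qed.

(** The family reproduces itself under slicing: the volume in dimension one higher, with the sign
    reversed, is a primitive of the slice volumes. *)
Lemma deriv_region_poly m a c :
  deriv (- region_poly m.+1 a c) = region_poly m a c.
Proof.
have fS k : k.+1`!%:R^-1 * k.+1%:R = k`!%:R^-1 :> R.
  rewrite factS natrM invfM mulrAC mulVf ?mul1r // pnatr_eq0 //.
have fm := fS m; have fm1 := fS m.+1.
have dq k : deriv ((a%:P - 'X) ^+ k.+1) = - (k.+1%:R * (a%:P - 'X) ^+ k) :> {poly R}.
  by rewrite deriv_exp derivB derivC derivX sub0r mulN1r mulNrn mulr_natl.
rewrite /region_poly derivN derivD !deriv_mulC (derivM (_ ^+ m.+1)) !dq derivD derivC derivX.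
rewrite !add0r; set q := _ - 'X.
have e1 : (m.+1`!%:R^-1)%:P * m.+1%:R = (m`!%:R^-1)%:P :> {poly R}.
  by rewrite -polyC_natr -polyCM fm.
have e2 : ((m.+1 + b)%:R / m.+2`!%:R)%:P * m.+2%:R =
   ((m + b)%:R / m.+1`!%:R)%:P + (m.+1`!%:R^-1)%:P :> {poly R}.
  rewrite -polyC_natr -polyCM -polyCD -mulrA fm1 addSn -natr1.
  by congr (_%:P); ring.
set F1 := (m.+1`!%:R^-1)%:P in e1 e2 *; set F2 := (_ / m.+2`!%:R)%:P in e2 *.
transitivity ((F1 * m.+1%:R) * (q ^+ m * (c%:P + 'X)) +
  (F2 * m.+2%:R - F1) * q ^+ m.+1); first by ring.
by rewrite e1 e2 addrK.
Qed.

Lemma integral_region m (a c : R) : 0 <= a ->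
  (\int[mu]_(y in `[0%R, a]) (region_volume m (a - y) (c + y))%:E =
   (region_volume m.+1 a c)%:E)%E.
Proof.
(* The fundamental theorem is applied on a nondegenerate interval, so the case a = 0 is treated
   apart. *)
move=> a0; have [->|an0] := eqVneq a 0.
  by rewrite set_itv1 integral_set1 /region_volume !expr0n !mul0r addr0.
have agt0 : 0 < a by rewrite lt_neqAle eq_sym an0.
under eq_integral do rewrite -region_polyE.
rewrite (@continuous_FTC2 _ _ (horner (- region_poly m.+1 a c))) //.
- rewrite !hornerN !region_polyE subrr subr0 addr0 -EFinB; congr (_%:E).
  by rewrite /region_volume !exprS; ring.
- apply: continuous_subspaceT; exact: continuous_horner.
- split.
  + by move=> x _; exact: derivable_horner.
  + by apply: cvg_at_right_filter; exact: continuous_horner.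
  + by apply: cvg_at_left_filter; exact: continuous_horner.
- by move=> x _; rewrite -derivE deriv_region_poly.
Qed.

Lemma lebesgue_region m (a c : R) : 0 <= a -> 0 <= c ->
  lebesgue_tuple [set t : m.+1.-tuple R | region m a c t] =
  (region_volume m a c)%:E.
Proof.
elim: m a c => [|m IH] a c a0 c0.
  rewrite lebesgue_tupleS.
  transitivity (\int[mu]_x (\1_(`[0%R, (b%:R * a + c)%R]%classic) x)%:E)%E.
    apply: eq_integral => x _ /=; rewrite diracE indicE.
    suff -> : ([tuple] \in [set t : 0.-tuple R | region 0 a c (cons_tuple x t)]) =
      (x \in `[0%R, (b%:R * a + c)%R]%classic) by [].
    apply/idP/idP.
      by move=> /set_mem /= H; rewrite mem_set //= in_itv.
    by move=> /set_mem; rewrite /= in_itv /= => H; rewrite mem_set.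
  have bac : 0 <= b%:R * a + c by rewrite addr_ge0 ?mulr_ge0.
  rewrite integral_indic // setIT.
  rewrite [LHS]lebesgue_measure_itv /= lte_fin.
  rewrite /region_volume expr0 expr1 fact0 add0n factS fact0 muln1 divr1 mul1r.
  rewrite [b%:R * a]mulrC addrC divr1.
  case: ltP => [_|bac0]; first by rewrite oppr0 adde0 addrC.
  by congr (_%:E); apply/eqP; rewrite eq_le bac0 andbT addrC mulrC.
apply: etrans (lebesgue_tupleS _) _.
rewrite -integral_region // [RHS]integral_mkcond.
apply: eq_integral => y _; rewrite patchE.
case: ifPn => [/set_mem ya|/negP ya].
  move: ya; rewrite [X in X -> _]/= in_itv => /andP[y0 ya].
  rewrite -IH ?subr_ge0 ?addr_ge0 //.
  suff -> : [set t : m.+1.-tuple R |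
      [set u : m.+2.-tuple R | region m.+1 a c u] (cons_tuple y t)] =
    [set t : m.+1.-tuple R | region m (a - y) (c + y) t] by [].
  apply/seteqP; split => t; first by case.
  by move=> rt; split => //; apply/andP.
suff -> : [set t : m.+1.-tuple R |
      [set u : m.+2.-tuple R | region m.+1 a c u] (cons_tuple y t)] = set0.
  exact: lebesgue_tuple0.
apply/seteqP; split => t //= -[ya' _].
by apply: ya; rewrite mem_set //= in_itv.
Qed.

(** Passing from (a, c) to (a - y, c + y) at each coordinate leaves the bound on the height
    unchanged. *)
Lemma region_coord m (a c : R) (s : seq R) : size s = m.+1 ->
  (forall i, (i < m)%N -> 0 <= s`_i) -> \sum_(i < m) s`_i <= a ->
  0 <= s`_m <= \sum_(i < m) s`_i + b%:R * (a - \sum_(i < m) s`_i) + c ->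
  region m a c s.
Proof.
elim: m a c s => [|m IH] a c [|y s] //= [sm].
  by move=> _ _; rewrite big_ord0 subr0 add0r.
move=> s0; rewrite !big_ord_recl /= => sa sh.
have sum0 : 0 <= \sum_(i < m) s`_i by apply: sumr_ge0 => i _; exact: (s0 i.+1 (ltn_ord i)).
have y0 : 0 <= y := s0 0%N isT.
split; first by rewrite y0 /=; lra.
apply: IH => // [i im||]; first exact: (s0 i.+1 im).
  by rewrite lerBrDl.
move/andP: sh => [-> sh] /=; apply: le_trans sh _; rewrite le_eqVlt; apply/orP; left.
by apply/eqP; rewrite /bump /=; ring.
Qed.

Section Polytope.
Variables (d : nat).
Hypothesis d0 : (0 < d)%N.

(** A bound for a linear form on the hull is its bound on the generators; the four hypotheses are
    its values at 0 and at the three kinds of columns. *)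
Lemma newton_polytope_le (u : 'I_(d - 1) -> R) (l e : R) (v : 'cV[R]_d) :
  0 <= e -> (forall j, u j <= e) -> (forall j, u j + l <= e) -> l * b%:R <= e ->
  newton_polytope (Adb d b) v ->
  \sum_j u j * v (row_of j) 0 + l * v (row_last d0) 0 <= e.
Proof.
move=> e0 ue ule be [q [w [y [w0 w1 Sy ->]]]].
have sumD (i : 'I_(d - 1)) : \sum_j u j * (i == j)%:R = u i.
  rewrite (bigD1 i) //= eqxx mulr1 big1 ?addr0 // => j /negPf ji.
  by rewrite eq_sym ji mulr0.
have sumD' (i : 'I_(d - 1)) : \sum_j u j * ((j == i)%:R)%:~R = u i.
  rewrite -[RHS]sumD; apply: eq_bigr => j _.
  by rewrite eq_sym; case: eqP; rewrite ?mulr1z ?mulr0z.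
have ye i : \sum_j u j * y i (row_of j) 0 + l * y i (row_last d0) 0 <= e.
  case: (Sy i) => [->|[c _ <-]].
    by rewrite mxE mulr0 addr0 big1 // => j _; rewrite mxE mulr0.
  have cE i' : map_mx intr (col c (Adb d b)) i' 0 = (Adb d b i' c)%:~R :> R.
    by rewrite mxE mxE.
  under eq_bigr do rewrite cE.
  rewrite cE.
  case: (columnP d0 c) => [j|j|] ->.
  - under eq_bigr do rewrite Adb_rx.
    by rewrite sumD' Adb_lx mulr0 addr0.
  - under eq_bigr do rewrite Adb_ry.
    by rewrite sumD' Adb_ly mulr1.
  - under eq_bigr do rewrite Adb_rz mulr0.
    by rewrite big1 // add0r Adb_lz natz -pmulrn.
have -> : \sum_j u j * (\sum_i w i *: y i) (row_of j) 0 +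
    l * (\sum_i w i *: y i) (row_last d0) 0 =
    \sum_i w i * (\sum_j u j * y i (row_of j) 0 + l * y i (row_last d0) 0).
  rewrite summxE mulr_sumr.
  under eq_bigr do rewrite summxE mulr_sumr.
  rewrite exchange_big -big_split /=; apply: eq_bigr => i _.
  rewrite mulrDr mulr_sumr mxE; congr (_ + _); last by ring.
  by apply: eq_bigr => j _; rewrite mxE; ring.
rewrite -[leRHS]mul1r -w1 mulr_suml; apply: ler_sum => i _.
exact: ler_wpM2l.
Qed.

Hypothesis b0 : (0 < b)%N.

(** The form of the last inequality takes the values b - 1, b, b on the three kinds of columns. *)
Lemma newton_polytopeP (v : 'cV[R]_d) : newton_polytope (Adb d b) v ->
  [/\ forall j, 0 <= v (row_of j) 0, \sum_j v (row_of j) 0 <= 1,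
      0 <= v (row_last d0) 0 &
      v (row_last d0) 0 + (b - 1)%:R * \sum_j v (row_of j) 0 <= b%:R].
Proof.
move=> Pv; have b1 : (b - 1)%:R = b%:R - 1 :> R by rewrite natrB.
have br : 1 <= b%:R :> R by rewrite ler1n.
split.
- move=> j; rewrite -oppr_le0.
  apply: le_trans (@newton_polytope_le (fun i => - (i == j)%:R) 0 0 v _ _ _ _ Pv).
  + rewrite (bigD1 j) //= eqxx mulN1r big1 => [|i /negPf ->]; last first.
      by rewrite oppr0 mul0r.
    by rewrite mul0r !addr0.
  + exact: lexx.
  + by move=> i; rewrite oppr_le0.
  + by move=> i; rewrite addr0 oppr_le0.
  + by rewrite mul0r.
- apply: le_trans (@newton_polytope_le (fun=> 1) 0 1 v _ _ _ _ Pv) => //.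
  + by under [in leRHS]eq_bigr do rewrite mul1r; rewrite mul0r addr0.
- rewrite -oppr_le0.
  apply: le_trans (@newton_polytope_le (fun=> 0) (-1) 0 v _ _ _ _ Pv) => //.
  + by rewrite big1 ?add0r ?mulN1r // => i _; rewrite mul0r.
- apply: le_trans (@newton_polytope_le (fun=> (b - 1)%:R) 1 b%:R v _ _ _ _ Pv) => //.
  + by rewrite -mulr_sumr mul1r addrC.
  + by move=> i; rewrite b1; lra.
  + by move=> i; rewrite b1; lra.
  + by rewrite mul1r.
Qed.

Lemma normalized_volume_le :
  (@normalized_volume R _ _ (Adb d b) <= (d - 1 + b)%:R%:E)%E.
Proof.
rewrite /normalized_volume /euclidean_volume.
apply: (@le_trans _ _ (d`!%:R%:E * (region_volume (d - 1) 1 0)%:E)%E); last first.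
  rewrite -EFinM lee_fin /region_volume mulr0 add0r expr1n mul1r.
  by rewrite -[X in X`!](ltn_predK d0) subn1 mulrCA divff ?mulr1 // pnatr_eq0 -lt0n fact_gt0.
apply: lee_wpmul2l; first by rewrite lee_fin.
have -> : (region_volume (d - 1) 1 0)%:E =
    lebesgue_tuple [set t : d.-tuple R | region (d - 1) 1 0 t].
  by case: d d0 => // m _; rewrite subn1 lebesgue_region.
apply: le_lebesgue_tuple => t /newton_polytopeP[].
pose F i : R := t`_i.
have tE (i : 'I_d) : (\col_j tnth t j) i 0 = F i :> R by rewrite mxE (tnth_nth 0).
have sE : \sum_(j < d - 1) (\col_j0 tnth t j0) (row_of j) 0 = \sum_(j < d - 1) F j.
  by apply: eq_bigr => j _; rewrite tE.
rewrite sE tE => v0 v1 vl vb; apply: region_coord => //.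
- by rewrite size_tuple; lia.
- by move=> i id; have := v0 (Ordinal id); rewrite tE.
- rewrite -/(F (d - 1)%N) -/(\sum_(i < d - 1) F i) vl /=.
  by move: vb; rewrite natrB // /=; set S := \sum_(j < _) _; lra.
Qed.
End Polytope.
End Volume.
Lemma newton_polytope_int (R : realType) (d b : nat) (d0 : (0 < d)%N) (b0 : (0 < b)%N)
    (v : 'cV[int]_d) : newton_polytope (Adb d b) (map_mx (intr : int -> R) v) ->
  exists k : nat, v (row_last d0) 0 = k%:R /\
    ((forall j, v (row_of j) 0 = 0) \/
     exists o, forall j, v (row_of j) 0 = (j == o)%:R).
Proof.
move=> /(newton_polytopeP d0 b0)[v0 v1 l0 _].
have {}v0 j : 0 <= v (row_of j) 0 by have := v0 j; rewrite mxE ler0z.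
have {}v1 : \sum_j v (row_of j) 0 <= 1.
  rewrite -(ler_int R) (raddf_sum (intr : {additive int -> R})); apply: le_trans v1.
  by apply: ler_sum => j _; rewrite mxE.
rewrite mxE ler0z in l0.
exists (absz (v (row_last d0) 0)); split; first by rewrite natz gez0_abs.
have [[i vi]|nv] := pselect (exists i, v (row_of i) 0 != 0); last first.
  by left => j; apply/eqP/negP => /negP vj; apply: nv; exists j.
right; exists i.
have s0 : 0 <= \sum_(j | j != i) v (row_of j) 0 by apply: sumr_ge0.
have i1 : 1 <= v (row_of i) 0 by have := v0 i; lia.
rewrite (bigD1 i) //= in v1.
have vS j : j != i -> v (row_of j) 0 <= \sum_(j | j != i) v (row_of j) 0.
  by move=> ji; rewrite (bigD1 j) //= lerDl sumr_ge0.
move: s0 v1 vS; set S := bigop _ _ _ => s0 v1 vS j.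
case: (eqVneq j i) => [->|/vS vj]; first by rewrite mulr1n; lia.
by rewrite mulr0n; have := v0 j; lia.
Qed.

(** Here rho_i = i + 1, with i numbered from 0: nonzero and pairwise distinct, which is what
    nonsingularity asks. *)
Definition base_point (K : numFieldType) (d : nat) : 'rV[K]_(2 * d - 1) :=
  \row_c (if (c < d - 1)%N then - c.+1%:R else 1).

Lemma base_point_neq0 (K : numFieldType) d c : base_point K d 0 c != 0.
Proof. by rewrite mxE; case: ifP; rewrite ?oppr_eq0 ?pnatr_eq0 ?oner_eq0. Qed.

Lemma base_point_cross (K : numFieldType) d (i j : 'I_(d - 1)) : i != j ->
  base_point K d 0 (col_x i) * base_point K d 0 (col_y j) !=
  base_point K d 0 (col_x j) * base_point K d 0 (col_y i).
Proof.
move=> ij; rewrite !mxE /= !ltn_ord !ltnNge !leq_addr /= !mulr1 eqr_opp.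
by rewrite eqr_nat eqSS.
Qed.

Lemma holonomic_rank_gt (R : realType) (d b : nat) (hd : (3 <= d)%N) (hb : (3 <= b)%N)
    (v : 'cV[int]_d) : newton_polytope (Adb d b) (map_mx (intr : int -> R) v) ->
  ((d - 1 + b)%:R%:E <
   holonomic_rank R (Weyl.hyp_ideal (Adb d b) (map_mx (intr : int -> R[i]) v)))%E.
Proof.
move=> Pv; have d0 : (0 < d)%N by lia.
have b0 : (0 < b)%N by lia.
have b2 : (2 <= b)%N by lia.
pose K := complex_numField R; pose p := base_point K d.
set beta := map_mx _ v.
have nsp : Weyl.nonsingular (Weyl.hyp_ideal (Adb d b) beta) (p 0).
  apply: (Nonsingular.nonsingular_Adb d0) => [|c|i j ij].
  - by rewrite pnatr_eq0 -lt0n.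
  - exact: base_point_neq0.
  - exact: base_point_cross.
have tp : torus p := @base_point_neq0 K d.
have rank_ge (n : nat) : (d + b <= n)%N ->
    (n%:R%:E <= sol_dim R (Weyl.hyp_ideal (Adb d b) beta) p)%E ->
    ((d - 1 + b)%:R%:E < holonomic_rank R (Weyl.hyp_ideal (Adb d b) beta))%E.
  move=> dbn np; apply: (@lt_le_trans _ _ n%:R%:E).
    by rewrite lte_fin ltr_nat; lia.
  by apply: le_trans np _; apply: ereal_sup_ubound; exists p.
have [k [vk [v0|[j0 vj0]]]] := newton_polytope_int d0 b0 Pv.
  (* The inequality is (d - 2)(b - 1) >= 2. *)
  apply: (rank_ge ((d - 1) * b)%N); first by nia.
  refine (@sol_dim_ge_last R K (@series_dominated R) d b k p beta d0 b2 tp _ _).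
    by rewrite mxE vk natz.
  by move=> j; rewrite mxE v0.
(* The inequality is (d - 2)(b - 2) >= 1. *)
apply: (rank_ge ((d - 1) * (b - 1) + 2)%N); first by nia.
refine (@sol_dim_ge_shift R K (@series_dominated R) d b k p beta d0 b2 tp _ j0 _).
  by rewrite mxE vk natz.
by move=> j; rewrite mxE vj0 natz.
Qed.

Theorem mainTheorem5 (R : realType) (d b : nat)
    (hd : (3 <= d)%N) (hb : (3 <= b)%N) (v : 'cV[int]_d) :
  newton_polytope (Adb d b) (map_mx (intr : int -> R) v) ->
  exceptional_arrangement (Adb d b) (map_mx (intr : int -> R[i]) v).
Proof.
move=> /(holonomic_rank_gt hd hb); apply: le_lt_trans.
by apply: normalized_volume_le; lia.
Qed.
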